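(* Let $p\in\{8,10\}$. The ideal of $W_{BS}^p\subset\mathbb{P}^p$ is generated by quadrics and cubics. Furthermore, the eight singular points of $W_{BS}^{10}$ are similar, and they have the following configuration: they can be labelled $P_1,P_2,P_3,P_4,P_1',P_2',P_3',P_4'$ in such a way that any two of $P_1,P_2,P_3,P_4$ are associated, any two of $P_1',P_2',P_3',P_4'$ are associated, $P_i$ and $P_i'$ are associated for $i=1,2,3,4$, and $P_i$ and $P_j'$ are not associated for $i\neq j$.
   Context: We work over $\mathbb{C}$. Two distinct singular points of a threefold $W\subset\mathbb{P}^p$ are associated if the line joining them is contained in $W$. The configuration of the singular points is the graph recording which pairs are associated. The singular points of $W$ are similar if they have the same multiplicity, they have the same tangent cone (up to linear isomorphism), and there is an $m$ such that each of them is associated with exactly $m$ others. $W_{BS}^8$ (BS-EF 3-fold of genus $8$): in $\{x_4=0\}\cong\mathbb{P}^3\subset\mathbb{P}^4_{[x_0:\dots:x_4]}$ take two quadric surfaces $Q=q_{00}x_0^2+q_{11}x_1^2+q_{22}x_2^2+q_{33}x_3^2+q_{01}x_0x_1+q_{23}x_2x_3=0$ and $R=r_{00}x_0^2+r_{11}x_1^2+r_{22}x_2^2+r_{33}x_3^2+r_{01}x_0x_1+r_{23}x_2x_3=0$. Let $C=Q\cap R$ be the elliptic quartic curve given by their complete intersection, let $Y\subset\mathbb{P}^4$ be the cone over $Q$ with vertex $v=[0:0:0:0:1]$, and let $X\to Y$ be the blow-up of $Y$ at $v$ and along $C$; $X$ is a smooth Fano threefold. The birational map $Y\dashrightarrow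 Y$, $[x_0:x_1:x_2:x_3:x_4]\mapsto[x_4x_0:x_4x_1:-x_4x_2:-x_4x_3:R(x_0,x_1,x_2,x_3)]$, induces an involution $\sigma$ of $X$ with eight fixed points, and $W_{BS}^8:=X/\sigma$. It is embedded as the (closure of the) image of the rational map $Y\dashrightarrow\mathbb{P}^9_{[Z_0:\dots:Z_9]}$ given by $Z_0=x_0(x_4^2+R)$, $Z_1=x_1(x_4^2+R)$, $Z_2=x_2(x_4^2-R)$, $Z_3=x_3(x_4^2-R)$, $Z_4=x_4x_0^2$, $Z_5=x_4x_1^2$, $Z_6=x_4x_2^2$, $Z_7=x_4x_3^2$, $Z_8=x_4x_0x_1$, $Z_9=x_4x_2x_3$, which is contained in the hyperplane $\{q_{00}Z_4+q_{11}Z_5+q_{22}Z_6+q_{33}Z_7+q_{01}Z_8+q_{23}Z_9=0\}\cong\mathbb{P}^8$. $W_{BS}^{10}$ (BS-EF 3-fold of genus $10$): let $S_6\subset\mathbb{P}^6_{[x_0:\dots:x_6]}$ be the smooth sextic Del Pezzo surface given by the closure of the image of $\mathbb{P}^2$ via $[u_0:u_1:u_2]\mapsto[u_1^2u_2:u_1u_2^2:u_0^2u_2:u_0u_2^2:u_0^2u_1:u_0u_1^2:u_0u_1u_2]$, and let $X=\mathbb{P}^1_{[y_0:y_1]}\times S_6$. Let $\sigma$ be the involution of $X$ given by $[y_0:y_1]\times[x_0:\dots:x_6]\mapsto[y_0:-y_1]\times[x_2:x_4:x_0:x_5:x_1:x_3:x_6]$, which has eight fixed points. Then $W_{BS}^{10}:=X/\sigma$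 is embedded in $\mathbb{P}^{10}$ by the quotient map with coordinates $y_0^2x_6$, $y_0^2(x_0+x_2)$, $y_0^2(x_1+x_4)$, $y_0^2(x_3+x_5)$, $y_1^2x_6$, $y_1^2(x_0+x_2)$, $y_1^2(x_1+x_4)$, $y_1^2(x_3+x_5)$, $y_0y_1(x_0-x_2)$, $y_0y_1(x_1-x_4)$, $y_0y_1(x_3-x_5)$. Its eight singular points are the images of the fixed points of $\sigma$. *)

(* Defs.v *)
From HB Require Import structures.
From mathcomp Require Export all_boot all_order all_algebra.
From mathcomp Require Export boolp classical_sets reals.
From mathcomp Require Export complex.
From mathcomp Require Export mpoly.

Set Implicit Arguments.
Unset Strict Implicit.
Unset Printing Implicit Defensive.

Import Order.TTheory GRing.Theory Num.Theory.
Local Open Scope classical_set_scope.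
Local Open Scope ring_scope.

(* A point of P^n is given by a nonzero row vector of length n.+1, up to
   [same_point].  A subset of P^n is the set of all representatives of its
   points, i.e. a set of nonzero vectors closed under nonzero scaling. *)

Section Geometry.
Variable F : fieldType.

Definition same_point n (v w : 'rV[F]_n) : bool := (v == w)%MS.

(* Since F is infinite in the application, this ideal is homogeneous when S
   is a subset of P^n; it is also used for subsets of affine space. *)
Definition vanishing_ideal n (S : set 'rV[F]_n) : set {mpoly F[n]} :=
  [set f | forall v : 'rV[F]_n, S v -> f.@[v 0] = 0].

Definition proj_closure n (S : set 'rV[F]_n) : set 'rV[F]_n :=
  [set v : 'rV[F]_n | v != 0 /\ forall f, vanishing_ideal S f -> f.@[v 0] = 0].

(* Image in projective space of D under a rational map with coordinates phi;
   the map is undefined where phi vanishes. *)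
Definition proj_image (T : Type) n (D : set T) (phi : T -> 'rV[F]_n) :
    set 'rV[F]_n :=
  [set z | exists x, [/\ D x, phi x != 0 & same_point z (phi x)]].

Definition ideal_gen n (G : set {mpoly F[n]}) : set {mpoly F[n]} :=
  [set f | exists s : seq ({mpoly F[n]} * {mpoly F[n]}),
     (forall hg, hg \in s -> G hg.2) /\ f = \sum_(hg <- s) hg.1 * hg.2].

Definition generated_by_quadrics_and_cubics n (I : set {mpoly F[n]}) : Prop :=
  exists G : set {mpoly F[n]},
    (forall g, G g -> g \is 2.-homog \/ g \is 3.-homog) /\ I = ideal_gen G.

Definition jacobian k n (f : 'I_k -> {mpoly F[n]}) (p : 'rV[F]_n) :
    'M[F]_(k, n) :=
  \matrix_(i, j) ((f i)^`M(j)).@[p 0].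

(* The k forms f define a smooth complete intersection in projective space. *)
Definition smooth_complete_intersection k n (f : 'I_k -> {mpoly F[n]}) : Prop :=
  forall p : 'rV[F]_n, p != 0 -> (forall i, (f i).@[p 0] = 0) ->
    row_free (jacobian f p).

(* Jacobian criterion for a threefold W in P^n: p is singular when the
   gradients at p of the polynomials in the ideal of W span a space of
   dimension < n - 3. *)
Definition singular_point n (W : set 'rV[F]_n.+1) (p : 'rV[F]_n.+1) : Prop :=
  W p /\ forall f : 'I_(n - 3) -> {mpoly F[n.+1]},
    (forall i, vanishing_ideal W (f i)) -> ~~ row_free (jacobian f p).

Definition associated n (W : set 'rV[F]_n.+1) (p q : 'rV[F]_n.+1) : Prop :=
  [/\ singular_point W p, singular_point W q, ~~ same_point p q &
      forall a b : F, a *: p + b *: q != 0 -> W (a *: p + b *: q)].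

(* Affine coordinates t centred at p, on the standard chart of P^n given by
   the first nonzero coordinate of p.  Multiplicity and tangent cone are local
   notions, so the choice of the chart is immaterial. *)
Definition chart_index n (p : 'rV[F]_n.+1) : 'I_n.+1 :=
  odflt ord0 [pick i | p 0 i != 0].

Definition chart n (p : 'rV[F]_n.+1) (t : 'rV[F]_n) : 'rV[F]_n.+1 :=
  let i := chart_index p in
  \row_j (if unlift i j is Some k then p 0 j / p 0 i + t 0 k else 1).

Definition chart_ideal n (W : set 'rV[F]_n.+1) (p : 'rV[F]_n.+1) :
    set {mpoly F[n]} :=
  vanishing_ideal [set t | W (chart p t)].

(* Ideal of the tangent cone: generated by the initial forms, at the origin of
   the chart, of the equations of W. *)
Definition tangent_cone_ideal n (W : set 'rV[F]_n.+1) (p : 'rV[F]_n.+1) :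
    set {mpoly F[n]} :=
  ideal_gen [set g | exists f d,
    [/\ chart_ideal W p f,
        forall k, (k < d)%N -> pihomog mdeg k f = 0 &
        g = pihomog mdeg d f]].

Definition linearly_isomorphic n (I J : set {mpoly F[n]}) : Prop :=
  exists2 A : 'M[F]_n, A \in unitmx &
    forall f, I f <-> J (f \mPo [tuple \sum_(k < n) A j k *: 'X_k | j < n]).

(* I has codimension k in the polynomial ring, as a vector subspace. *)
Definition has_codim n (I : set {mpoly F[n]}) (k : nat) : Prop :=
  exists s : k.-tuple {mpoly F[n]},
    (forall c : 'I_k -> F,
       I (\sum_(i < k) c i *: tnth s i) -> forall i, c i = 0) /\
    (forall f, exists c : 'I_k -> F, I (f - \sum_(i < k) c i *: tnth s i)).

(* I + m^r, where m is the maximal ideal of the origin. *)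
Definition add_max_pow n (I : set {mpoly F[n]}) (r : nat) : set {mpoly F[n]} :=
  [set f | exists a b, [/\ I a, {in msupp b, forall u, (r <= mdeg u)%N} &
                           f = a + b]].

(* The quotient of the polynomial ring by [chart_ideal W p] + m^(r+1) is
   O/m^(r+1), for O the local ring of W at p.  Its length H r agrees with the
   Hilbert-Samuel polynomial h for large r, and the multiplicity of W at p is
   d! times the leading coefficient of h, where d = deg h. *)
Definition is_multiplicity n (W : set 'rV[F]_n.+1) (p : 'rV[F]_n.+1) (e : nat) :
    Prop :=
  exists (H : nat -> nat) (h : {poly rat}),
    [/\ forall r, has_codim (add_max_pow (chart_ideal W p) r.+1) (H r),
        exists N, forall r, (N <= r)%N -> (H r)%:R = h.[r%:R] &
        e%:R = ((size h).-1)`!%:R * lead_coef h].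

Definition multiplicity n (W : set 'rV[F]_n.+1) (p : 'rV[F]_n.+1) : nat :=
  xget 0%N [set e | is_multiplicity W p e].

Definition associated_with_exactly n (W : set 'rV[F]_n.+1) (p : 'rV[F]_n.+1)
    (m : nat) : Prop :=
  exists s : m.-tuple 'rV[F]_n.+1,
    (forall i j, same_point (tnth s i) (tnth s j) -> i = j) /\
    (forall q, associated W p q <-> exists i, same_point q (tnth s i)).

Definition similar_singular_points n (W : set 'rV[F]_n.+1) : Prop :=
  (forall p q, singular_point W p -> singular_point W q ->
     multiplicity W p = multiplicity W q /\
     linearly_isomorphic (tangent_cone_ideal W p) (tangent_cone_ideal W q)) /\
  (exists m, forall p, singular_point W p -> associated_with_exactly W p m).

End Geometry.

Section BayleSano.
Variable F : fieldType.

Definition row_of_seq n (s : seq F) : 'rV[F]_n := \row_(i < n) s`_i.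

(* Coefficients of c00 x0^2 + c11 x1^2 + c22 x2^2 + c33 x3^2 + c01 x0 x1
   + c23 x2 x3. *)
Record quad_coef := QuadCoef { c00 : F; c11 : F; c22 : F; c33 : F;
                               c01 : F; c23 : F }.

Definition quadric (c : quad_coef) : {mpoly F[4]} :=
  let x k : {mpoly F[4]} := 'X_(inord k) in
  c00 c *: x 0%N ^+ 2 + c11 c *: x 1%N ^+ 2 + c22 c *: x 2%N ^+ 2
  + c33 c *: x 3%N ^+ 2 + c01 c *: (x 0%N * x 1%N) + c23 c *: (x 2%N * x 3%N).

Definition quadric_at (c : quad_coef) (x : 'rV[F]_5) : F :=
  (quadric c).@[fun i : 'I_4 => x 0 (widen_ord (leqnSn 4) i)].

(* The surface Q and the curve C = Q /\ R are smooth.  This amounts to the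
   smoothness of the threefold X: blowing up the vertex turns the cone over Q
   into a P^1-bundle over Q, in which C is then blown up. *)
Definition BS8_smooth (q r : quad_coef) : Prop :=
  smooth_complete_intersection (tnth [tuple quadric q]) /\
  smooth_complete_intersection (tnth [tuple quadric q; quadric r]).

Definition quadric_cone (q : quad_coef) : set 'rV[F]_5 :=
  [set x : 'rV[F]_5 | x != 0 /\ quadric_at q x = 0].

Definition BS8_map (r : quad_coef) (v : 'rV[F]_5) : 'rV[F]_10 :=
  let x k := v 0 (inord k) in
  let x0 := x 0%N in let x1 := x 1%N in let x2 := x 2%N in
  let x3 := x 3%N in let x4 := x 4%N in
  let Rx := quadric_at r v in
  row_of_seq 10
    [:: x0 * (x4 ^+ 2 + Rx); x1 * (x4 ^+ 2 + Rx);
        x2 * (x4 ^+ 2 - Rx); x3 * (x4 ^+ 2 - Rx);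
        x4 * x0 ^+ 2; x4 * x1 ^+ 2; x4 * x2 ^+ 2; x4 * x3 ^+ 2;
        x4 * x0 * x1; x4 * x2 * x3].

Definition BS8 (q r : quad_coef) : set 'rV[F]_10 :=
  proj_closure (proj_image (quadric_cone q) (BS8_map r)).

(* The linear equation in P^9 satisfied by BS8 q r. *)
Definition BS8_hyperplane (q : quad_coef) : set 'rV[F]_10 :=
  [set v : 'rV[F]_10 | let Z k := v 0 (inord k) in
     c00 q * Z 4%N + c11 q * Z 5%N + c22 q * Z 6%N + c33 q * Z 7%N
     + c01 q * Z 8%N + c23 q * Z 9%N = 0].

(* t |-> t *m A is a linear isomorphism from F^9 onto the hyperplane, that is,
   a choice of homogeneous coordinates of P^8 on it. *)
Definition BS8_coordinates (q : quad_coef) (A : 'M[F]_(9, 10)) : Prop :=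
  row_free A /\ forall v : 'rV[F]_10, BS8_hyperplane q v <-> (v <= A)%MS.

Definition BS8_in_P8 (q r : quad_coef) (A : 'M[F]_(9, 10)) : set 'rV[F]_9 :=
  [set t | BS8 q r (t *m A)].

Definition del_pezzo6 : set 'rV[F]_7 :=
  proj_closure (proj_image [set: 'rV[F]_3] (fun v : 'rV[F]_3 =>
    let u k := v 0 (inord k) in
    let u0 := u 0%N in let u1 := u 1%N in let u2 := u 2%N in
    row_of_seq 7
      [:: u1 ^+ 2 * u2; u1 * u2 ^+ 2; u0 ^+ 2 * u2; u0 * u2 ^+ 2;
          u0 ^+ 2 * u1; u0 * u1 ^+ 2; u0 * u1 * u2])).

(* Quotient map of P^1 x S_6 by the involution
   [y0:y1] x [x0:...:x6] |-> [y0:-y1] x [x2:x4:x0:x5:x1:x3:x6]. *)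
Definition BS10_map (yx : 'rV[F]_2 * 'rV[F]_7) : 'rV[F]_11 :=
  let y k := yx.1 0 (inord k) in
  let x k := yx.2 0 (inord k) in
  let y0 := y 0%N in let y1 := y 1%N in
  let x0 := x 0%N in let x1 := x 1%N in let x2 := x 2%N in let x3 := x 3%N in
  let x4 := x 4%N in let x5 := x 5%N in let x6 := x 6%N in
  row_of_seq 11
    [:: y0 ^+ 2 * x6; y0 ^+ 2 * (x0 + x2);
        y0 ^+ 2 * (x1 + x4); y0 ^+ 2 * (x3 + x5);
        y1 ^+ 2 * x6; y1 ^+ 2 * (x0 + x2);
        y1 ^+ 2 * (x1 + x4); y1 ^+ 2 * (x3 + x5);
        y0 * y1 * (x0 - x2); y0 * y1 * (x1 - x4); y0 * y1 * (x3 - x5)].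

Definition BS10 : set 'rV[F]_11 :=
  proj_image [set yx : 'rV[F]_2 * 'rV[F]_7 | yx.1 != 0 /\ del_pezzo6 yx.2]
    BS10_map.

End BayleSano.

Arguments BS10 : clear implicits.

(* Main.v *)
Require Import Defs.
From mathcomp Require Import ring zify.

(** Both threefolds are given by a rational map whose coordinates become monomials after
    a change of variables. The relations between the monomials form a toric ideal,
    generated by 2 x 2 minors (scroll_kernel, minors_kernel); the other equations come
    from the few relations between the new variables.

    Genus 8. Where R does not vanish on the cone, put w = x4, w' = R / x4, p = w + w' and
    m = w - w'. Up to the factor x4, the coordinates are x0 p, x1 p, x2 m, x3 m and six
    quadratic monomials in the x_i, on the double cover E = p^2 - m^2 - 4 R = 0 of the
    cone Q = 0. A form that vanishes on the threefold is, modulo E, a combination of 1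
    and p with coefficients free of p; each coefficient vanishes on a dense part of Q,
    and Q is prime because its two binary parts are nondegenerate (quadric_prime,
    disc_neq0), so the form is a multiple of Q modulo E. Bounds on the degrees in p and
    m show that the cofactor is a combination of 1 and m^2 over the image of the
    coordinate ring. Now Q is the image of the linear form that defines the hyperplane,
    Q m^2 is the image of a quadric modulo E, and the multiples of E that lie in the
    image come from nine cubics with images E x_i x_j x_k x_l. These equations and the
    minors therefore generate the ideal (cover_ideal).

    Genus 10. The involution of the sextic surface has invariants s0 = x6, s1 = x0 + x2,
    s2 = x1 + x4, s3 = x3 + x5 and anti-invariants d1, d2, d3. Let M be the symmetric
    matrix with rows (2 s0, s3, s2), (s3, 2 s0, s1), (s2, s1, 2 s0), and
    e = (d1, - d2, d3). The quotient of the surface is the Cayley cubic det M = 0, and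
    on the surface M e = 0 and adj M = - e e^T. The coordinates of the threefold are
    A = y0^2 s, B = y1^2 s and C = y0 y1 d. The equations adj M = - e e^T express the
    products C_i C_j by A and B, so a form is reduced to F0 + e . F with F0 and F free
    of d. If it vanishes on the threefold, F0 is a multiple of the Cayley cubic
    (cayley_dvd), and F is a combination of the rows of M because M and adj M form a
    matrix factorization of det M (cayley_syzygy). Hence the minors of A and B, the
    quadrics given by M e = 0 and by adj M = - e e^T, and the polarizations of the
    cubic generate the ideal (torus_ideal).

    Singular points. The parts y1 = 0 and y0 = 0 of the threefold are two Cayley cubics,
    and their nodes (1, +-2, +-2, +-2), four on each, are its singular points. At any
    other point the tangent equations, together with four well chosen linear forms,
    have no common zero (smooth_boundary, smooth_interior). The line joining two nodes
    of one Cayley cubic lies in that cubic (cayley_line), and corresponding nodes are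
    joined by the image of the product of the line and a fixed point (cross_line). So
    four lines pass through each node; they span with it a space of dimension 5, which
    is too large for a smooth point (singular_of_lines). No other line joins two nodes,
    since a minor does not vanish on it (nodes_not_joined). Finally, the changes of
    signs of the coordinates of the plane and the exchange of y0 and y1 are linear
    symmetries of the threefold; they permute the eight points transitively and are
    linear in affine charts centred at them, so multiplicities and tangent cones agree
    (nodes_local). *)

Set Implicit Arguments.
Unset Strict Implicit.
Unset Printing Implicit Defensive.
Import Order.TTheory GRing.Theory Num.Theory.
Local Open Scope classical_set_scope.
Local Open Scope ring_scope.

(** * Linear combinations of equations *)

(** For use as [apply: (lincomb (eqD (eqM c e) e')); ring], where e and e' are equations:
    the two sides differ by a combination of the differences of their sides. *)
Lemma lincomb (V : zmodType) (a b u v : V) : u = v -> a - b = u - v -> a = b.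
Proof. by move=> -> /eqP; rewrite subrr subr_eq0 => /eqP. Qed.

Lemma eqD (V : zmodType) (u v u' v' : V) : u = v -> u' = v' -> u + u' = v + v'.
Proof. by move=> -> ->. Qed.

Lemma eqM (R : comPzRingType) (c u v : R) : u = v -> c * u = c * v.
Proof. by move=> ->. Qed.

(** * Ideals and their generators *)

Section Ideals.
Variables (F : fieldType).

Definition is_ideal n (J : set {mpoly F[n]}) :=
  [/\ J 0, (forall a b, J a -> J b -> J (a + b)) &
      (forall h a, J a -> J (h * a))].

Section OneIdeal.
Variables (n : nat) (J : set {mpoly F[n]}).
Hypothesis idJ : is_ideal J.

Lemma ideal0 : J 0. Proof. by case: idJ. Qed.
Lemma idealD a b : J a -> J b -> J (a + b). Proof. by case: idJ => _ h _; exact: h. Qed.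
Lemma idealM h a : J a -> J (h * a). Proof. by case: idJ => _ _; exact. Qed.
Lemma idealMr h a : J a -> J (a * h). Proof. by rewrite mulrC; exact: idealM. Qed.
Lemma idealN a : J a -> J (- a). Proof. by rewrite -mulN1r; exact: idealM. Qed.
Lemma idealZ c a : J a -> J (c *: a).
Proof. by rewrite -mul_mpolyC; exact: idealM. Qed.
Lemma ideal_sum (I : Type) (s : seq I) (P : pred I) (f : I -> {mpoly F[n]}) :
  (forall i, P i -> J (f i)) -> J (\sum_(i <- s | P i) f i).
Proof. by move=> h; apply: (big_ind J) => //; [exact: ideal0 | exact: idealD]. Qed.
Lemma ideal_trans a b c : J (a - b) -> J (b - c) -> J (a - c).
Proof. by move=> h /(idealD h); rewrite addrA subrK. Qed.
Lemma ideal_sym a b : J (a - b) -> J (b - a).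
Proof. by move=> /idealN; rewrite opprB. Qed.
Lemma ideal_congl a b : J (a - b) -> J b -> J a.
Proof. by move=> h /(idealD h); rewrite subrK. Qed.
End OneIdeal.

Lemma ideal_gen_is_ideal n (G : set {mpoly F[n]}) : is_ideal (ideal_gen G).
Proof.
split.
- by exists [::]; rewrite big_nil.
- move=> a b [s [hs ->]] [t [ht ->]]; exists (s ++ t); rewrite big_cat; split=> //.
  by move=> hg; rewrite mem_cat => /orP[/hs|/ht].
- move=> h a [s [hs ->]]; exists [seq (h * hg.1, hg.2) | hg <- s]; split.
    by move=> _ /mapP[hg /hs Ghg ->].
  by rewrite big_map mulr_sumr; apply: eq_bigr => i _; rewrite mulrA.
Qed.

Lemma sub_ideal_gen n (G : set {mpoly F[n]}) g : G g -> ideal_gen G g.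
Proof.
move=> Gg; exists [:: (1, g)]; split; last by rewrite big_seq1 mul1r.
by move=> hg; rewrite inE => /eqP ->.
Qed.

Lemma ideal_gen_min n (G J : set {mpoly F[n]}) : is_ideal J -> G `<=` J ->
  ideal_gen G `<=` J.
Proof.
move=> idJ GJ _ [s [hs ->]]; rewrite big_seq; apply: ideal_sum => // hg /hs /GJ.
exact: idealM.
Qed.

Lemma vanishing_ideal_is_ideal n (S : set 'rV[F]_n) : is_ideal (vanishing_ideal S).
Proof.
split=> [v _|a b Ja Jb v Sv|h a Ja v Sv]; first exact: meval0.
  by rewrite mevalD Ja ?Jb ?addr0.
by rewrite mevalM Ja ?mulr0.
Qed.

(** It is enough to look for generators among the quadrics and cubics of I itself. *)
Lemma generated_by_quadrics_and_cubicsI n (I : set {mpoly F[n]}) : is_ideal I ->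
  I `<=` ideal_gen [set g | I g /\ (g \is 2.-homog \/ g \is 3.-homog)] ->
  generated_by_quadrics_and_cubics I.
Proof.
move=> idI sub; eexists; split; last first.
  rewrite eqEsubset; split; first exact: sub.
  by apply: ideal_gen_min => // g [].
by move=> g [].
Qed.

End Ideals.

(** * Monomial supports *)

Section Support.
Variables (n : nat) (F : fieldType).
Implicit Types (f g : {mpoly F[n]}) (P : 'X_{1..n} -> Prop).

(** Most subspaces of polynomials met below (weight bounds, parities, absence of a
    variable) are spanned by monomials, hence described by a property of exponents. *)
Definition supp P f := forall m, m \in msupp f -> P m.

Lemma supp0 P : supp P 0. Proof. by move=> m; rewrite msupp0. Qed.
Lemma suppD P f g : supp P f -> supp P g -> supp P (f + g).
Proof. by move=> hf hg m /msuppD_le; rewrite mem_cat => /orP[/hf|/hg]. Qed.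
Lemma suppN P f : supp P f -> supp P (- f).
Proof. by move=> hf m; rewrite (perm_mem (msuppN _)) => /hf. Qed.
Lemma suppB P f g : supp P f -> supp P g -> supp P (f - g).
Proof. by move=> hf /suppN; exact: suppD. Qed.
Lemma suppZ P c f : supp P f -> supp P (c *: f).
Proof. by move=> hf m /msuppZ_le /hf. Qed.
Lemma supp_sum (I : Type) (s : seq I) (Q : pred I) (h : I -> {mpoly F[n]}) P :
  (forall i, Q i -> supp P (h i)) -> supp P (\sum_(i <- s | Q i) h i).
Proof. by move=> H; apply: (big_ind (supp P)) => //; [exact: supp0 | exact: suppD]. Qed.
Lemma suppX P m : P m -> supp P 'X_[m].
Proof. by move=> hm m'; rewrite msuppX inE => /eqP ->. Qed.
Lemma suppM P1 P2 P3 f g : supp P1 f -> supp P2 g ->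
  (forall a b, P1 a -> P2 b -> P3 (a + b)%MM) -> supp P3 (f * g).
Proof.
move=> hf hg H m /msuppM_le /allpairsP[[a b] /= [/hf ha /hg hb ->]]; exact: H.
Qed.
Lemma sub_supp P1 P2 f : (forall m, P1 m -> P2 m) -> supp P1 f -> supp P2 f.
Proof. by move=> H hf m /hf /H. Qed.
Lemma suppXM P e f : supp P ('X_[e] * f) <-> supp (fun m => P (e + m)%MM) f.
Proof.
split=> [h m mf|h m].
  apply: h; rewrite mulrC (perm_mem (msuppMX _ _)).
  by apply/mapP; exists m.
by rewrite mulrC (perm_mem (msuppMX _ _)) => /mapP[m' /h hm' ->].
Qed.
Lemma supp_contra P1 P2 f : supp P1 f -> supp P2 f -> (forall m, P1 m -> P2 m -> False) -> f = 0.
Proof.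
move=> h1 h2 H; apply/eqP; rewrite -msupp_eq0; apply/eqP.
case E: (msupp f) => [//|m s]; exfalso.
have mf : m \in msupp f by rewrite E mem_head.
exact: H (h1 _ mf) (h2 _ mf).
Qed.

Lemma supp_ind P (V : {mpoly F[n]} -> Prop) f : supp P f ->
  V 0 -> (forall a b, V a -> V b -> V (a + b)) ->
  (forall c a, V a -> V (c *: a)) -> (forall m, P m -> V 'X_[m]) -> V f.
Proof.
move=> hf V0 VD VZ VX; rewrite (mpolyE f) big_seq.
by apply: (big_ind V) => // m /hf /VX; exact: VZ.
Qed.

Definition restrict (S : pred 'X_{1..n}) f :=
  \sum_(m <- msupp f | S m) f@_m *: 'X_[m].

Lemma restrictP (S : pred _) f : supp S (restrict S f).
Proof. by apply: supp_sum => m Sm; apply: suppZ; apply: suppX. Qed.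

Lemma restrict_compl (S : pred _) f : f = restrict S f + restrict (predC S) f.
Proof. by rewrite {1}(mpolyE f) (bigID S). Qed.

Lemma restrict_uniq (S : pred 'X_{1..n}) f f1 f2 : f = f1 + f2 ->
  supp (fun m => S m) f1 -> supp (fun m => ~~ S m) f2 -> restrict S f = f1.
Proof.
move=> -> s1 s2; apply/eqP; rewrite -subr_eq0; apply/eqP.
apply: (supp_contra (P1 := fun m => S m) (P2 := fun m => ~~ S m)); last by move=> m ->.
  by apply: suppB => //; exact: restrictP.
have -> : restrict S (f1 + f2) - f1 = f2 - restrict (predC S) (f1 + f2).
  by apply/eqP; rewrite subr_eq addrAC eq_sym subr_eq addrC -restrict_compl addrC.
by apply: suppB => //; exact: (restrictP (S := predC S)).
Qed.

Lemma restrict_id (S : pred 'X_{1..n}) f : supp (fun m => S m) f -> restrict S f = f.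
Proof. by move=> sf; apply: (@restrict_uniq _ _ _ 0); rewrite ?addr0 //; exact: supp0. Qed.

Lemma restrictD (S : pred 'X_{1..n}) f g : restrict S (f + g) = restrict S f + restrict S g.
Proof.
apply: (@restrict_uniq _ _ _ (restrict (predC S) f + restrict (predC S) g)).
- by rewrite {1}(restrict_compl S f) {1}(restrict_compl S g) addrACA.
- by apply: suppD; exact: restrictP.
by apply: suppD; exact: (restrictP (S := predC S)).
Qed.

(** When q is homogeneous for a grading that defines S and S', taking the
    S'-part of a multiple of q amounts to taking the S-part of the cofactor. *)
Lemma restrictM (S S' : pred 'X_{1..n}) q g :
  supp (fun e => forall m, S' (e + m)%MM = S m) q -> restrict S' (q * g) = q * restrict S g.
Proof.
move=> hq; apply: (@restrict_uniq _ _ _ (q * restrict (predC S) g)).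
- by rewrite -mulrDr -restrict_compl.
- by apply: suppM hq (restrictP (S := S) (f := g)) _ => a b ha; rewrite ha.
by apply: suppM hq (restrictP (S := predC S) (f := g)) _ => a b ha; rewrite ha.
Qed.

Lemma restrict_factor (S S' : pred 'X_{1..n}) q g :
  supp (fun e => forall m, S' (e + m)%MM = S m) q -> supp (fun m => S' m) (q * g) ->
  q * g = q * restrict S g.
Proof. by move=> hq /restrict_id <-; exact: restrictM. Qed.

End Support.

(** * Polynomials that vanish everywhere *)

Section Vanishing.
Variable F : numFieldType.

Lemma poly_eq0_vanish (p : {poly F}) : (forall x, p.[x] = 0) -> p = 0.
Proof.
move=> h; apply/eqP; apply: contraT => p0.
have := max_poly_roots p0 (rs := [seq i%:R | i <- iota 0 (size p)]).
rewrite size_map size_iota ltnn; apply=> //.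
  by apply/allP => x _; apply/rootP.
by rewrite map_inj_uniq ?iota_uniq // => i j /eqP; rewrite eqr_nat => /eqP.
Qed.

Definition mnm_low n (m : 'X_{1..n.+1}) : 'X_{1..n} :=
  [multinom m (widen_ord (leqnSn n) i) | i < n].

Lemma mnm_low_inj n (m m' : 'X_{1..n.+1}) :
  mnm_low m = mnm_low m' -> m ord_max = m' ord_max -> m = m'.
Proof.
move=> /mnmP h1 h2; apply/mnmP => i.
case: (unliftP ord_max i) => [j ->|->//].
have := h1 j; rewrite !mnmE.
suff -> : lift ord_max j = widen_ord (leqnSn n) j by [].
by apply: val_inj; rewrite /= /bump leqNgt ltn_ord.
Qed.

(** Evaluation in two steps, the last variable being the variable of a univariate polynomial. *)
Lemma meval_low n (v : 'I_n.+1 -> F) (f : {mpoly F[n.+1]}) :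
  f.@[v] = (\poly_(k < msize f)
    (\sum_(m <- msupp f | m ord_max == k) f@_m *: 'X_[mnm_low m])
      .@[v \o widen_ord (leqnSn n)]).[v ord_max].
Proof.
rewrite horner_poly mevalE.
rewrite (eq_bigr (fun k : 'I_(msize f) => \sum_(m <- msupp f | m ord_max == k)
   f@_m * \prod_i v i ^+ m i)); last first.
  move=> k _; rewrite raddf_sum /= mulr_suml; apply: eq_bigr => m /eqP mk.
  rewrite mevalZ mevalX -mulrA big_ord_recr /= mk; congr (_ * (_ * _)).
  by apply: eq_bigr => i _; rewrite mnmE.
rewrite (exchange_big_dep xpredT) //= big_seq [RHS]big_seq.
apply: eq_bigr => m mf.
have mb : (m ord_max < msize f)%N.
  apply: leq_ltn_trans (msize_mdeg_lt mf).
  by rewrite mdegE (bigD1 ord_max) //= leq_addr.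
rewrite (bigD1 (Ordinal mb)) //= [X in _ = _ + X]big1 ?addr0 // => k /andP[/eqP mk /eqP[]].
by apply: val_inj; rewrite /= mk.
Qed.

Lemma meval_eq0 n (f : {mpoly F[n]}) : (forall v, f.@[v] = 0) -> f = 0.
Proof.
elim: n f => [|n IH] f h.
  have E : f = (f@_0%MM)%:MP.
    apply/mpolyP => m; rewrite mcoeffC.
    have -> : m = 0%MM by apply/mnmP => -[].
    by rewrite eqxx mulr1.
  by have := h (fun=> 0); rewrite E mevalC => ->; rewrite mpolyC0.
pose c k := \sum_(m <- msupp f | m ord_max == k) f@_m *: 'X_[mnm_low m] : {mpoly F[n]}.
have c0 k : (k < msize f)%N -> c k = 0.
  move=> kf; apply: IH => w.
  have /poly_eq0_vanish/polyP/(_ k) : forall x,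
    (\poly_(k < msize f) (c k).@[w]).[x] = 0.
    move=> x; pose v (i : 'I_n.+1) := if unlift ord_max i is Some j then w j else x.
    have vE : v \o widen_ord (leqnSn n) =1 w.
      move=> i; rewrite /= /v.
      have -> : widen_ord (leqnSn n) i = lift ord_max i.
        by apply: val_inj; rewrite /= /bump leqNgt ltn_ord.
      by rewrite liftK.
    have := h v; rewrite meval_low {2}/v unlift_none => <-.
    rewrite !horner_poly; apply: eq_bigr => i _; congr (_ * _).
    by apply: meval_eq => j; rewrite vE.
  by rewrite coef_poly kf coef0.
apply/mpolyP => m; rewrite mcoeff0; apply/eqP; rewrite mcoeff_eq0.
apply/negP => mf.
have /c0/(congr1 (mcoeff (mnm_low m))) : (m ord_max < msize f)%N.
  apply: leq_ltn_trans (msize_mdeg_lt mf).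
  by rewrite mdegE (bigD1 ord_max) //= leq_addr.
rewrite mcoeff0 raddf_sum big_mkcond (bigD1_seq m) ?msupp_uniq //= eqxx.
rewrite mcoeffZ mcoeffX eqxx mulr1 big1 ?addr0 => [|m' h2].
  by apply/eqP; rewrite mcoeff_eq0 mf.
case: eqP => // h1; rewrite mcoeffZ mcoeffX.
case: eqP => [/mnm_low_inj/(_ h1) E|]; last by rewrite mulr0.
by rewrite E eqxx in h2.
Qed.

End Vanishing.

(** * Kernels of monomial maps *)

Section Toric.
Variables (F : fieldType) (n k : nat) (J : set {mpoly F[n]}).
Hypothesis idJ : is_ideal J.
Variable E : 'X_{1..n} -> 'X_{1..k}.

Definition congruent (a b : 'X_{1..n}) := J ('X_[a] - 'X_[b]).

Lemma congruent_refl a : congruent a a.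
Proof. by rewrite /congruent subrr; exact: ideal0. Qed.
Lemma congruent_sym a b : congruent a b -> congruent b a.
Proof. exact: ideal_sym. Qed.
Lemma congruent_trans a b c : congruent a b -> congruent b c -> congruent a c.
Proof. exact: ideal_trans. Qed.
Lemma congruentD a b c : congruent a b -> congruent (c + a) (c + b).
Proof. by rewrite /congruent !mpolyXD -mulrBr; exact: idealM. Qed.

(** The monomials of an element of the kernel cancel in groups with the same image;
    subtracting multiples of the differences removes the monomials one by one. *)
Lemma toric_kernel (phi : {linear {mpoly F[n]} -> {mpoly F[k]}}) :
  (forall m, phi 'X_[m] = 'X_[E m]) ->
  (forall a b, E a = E b -> congruent a b) ->
  forall f, phi f = 0 -> J f.
Proof.
move=> phiX conn f; have [N] := ubnP (size (msupp f)).
elim: N f => // N IH f fN f0.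
case E0: (msupp f) => [|m s]; first by rewrite (msuppnil0 E0); exact: ideal0.
have mf : m \in msupp f by rewrite E0 mem_head.
have /hasP[m' m'f /andP[/eqP Em m'm]] : has (fun m' => (E m' == E m) && (m' != m)) (msupp f).
  apply: contraT => /hasPn no.
  have := congr1 (mcoeff (E m)) f0; rewrite mcoeff0 {1}(mpolyE f) raddf_sum raddf_sum.
  rewrite (bigD1_seq m) ?msupp_uniq //= linearZ /= phiX mcoeffZ mcoeffX eqxx mulr1.
  rewrite big_seq_cond big1 ?addr0 => [/eqP|i /andP[/no i1 i2]].
    by rewrite mcoeff_eq0 mf.
  rewrite linearZ /= phiX mcoeffZ mcoeffX; move: i1; rewrite i2 andbT.
  by move/negbTE->; rewrite mulr0.
have Jm : J (f@_m *: ('X_[m] - 'X_[m'])).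
  by apply: idealZ => //; apply: conn.
apply: (ideal_congl idJ (b := f - f@_m *: ('X_[m] - 'X_[m']))) => //.
  by rewrite opprB addrC subrK.
apply: IH; last by rewrite linearB linearZ /= linearB /= !phiX Em subrr scaler0 subr0.
rewrite ltnS in fN; apply: leq_trans fN.
set g := f - _.
have sub : {subset m :: msupp g <= msupp f}.
  move=> a; rewrite inE => /orP[/eqP->//|]; apply: contraTT => af.
  rewrite mcoeff_msupp negbK /g mcoeffB mcoeffZ mcoeffB !mcoeffX.
  rewrite (memN_msupp_eq0 af); case: (m =P a) => [e|_]; first by rewrite -e mf in af.
  case: (m' =P a) => [e|_]; first by rewrite -e m'f in af.
  by rewrite subr0 mulr0 subr0.
apply: leq_trans (uniq_leq_size _ sub) => //=.
rewrite msupp_uniq andbT mcoeff_msupp negbK /g mcoeffB mcoeffZ mcoeffB !mcoeffX eqxx.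
by rewrite (negbTE m'm) subr0 mulr1 subrr.
Qed.

(** Induction on the degree of the image: a common variable can be cancelled, so it
    is enough that two monomials without common variable can be given one by
    exchanging one of them for a congruent monomial. *)
Lemma toric_connected :
  (forall a b, E (a + b)%MM = (E a + E b)%MM) ->
  (forall i, E U_(i)%MM != 0%MM) ->
  (forall a b, E a = E b -> (forall i, (a i == 0%N) || (b i == 0%N)) -> a != b ->
     exists c i, [/\ E c = E a, c i != 0%N &
        (congruent a c /\ b i != 0%N) \/ (congruent b c /\ a i != 0%N)]) ->
  forall a b, E a = E b -> congruent a b.
Proof.
move=> ED EU H a b; have [N] := ubnP (mdeg (E a)).
elim: N a b => // N IH a b aN Eab.
have share c d i : E c = E a -> E c = E d -> c i != 0%N -> d i != 0%N -> congruent c d.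
  move=> Eca Ecd ci di; move: Eca Ecd.
  have [c' ->] : exists c', c = (U_(i) + c')%MM.
    by exists (c - U_(i))%MM; rewrite addmC submK // lep1mP.
  have [d' ->] : exists d', d = (U_(i) + d')%MM.
    by exists (d - U_(i))%MM; rewrite addmC submK // lep1mP.
  move=> Eca' Ecd; apply: congruentD; apply: IH; last by move: Ecd; rewrite !ED => /addmI.
  move: aN; rewrite -Eca' ED mdegD.
  have : (0 < mdeg (E U_(i)))%N by rewrite lt0n mdeg_eq0.
  by lia.
case: (eqVneq a b) => [->|ab]; first exact: congruent_refl.
case: (pickP (fun i => (a i != 0%N) && (b i != 0%N))) => [i /andP[ai bi]|no].
  exact: share Eab ai bi.
have {H} := H a b Eab _ ab; case.
  by move=> i; have := no i; case: (a i == 0%N); case: (b i == 0%N).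
move=> c [i [Ec ci [[ac bi]|[bc ai]]]].
  apply: congruent_trans ac _; apply: share ci bi => //; congruence.
apply: congruent_sym; apply: congruent_trans bc _; apply: share ci ai => //.
Qed.

End Toric.

Section MonomialMap.
Variables (F : fieldType) (n k : nat) (tbl : seq (seq nat)).

(** Row i of the table lists the exponents of the image of the i-th variable; missing
    entries stand for 0. *)
Definition tbl_mnm (i : 'I_n.+1) : 'X_{1..k.+1} :=
  [multinom nth 0%N (nth [::] tbl i) j | j < k.+1].
Definition tbl_exp (m : 'X_{1..n.+1}) : 'X_{1..k.+1} :=
  (\sum_(i < n.+1) tbl_mnm i *+ m i)%MM.
Definition tbl_map : (n.+1).-tuple {mpoly F[k.+1]} := [tuple 'X_[tbl_mnm i] | i < n.+1].

Lemma tbl_mapX m : ('X_[m] \mPo tbl_map) = 'X_[tbl_exp m].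
Proof.
rewrite comp_mpolyX /tbl_exp -mprodXE; apply: eq_bigr => i _.
by rewrite tnth_mktuple mpolyXn.
Qed.

Lemma tbl_expE m j : (j < k.+1)%N -> tbl_exp m (inord j) =
  (\sum_(i <- iota 0 n.+1) nth 0 (nth [::] tbl i) j * m (inord i))%N.
Proof.
move=> jk; rewrite /tbl_exp mnm_sumE -[iota 0 n.+1]/(index_iota 0 n.+1) big_mkord.
by apply: eq_bigr => i _; rewrite mulmnE mnmE inordK // inord_val.
Qed.

Lemma tbl_expD a b : tbl_exp (a + b) = (tbl_exp a + tbl_exp b)%MM.
Proof.
apply/mnmP => j; rewrite mnmDE !mnm_sumE -big_split /=.
by apply: eq_bigr => i _; rewrite !mulmnE mnmDE mulnDr.
Qed.

Lemma tbl_exp1 i : tbl_exp U_(i)%MM = tbl_mnm i.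
Proof.
rewrite /tbl_exp (bigD1 i) //= big1 => [|j /negbTE ji]; last first.
  by rewrite mnm1E eq_sym ji mulm0n.
by rewrite mnm1E eqxx mulm1n addm0.
Qed.
End MonomialMap.

Lemma ord_ind n (P : 'I_n.+1 -> Prop) : (forall k, (k < n.+1)%N -> P (inord k)) -> forall i, P i.
Proof. by move=> h i; rewrite -(inord_val i); apply: h. Qed.

Lemma inord_eq n a b : (a < n.+1)%N -> (b < n.+1)%N -> (inord a == inord b :> 'I_n.+1) = (a == b).
Proof. by move=> ha hb; rewrite -val_eqE /= !inordK. Qed.

Lemma pair_mnm_le n (m : 'X_{1..n}) i j : (0 < m i)%N -> (0 < m j)%N -> ((i == j) ==> (1 < m i))%N ->
  (U_(i) + U_(j) <= m)%MM.
Proof.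
move=> mi mj ij; apply/mnm_lepP => k; rewrite mnmDE !mnm1E.
case: eqP => [<-|_]; last by case: eqP => [<-|].
by move: ij; rewrite eq_sym; case: eqP.
Qed.

Lemma tbl_mapU (F : fieldType) n k (tbl : seq (seq nat)) i : (i < n.+1)%N ->
  'X_(inord i) \mPo tbl_map F n k tbl =
  \prod_(j <- iota 0 k.+1) 'X_(inord j) ^+ nth 0%N (nth [::] tbl i) j.
Proof.
move=> ink; rewrite comp_mpolyXU -tnth_nth tnth_mktuple.
rewrite [LHS]mpolyXE_id -[iota 0 k.+1]/(index_iota 0 k.+1) big_mkord.
by apply: eq_bigr => j _; rewrite mnmE inord_val inordK.
Qed.

Lemma comp_mpolyA (F : fieldType) n k l (t : n.-tuple {mpoly F[k]}) (u : k.-tuple {mpoly F[l]})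
  (f : {mpoly F[n]}) : (f \mPo t) \mPo u = f \mPo [tuple tnth t i \mPo u | i < n].
Proof.
elim/mpolyind: f => [|c m f _ _ IH]; first by rewrite !rmorph0.
rewrite !comp_mpolyD !comp_mpolyZ {}IH; congr (_ *: _ + _).
rewrite !comp_mpolyX rmorph_prod; apply: eq_bigr => i _ /=.
by rewrite rmorphXn /= tnth_mktuple.
Qed.

Lemma comp_mpolyM (F : fieldType) n k (t : n.-tuple {mpoly F[k]}) (f g : {mpoly F[n]}) :
  (f * g) \mPo t = (f \mPo t) * (g \mPo t).
Proof. exact: rmorphM. Qed.

Lemma comp_mpoly_nat (F : fieldType) n k (t : n.-tuple {mpoly F[k]}) d : d%:R \mPo t = d%:R.
Proof. exact: rmorph_nat. Qed.

Section ToricMove.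
Variables (F : fieldType) (n k : nat) (J : set {mpoly F[n.+1]}) (tbl : seq (seq nat)).
Hypothesis idJ : is_ideal J.
Let E := @tbl_exp n k tbl.

(** The exchange step: a binomial relation of J rewrites two factors of a monomial. *)
Lemma toric_move i j i' j' a :
  J ('X_i * 'X_j - 'X_i' * 'X_j') -> E (U_(i) + U_(j))%MM = E (U_(i') + U_(j'))%MM ->
  (U_(i) + U_(j) <= a)%MM ->
  exists c, [/\ E c = E a, c i' != 0%N, c j' != 0%N & congruent J a c].
Proof.
rewrite -!mpolyXD => Jm EE la; exists ((U_(i') + U_(j')) + (a - (U_(i) + U_(j))))%MM.
split.
- by rewrite /E tbl_expD -/E -EE /E -tbl_expD addmC submK.
- by rewrite !mnmDE mnm1E eqxx.
- by rewrite !mnmDE (mnm1E j') eqxx; lia.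
rewrite -{1}(submK la) (addmC (_ - _)%MM) /congruent !mpolyXD -mulrBl.
by apply: idealMr => //; rewrite -!mpolyXD.
Qed.
End ToricMove.

(** Coordinates that do not occur in f can be changed freely. *)
Lemma meval_supp (F : fieldType) n (v w : 'I_n -> F) (f : {mpoly F[n]}) :
  supp (fun m => forall i, v i <> w i -> m i = 0%N) f -> f.@[v] = f.@[w].
Proof.
move=> fS; apply: (supp_ind fS (V := fun g => g.@[v] = g.@[w])).
- by rewrite !meval0.
- by move=> a b ha hb; rewrite !mevalD ha hb.
- by move=> c a ha; rewrite !mevalZ ha.
move=> m hm; rewrite !mevalX; apply: eq_bigr => i _.
by case: (eqVneq (v i) (w i)) => [->//|/eqP/hm ->]; rewrite !expr0.
Qed.

(** * Linear substitutions *)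

Section LinearSubstitution.
Variables (F : fieldType) (n k : nat).

Definition lin_subst (A : 'M[F]_(k, n)) : n.-tuple {mpoly F[k]} :=
  [tuple \sum_i (A i j)%:MP * 'X_i | j < n].

Lemma meval_lin_subst A f (t : 'rV[F]_k) : (f \mPo lin_subst A).@[t 0] = f.@[(t *m A) 0].
Proof.
rewrite comp_mpoly_meval; apply: meval_eq => j; rewrite tnth_mktuple mxE raddf_sum.
by apply: eq_bigr => i _; rewrite /= mevalM mevalC mevalXU mulrC.
Qed.

Lemma dhomog_lin_subst A f d : f \is d.-homog -> f \mPo lin_subst A \is d.-homog.
Proof.
move=> /dhomogP fd; rewrite comp_mpolyEX big_seq.
apply: rpred_sum => m mf; apply: rpredZ; rewrite comp_mpolyX.
have <- : (\sum_i m i)%N = d by rewrite -mdegE -(fd m mf).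
apply: (big_ind2 (fun (p : {mpoly F[k]}) (e : nat) => p \is e.-homog)) => [|p e p' e'|j _].
- exact: dhomog1.
- exact: dhomogM.
rewrite -{2}[m j]mul1n; apply: dhomogMn; rewrite tnth_mktuple.
apply: rpred_sum => i _; rewrite mul_mpolyC; apply: rpredZ.
by rewrite dhomogX /= mdeg1.
Qed.
End LinearSubstitution.

Lemma lin_substK (F : fieldType) n k (A : 'M[F]_(k, n)) (B : 'M[F]_(n, k)) f :
  A *m B = 1%:M -> (f \mPo lin_subst B) \mPo lin_subst A = f.
Proof.
move=> AB; rewrite comp_mpolyA -[RHS]comp_mpoly_id; congr (_ \mPo _).
apply: eq_from_tnth => l; rewrite !tnth_mktuple raddf_sum /=.
transitivity (\sum_i ((A *m B) i l)%:MP * 'X_i : {mpoly F[k]}).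
  under eq_bigr do rewrite comp_mpolyM comp_mpolyC comp_mpolyXU -tnth_nth tnth_mktuple mulr_sumr.
  rewrite exchange_big; apply: eq_bigr => i _; rewrite mxE raddf_sum mulr_suml.
  by apply: eq_bigr => j _; rewrite /= mpolyCM; ring.
rewrite AB (bigD1 l) //= big1 ?addr0 => [|i il]; rewrite mxE.
  by rewrite eqxx mul1r.
by rewrite (negbTE il) mpolyC0 mul0r.
Qed.

Lemma same_pointP (F : fieldType) n (v w : 'rV[F]_n) :
  reflect (exists2 c, c != 0 & v = c *: w) (same_point v w).
Proof.
apply: (iffP andP) => [[/sub_rVP[c e] /sub_rVP[d e']]|[c c0 ->]]; last first.
  split; apply/sub_rVP; first by exists c.
  by exists c^-1; rewrite scalerA mulVf ?scale1r.
case: (eqVneq c 0) => c0; last by exists c.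
exists 1; first by rewrite oner_eq0.
by move: e e'; rewrite c0 scale0r => -> ->; rewrite scaler0 scaler0.
Qed.

Lemma same_point_refl (F : fieldType) n (v : 'rV[F]_n) : same_point v v.
Proof. by apply/same_pointP; exists 1; rewrite ?oner_eq0 ?scale1r. Qed.

Lemma same_point_sym (F : fieldType) n (v w : 'rV[F]_n) : same_point v w -> same_point w v.
Proof.
by move=> /same_pointP[c c0 ->]; apply/same_pointP; exists c^-1; rewrite ?invr_eq0 ?scalerA ?mulVf ?scale1r.
Qed.

Lemma same_point_trans (F : fieldType) n (u v w : 'rV[F]_n) :
  same_point u v -> same_point v w -> same_point u w.
Proof.
move=> /same_pointP[c c0 ->] /same_pointP[d d0 ->].
by apply/same_pointP; exists (c * d); rewrite ?mulf_neq0 ?scalerA.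
Qed.

Lemma row_of_seqE (F : fieldType) n (s : seq F) k : (k < n.+1)%N ->
  row_of_seq n.+1 s 0 (inord k) = s`_k.
Proof. by move=> kn; rewrite mxE inordK. Qed.

Lemma meval_nat (F : fieldType) n (v : 'I_n -> F) d : (d%:R : {mpoly F[n]}).@[v] = d%:R.
Proof. exact: rmorph_nat. Qed.

(** * The two rational scrolls *)

(** In the variables x0, x1, x2, x3, p, m, the coordinates of the threefold of genus 8
    are x0 p, x1 p, x2 m, x3 m, followed by the squares and by x0 x1, x2 x3. *)
Definition bs8_tbl : seq (seq nat) :=
  [:: [:: 1; 0; 0; 0; 1; 0]; [:: 0; 1; 0; 0; 1; 0];
      [:: 0; 0; 1; 0; 0; 1]; [:: 0; 0; 0; 1; 0; 1];
      [:: 2]; [:: 0; 2]; [:: 0; 0; 2]; [:: 0; 0; 0; 2];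
      [:: 1; 1]; [:: 0; 0; 1; 1]]%N.

Definition multinom_of_seq n (s : seq nat) : 'X_{1..n} := [multinom nth 0%N s i | i < n].

Lemma multinom_of_seqE n s k : (k < n.+1)%N ->
  (multinom_of_seq n.+1 s) (inord k) = nth 0%N s k.
Proof. by move=> kn; rewrite mnmE inordK. Qed.

Lemma ord_iota n (P : 'I_n.+1 -> Prop) :
  (forall k, k \in iota 0 n.+1 -> P (inord k)) -> forall i, P i.
Proof. by move=> h; apply: ord_ind => k kn; apply: h; rewrite mem_iota. Qed.

Local Notation exp8 := (@tbl_exp 9 5 bs8_tbl).

Ltac tblE := rewrite !tbl_expE //= !big_cons ?big_nil /= ?(mul0n, mul1n, add0n, addn0).

Lemma exp8E a : [/\ exp8 a (inord 0) = a (inord 0) + 2 * a (inord 4) + a (inord 8),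
  exp8 a (inord 1) = a (inord 1) + 2 * a (inord 5) + a (inord 8),
  exp8 a (inord 2) = a (inord 2) + 2 * a (inord 6) + a (inord 9) &
  [/\ exp8 a (inord 3) = a (inord 3) + 2 * a (inord 7) + a (inord 9),
      exp8 a (inord 4) = a (inord 0) + a (inord 1) &
      exp8 a (inord 5) = a (inord 2) + a (inord 3)]]%N.
Proof. by split; [| | |split]; tblE; lia. Qed.

Section Lift8.

Definition even8 (m : 'X_{1..6}) :=
  ~~ odd (m (inord 0) + m (inord 1) + m (inord 4)) &&
  ~~ odd (m (inord 2) + m (inord 3) + m (inord 5)).

(** The exponents of the monomials in the image of the coordinate ring. *)
Definition scroll8 (m : 'X_{1..6}) :=
  [&& even8 m, m (inord 4) <= m (inord 0) + m (inord 1) &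
      m (inord 5) <= m (inord 2) + m (inord 3)]%N.

Lemma scroll_split (i j g : nat) : ~~ odd (i + j + g) -> (g <= i + j)%N ->
  exists a b c d e : nat,
   [/\ i = a + 2 * c + e, j = b + 2 * d + e & g = a + b]%N.
Proof.
move=> ev le.
exists (minn i g), (g - minn i g)%N, ((i - minn i g)./2), ((j - (g - minn i g))./2), (odd (i - minn i g)).
by split; lia.
Qed.

Lemma scroll8_lift m : scroll8 m -> exists a, exp8 a = m.
Proof.
move=> /and3P[/andP[ev1 ev2] le1 le2].
have [z0 [z1 [a00 [a11 [a01 [e1 e2 e3]]]]]] := scroll_split ev1 le1.
have [z2 [z3 [a22 [a33 [a23 [e4 e5 e6]]]]]] := scroll_split ev2 le2.
exists (multinom_of_seq 10 [:: z0; z1; z2; z3; a00; a11; a22; a33; a01; a23]).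
apply/mnmP; apply: ord_iota => k; rewrite !inE.
do 6?[case/orP]; move/eqP->; tblE; rewrite !multinom_of_seqE //=; lia.
Qed.

End Lift8.

Section Scrolls.
Variables (F : fieldType) (J : set {mpoly F[10]}).
Hypothesis idJ : is_ideal J.
Local Notation Z k := ('X_(inord k) : {mpoly F[10]}).

(** The 2 x 2 minors of the matrices with columns (Z0, Z1), (Z4, Z8), (Z8, Z5), and
    (Z2, Z3), (Z6, Z9), (Z9, Z7). *)
Definition scroll_minors (I : set {mpoly F[10]}) : Prop :=
  [/\ I (Z 0 * Z 8 - Z 1 * Z 4), I (Z 0 * Z 5 - Z 1 * Z 8) & I (Z 4 * Z 5 - Z 8 * Z 8)] /\
  [/\ I (Z 2 * Z 9 - Z 3 * Z 6), I (Z 2 * Z 7 - Z 3 * Z 9) & I (Z 6 * Z 7 - Z 9 * Z 9)].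

Hypothesis minJ : scroll_minors J.

Let sibling (a b : 'X_{1..10}) := exists c i, [/\ exp8 c = exp8 a, c i != 0%N &
        (congruent J a c /\ b i != 0%N) \/ (congruent J b c /\ a i != 0%N)].

Let sibling_sym a b : exp8 a = exp8 b -> sibling b a -> sibling a b.
Proof. by move=> E [c [i [h1 h2 h3]]]; exists c, i; split=> //; [congruence | tauto]. Qed.

Let moves : seq (nat * nat * nat * nat) :=
  [:: (0, 8, 1, 4); (0, 5, 1, 8); (4, 5, 8, 8);
      (2, 9, 3, 6); (2, 7, 3, 9); (6, 7, 9, 9)]%N.

Let movesP i j i' j' : (i, j, i', j') \in moves ->
  J (Z i * Z j - Z i' * Z j') /\
  exp8 (U_(inord i) + U_(inord j))%MM = exp8 (U_(inord i') + U_(inord j'))%MM.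
Proof.
case: minJ => -[m1 m2 m3] [m4 m5 m6] H; split.
  by move: H; rewrite !inE; do 5?[case/orP]; move=> /eqP[-> -> -> ->].
apply/mnmP; apply: ord_iota => k.
by move: H; rewrite !inE; do 5?[case/orP]; move=> /eqP[-> -> -> ->];
  do 5?[case/orP]; move/eqP->; rewrite !tbl_expD !tbl_exp1 !mnmDE !mnmE !inordK.
Qed.

Let move8 (i j i' j' l : nat) a b : all (fun k => k < 10)%N [:: i; j; i'; j'; l] ->
  ((i, j, i', j') \in moves) || ((i', j', i, j) \in moves) ->
  exp8 a = exp8 b -> l \in [:: i'; j'] ->
  (0 < b (inord i))%N && (0 < b (inord j))%N && ((i == j) ==> (1 < b (inord i)))%N ->
  (0 < a (inord l))%N -> sibling a b.
Proof.
move=> /=/and5P[i1 i2 i3 i4 /andP[i5 _]] mv Eab lij hb ha.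
have [Jm EE] : J (Z i * Z j - Z i' * Z j') /\
  exp8 (U_(inord i) + U_(inord j))%MM = exp8 (U_(inord i') + U_(inord j'))%MM.
  by case/orP: mv => /movesP[] // /(ideal_sym idJ) ? ->.
have [|c [h1 h2 h3 h4]] := toric_move idJ Jm EE (a := b).
  by case/andP: hb => /andP[bi bj] bij; apply: pair_mnm_le; rewrite ?inord_eq.
exists c, (inord l); split; first by congruence.
  by move: lij; rewrite !inE => /orP[] /eqP->.
by right; split=> //; lia.
Qed.

(** A variable occurring in only one of two monomials with the same image can be
    created in the other one by exchanging factors within a scroll. The variables
    Z4..Z7 are treated once Z0..Z3 have disappeared from both monomials. *)
Let exp8_half a b : exp8 a = exp8 b -> (forall i, (a i == 0%N) || (b i == 0%N)) ->
  (exists2 i, i \in iota 0 8 & (0 < a (inord i))%N && 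
     ((3 < i) ==> all (fun z => a (inord z) + b (inord z) == 0) (iota 0 4))%N) ->
  sibling a b.
Proof.
move=> E dis [i i8 /andP[ai small]].
have [e0 e1 e2 [e3 e4 e5]] := exp8E a; have [f0 f1 f2 [f3 f4 f5]] := exp8E b.
rewrite E in e0 e1 e2 e3 e4 e5.
have di := dis (inord i).
move: i8 ai small di; rewrite !inE; do 7?[case/orP]; move/eqP-> => /= ai small di.
- have [h|h] : (0 < b (inord 4) \/ 0 < b (inord 8))%N by lia.
    by apply: (@move8 1 4 0 8 0); rewrite //; lia.
  by apply: (@move8 1 8 0 5 0); rewrite //; lia.
- have [h|h] : (0 < b (inord 5) \/ 0 < b (inord 8))%N by lia.
    by apply: (@move8 0 5 1 8 1); rewrite //; lia.
  by apply: (@move8 0 8 1 4 1); rewrite //; lia.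
- have [h|h] : (0 < b (inord 6) \/ 0 < b (inord 9))%N by lia.
    by apply: (@move8 3 6 2 9 2); rewrite //; lia.
  by apply: (@move8 3 9 2 7 2); rewrite //; lia.
- have [h|h] : (0 < b (inord 7) \/ 0 < b (inord 9))%N by lia.
    by apply: (@move8 2 7 3 9 3); rewrite //; lia.
  by apply: (@move8 2 9 3 6 3); rewrite //; lia.
- by apply: (@move8 8 8 4 5 4); rewrite //; lia.
- by apply: (@move8 8 8 4 5 5); rewrite //; lia.
- by apply: (@move8 9 9 6 7 6); rewrite //; lia.
- by apply: (@move8 9 9 6 7 7); rewrite //; lia.
Qed.

Let exp8_disj a b : exp8 a = exp8 b -> (forall i, (a i == 0%N) || (b i == 0%N)) -> a != b ->
  sibling a b.
Proof.
move=> E dis ab.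
have dis' i : (b i == 0%N) || (a i == 0%N) by rewrite orbC.
case za: (all (fun z => a (inord z) + b (inord z) == 0) (iota 0 4))%N; last first.
  have /allPn[z z4 hz] := negbT za.
  have [h|h] : (0 < a (inord z) \/ 0 < b (inord z))%N by lia.
    apply: exp8_half => //; exists z; last by rewrite h; move: z4; rewrite mem_iota; lia.
    by move: z4; rewrite !mem_iota; lia.
  apply: sibling_sym => //; apply: exp8_half => //; exists z; last by rewrite h; move: z4; rewrite mem_iota; lia.
  by move: z4; rewrite !mem_iota; lia.
have za' : all (fun z => b (inord z) + a (inord z) == 0)%N (iota 0 4).
  by apply/allP => z /(allP za); rewrite addnC.
case zb: (all (fun z => a (inord z) + b (inord z) == 0) (iota 4 4))%N; last first.
  have /allPn[z z4 hz] := negbT zb.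
  have [h|h] : (0 < a (inord z) \/ 0 < b (inord z))%N by lia.
    apply: exp8_half => //; exists z; last by rewrite h za implybT.
    by move: z4; rewrite !mem_iota; lia.
  apply: sibling_sym => //; apply: exp8_half => //; exists z; last by rewrite h za' implybT.
  by move: z4; rewrite !mem_iota; lia.
have [e0 e1 e2 [e3 e4 e5]] := exp8E a; have [f0 f1 f2 [f3 f4 f5]] := exp8E b.
rewrite E in e0 e1 e2 e3 e4 e5.
case/eqP: ab; apply/mnmP; move: za zb => /=/and5P[? ? ? ? _] /and5P[? ? ? ? _].
by apply: ord_iota => k; rewrite !inE; do 9?[case/orP]; move/eqP->; lia.
Qed.

(** The coordinate ring of the join of the two scrolls is a subring of a polynomial ring. *)
Lemma scroll_kernel f : f \mPo tbl_map F 9 5 bs8_tbl = 0 -> J f.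
Proof.
apply: (toric_kernel idJ (E := exp8)) => [m|]; first exact: tbl_mapX.
apply: toric_connected => // [a b|i]; first exact: tbl_expD.
rewrite tbl_exp1; apply/eqP => /mnmP.
move: i; apply: ord_iota => k; rewrite !inE.
by do 9?[case/orP]; move/eqP-> => h;
  have := (h (inord 0), h (inord 1), h (inord 2), h (inord 3));
  rewrite !mnmE !inordK //= => -[[[]]].
Qed.

End Scrolls.

(** * Reduction modulo the equation of a double cover *)

Section Cover8.
Variable F : numFieldType.
Local Notation S6 := {mpoly F[6]}.
Local Notation P10 := {mpoly F[10]}.
Local Notation X k := ('X_(inord k) : S6).
Local Notation Z k := ('X_(inord k) : P10).
Local Notation phi f := ((f : P10) \mPo tbl_map F 9 5 bs8_tbl).
Implicit Types (c q r : quad_coef F) (m : 'X_{1..6}).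

Definition quad6 c : S6 :=
  (c00 c)%:MP * (X 0 * X 0) + (c11 c)%:MP * (X 1 * X 1) + (c22 c)%:MP * (X 2 * X 2)
  + (c33 c)%:MP * (X 3 * X 3) + (c01 c)%:MP * (X 0 * X 1) + (c23 c)%:MP * (X 2 * X 3).

Definition lin10 c : P10 :=
  (c00 c)%:MP * Z 4 + (c11 c)%:MP * Z 5 + (c22 c)%:MP * Z 6
  + (c33 c)%:MP * Z 7 + (c01 c)%:MP * Z 8 + (c23 c)%:MP * Z 9.

(** The equation p^2 = m^2 + 4 R: writing p = w + w' and m = w - w', it says w w' = R. *)
Definition cover_eq r : S6 := X 4 * X 4 - (X 5 * X 5 + 4%:R * quad6 r).

Lemma phi_var8 k : (k < 10)%N -> phi (Z k) =
  [:: X 0 * X 4; X 1 * X 4; X 2 * X 5; X 3 * X 5; X 0 * X 0; X 1 * X 1; X 2 * X 2; X 3 * X 3;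
      X 0 * X 1; X 2 * X 3]`_k.
Proof.
move=> k10; rewrite tbl_mapU // !big_cons big_nil.
by move: k10; do 10?[case: k => [_|k]] => //=; ring.
Qed.

Lemma phi_lin10 c : phi (lin10 c) = quad6 c.
Proof. by rewrite /lin10 /quad6 !(comp_mpolyD, comp_mpolyC, comp_mpolyM) !phi_var8. Qed.

Definition quad_pairs : seq (nat * nat) := [:: (0, 0); (1, 1); (2, 2); (3, 3); (0, 1); (2, 3)]%N.

Lemma supp_quad6 (P : 'X_{1..6} -> Prop) c :
  (forall i j, (i, j) \in quad_pairs -> P (U_(inord i) + U_(inord j))%MM) -> supp P (quad6 c).
Proof.
move=> H; rewrite /quad6 !mul_mpolyC -!mpolyXD.
by do 5?[apply: suppD]; apply: suppZ; apply: suppX; apply: H.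
Qed.

(** For w = 0 this bound on deg p + deg m holds on the image of the coordinate ring,
    and, unlike the two bounds in scroll8, it is compatible with the reduction of
    p^2 to m^2 + 4 R. *)
Definition weight8 w m := even8 m &&
  (m (inord 4) + m (inord 5) <= m (inord 0) + m (inord 1) + (m (inord 2) + m (inord 3)) + w)%N.

Lemma even_shift a b m : (a, b) \in (4, 4)%N :: (5, 5)%N :: quad_pairs ->
  even8 (U_(inord a) + U_(inord b) + m)%MM = even8 m.
Proof.
by rewrite !inE; do 7?[case/orP]; move/eqP=> [-> ->];
  rewrite /even8 !mnmDE !mnm1E !inord_eq //=; congr (_ && _); lia.
Qed.

Lemma weight8_pair w i j m : (i, j) \in quad_pairs ->
  weight8 w (U_(inord i) + U_(inord j) + m)%MM = weight8 w.+2 m.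
Proof.
move=> ij; rewrite /weight8 even_shift; last by rewrite in_cons in_cons ij !orbT.
by move: ij; rewrite !inE; do 5?[case/orP]; move=> /eqP[-> ->];
  rewrite !mnmDE !mnm1E !inord_eq //=; congr (_ && _); lia.
Qed.

Lemma weight8_scroll m : scroll8 m -> weight8 0 m.
Proof. by case/and3P=> h1 h2 h3; rewrite /weight8 h1 /=; lia. Qed.

Lemma phi_supp (f : P10) : supp (fun m => scroll8 m) (phi f).
Proof.
apply: (supp_ind (P := fun=> True) (f := f) (V := fun g => supp (fun m => scroll8 m) (phi g))).
- by [].
- by rewrite comp_mpoly0; exact: supp0.
- by move=> a b ha hb; rewrite comp_mpolyD; exact: suppD.
- by move=> c a ha; rewrite comp_mpolyZ; exact: suppZ.
move=> m _; rewrite tbl_mapX; apply: suppX; rewrite /scroll8 /even8.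
by have [-> -> -> [-> -> ->]] := exp8E m; lia.
Qed.

Lemma supp_swap (j : nat) (s : F) (P : 'X_{1..6} -> Prop) r m :
  P (U_(inord j) + U_(inord j) + m)%MM ->
  (forall a b, (a, b) \in quad_pairs -> P (U_(inord a) + U_(inord b) + m)%MM) ->
  supp P ((X j * X j + s%:MP * quad6 r) * 'X_[m]).
Proof.
move=> Pj Pq; rewrite mulrC; apply/suppXM; apply: suppD.
  by rewrite -mpolyXD; apply: suppX; rewrite addmC.
rewrite mul_mpolyC; apply: suppZ; apply: supp_quad6 => a b ab.
by rewrite addmC; exact: Pq.
Qed.

Section Red.
Variable r : quad_coef F.
Let E := cover_eq r.

Lemma split_square (k : nat) m : (1 < m (inord k))%N ->
  exists m', m = (U_(inord k) + U_(inord k) + m')%MM.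
Proof.
move=> mk; exists (m - (U_(inord k) + U_(inord k)))%MM; rewrite addmC submK //.
by apply: pair_mnm_le; rewrite ?eqxx // (ltn_trans _ mk).
Qed.

(** Modulo E every polynomial is of degree at most one in p; the set S of exponents
    is any one that this reduction preserves. *)
Lemma reduce_p (S : pred 'X_{1..6}) :
  (forall m, S (U_(inord 4) + U_(inord 4) + m)%MM -> S (U_(inord 5) + U_(inord 5) + m)%MM) ->
  (forall i j m, (i, j) \in quad_pairs ->
     S (U_(inord 4) + U_(inord 4) + m)%MM -> S (U_(inord i) + U_(inord j) + m)%MM) ->
  forall f, supp (fun m => S m) f -> exists F0 F1 h, [/\ f = F0 + X 4 * F1 + E * h,
    supp (fun m => S m && (m (inord 4) == 0%N)) F0 &
    supp (fun m => S (U_(inord 4) + m)%MM && (m (inord 4) == 0%N)) F1].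
Proof.
move=> S5 Sq f.
pose V (f : S6) := exists F0 F1 h, [/\ f = F0 + X 4 * F1 + E * h,
    supp (fun m => S m && (m (inord 4) == 0%N)) F0 &
    supp (fun m => S (U_(inord 4) + m)%MM && (m (inord 4) == 0%N)) F1].
have V0 : V 0.
  by exists 0, 0, 0; rewrite !mulr0 !addr0; split=> //; exact: supp0.
have VD a b : V a -> V b -> V (a + b).
  move=> [a0 [a1 [h [-> s0 s1]]]] [b0 [b1 [k [-> t0 t1]]]].
  exists (a0 + b0), (a1 + b1), (h + k); split; [ring | exact: suppD | exact: suppD].
have VZ (c : F) a : V a -> V (c *: a).
  move=> [a0 [a1 [h [-> s0 s1]]]]; exists (c *: a0), (c *: a1), (c *: h).
  by split; [rewrite -!mul_mpolyC; ring | exact: suppZ | exact: suppZ].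
move=> fS; suff VX m : S m -> V 'X_[m] by exact: (supp_ind fS V0 VD VZ).
have [N] := ubnP (m (inord 4)); elim: N m => // N IH m mN Sm.
case: (posnP (m (inord 4))) => m4.
  exists 'X_[m], 0, 0; rewrite !mulr0 !addr0; split=> //; last exact: supp0.
  by apply: suppX; rewrite Sm m4.
case: (ltnP 1 (m (inord 4))) => m4'.
  have [m' e] := split_square m4'; subst m.
  have -> : 'X_[U_(inord 4) + U_(inord 4) + m'] =
    E * 'X_[m'] + (X 5 * X 5 + (4%:R : F)%:MP * quad6 r) * 'X_[m'].
    by rewrite /E /cover_eq !mpolyXD mpolyC_nat; ring.
  apply: (VD); first by exists 0, 0, 'X_[m']; rewrite mulr0 !add0r; split=> //; exact: supp0.
  apply: (supp_ind (P := fun m => S m && (m (inord 4) < N)%N) _ V0 VD VZ); last first.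
    by move=> a /andP[? ?]; exact: IH.
  move: mN; rewrite !mnmDE !mnm1E !inord_eq //= => mN.
  apply: supp_swap => //; first by rewrite S5 //= !mnmDE !mnm1E !inord_eq //=; lia.
  move=> a b ab; rewrite Sq //= !mnmDE !mnm1E.
  by move: ab; rewrite !inE; do 5?[case/orP]; move=> /eqP[-> ->]; rewrite !inord_eq //=; lia.
have [m' e] : exists m', m = (U_(inord 4) + m')%MM.
  by exists (m - U_(inord 4))%MM; rewrite addmC submK // lep1mP; lia.
subst m; exists 0, 'X_[m'], 0; rewrite mulr0 addr0 add0r mpolyXD; split=> //; first exact: supp0.
by apply: suppX; rewrite Sm /=; move: m4'; rewrite mnmDE mnm1E eqxx; lia.
Qed.

(** A monomial of weight at most 0 that is not in the image has too large a degree
    in one of p, m; the equation of the cover trades its square for the other one,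
    which decreases the total excess mu. *)
Lemma weight0_lift f : supp (fun m => weight8 0 m) f -> exists a h, f = phi a + E * h.
Proof.
pose V (f : S6) := exists a h, f = phi a + E * h.
have V0 : V 0 by exists 0, 0; rewrite comp_mpoly0 mulr0 addr0.
have VD a b : V a -> V b -> V (a + b).
  move=> [a0 [h ->]] [b0 [k ->]]; exists (a0 + b0), (h + k); rewrite comp_mpolyD; ring.
have VZ (c : F) a : V a -> V (c *: a).
  move=> [a0 [h ->]]; exists (c *: a0), (c *: h).
  by rewrite comp_mpolyZ -!mul_mpolyC; ring.
move=> fS; suff VX m : weight8 0 m -> V 'X_[m] by exact: (supp_ind fS V0 VD VZ).
pose mu (m : 'X_{1..6}) := ((m (inord 4) - (m (inord 0) + m (inord 1)))
    + (m (inord 5) - (m (inord 2) + m (inord 3))))%N.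
have [N] := ubnP (mu m); elim: N m => // N IH m mN Sm.
case: (boolP (scroll8 m)) => [/scroll8_lift[a <-]|nm].
  by exists 'X_[a], 0; rewrite mulr0 addr0 tbl_mapX.
have VE g : V (E * g) by exists 0, g; rewrite comp_mpoly0 add0r.
have step (i j : nat) (s : F) m' : (i, j) \in [:: (4, 5); (5, 4)]%N ->
   m = (U_(inord i) + U_(inord i) + m')%MM ->
   (if i == 4%N then m (inord 0) + m (inord 1) < m (inord 4) 
     else m (inord 2) + m (inord 3) < m (inord 5))%N ->
   V ((X j * X j + s%:MP * quad6 r) * 'X_[m']).
  move=> ij em lt; apply: (supp_ind (P := fun m => weight8 0 m && (mu m < N)%N)) => //; last first.
    by move=> a /andP[? ?]; exact: IH.
  move: lt mN Sm; rewrite em /weight8 /even8 /mu => lt mN Sm.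
  move: ij lt mN Sm; rewrite !inE => /orP[] /eqP[-> ->] /=; rewrite !mnmDE !mnm1E !inord_eq //= => lt mN Sm;
   apply: supp_swap => //; try by rewrite !mnmDE !mnm1E !inord_eq //=; lia.
  - by move=> a b; rewrite !inE; do 5?[case/orP]; move=> /eqP[-> ->]; rewrite !mnmDE !mnm1E !inord_eq //=; lia.
  - by move=> a b; rewrite !inE; do 5?[case/orP]; move=> /eqP[-> ->]; rewrite !mnmDE !mnm1E !inord_eq //=; lia.
have [lt|lt] : (m (inord 0) + m (inord 1) < m (inord 4) \/ 
   m (inord 2) + m (inord 3) < m (inord 5))%N.
- by move: nm Sm; rewrite /weight8 /scroll8; case: even8 => //=; lia.
- have [|m' em] := @split_square 4 m; first by move: Sm; rewrite /weight8 /even8; lia.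
  have -> : 'X_[m] = E * 'X_[m'] + (X 5 * X 5 + (4%:R : F)%:MP * quad6 r) * 'X_[m'].
    by rewrite em /E /cover_eq !mpolyXD mpolyC_nat; ring.
  by apply: (VD) => //; apply: (step 4%N 5%N).
- have [|m' em] := @split_square 5 m; first by move: Sm; rewrite /weight8 /even8; lia.
  have -> : 'X_[m] = E * (- 'X_[m']) + (X 4 * X 4 + (- 4%:R : F)%:MP * quad6 r) * 'X_[m'].
    by rewrite em /E /cover_eq !mpolyXD mpolyCN mpolyC_nat; ring.
  by apply: (VD) => //; apply: (step 5%N 4%N).
Qed.

(** A monomial of weight 2 is a square of p or m times a monomial of weight 0, and
    p^2 is congruent to m^2 + 4 R. *)
Lemma weight2_lift f : supp (fun m => weight8 2 m) f ->
  exists a b h, f = phi a + X 5 * X 5 * phi b + E * h.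
Proof.
pose V (f : S6) := exists a b h, f = phi a + X 5 * X 5 * phi b + E * h.
have V0 : V 0 by exists 0, 0, 0; rewrite comp_mpoly0 !mulr0 !addr0.
have VD a b : V a -> V b -> V (a + b).
  move=> [a0 [a1 [h ->]]] [b0 [b1 [k ->]]]; exists (a0 + b0), (a1 + b1), (h + k).
  by rewrite !comp_mpolyD; ring.
have VZ (c : F) a : V a -> V (c *: a).
  move=> [a0 [a1 [h ->]]]; exists (c *: a0), (c *: a1), (c *: h).
  by rewrite !comp_mpolyZ -!mul_mpolyC; ring.
have V00 g : supp (fun m => weight8 0 m) g -> V g.
  by move=> /weight0_lift[a [h ->]]; exists a, 0, h; rewrite comp_mpoly0 mulr0 addr0.
have V5 g : supp (fun m => weight8 0 m) g -> V (X 5 * X 5 * g).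
  move=> /weight0_lift[a [h ->]]; exists 0, a, (X 5 * X 5 * h).
  by rewrite comp_mpoly0; ring.
move=> fS; suff VX m : weight8 2 m -> V 'X_[m] by exact: (supp_ind fS V0 VD VZ).
move=> Sm; case: (boolP (weight8 0 m)) => [S0|nS].
  by apply: (V00); exact: suppX.
have [|lt] := ltnP 1 (m (inord 5)).
  move=> /split_square[m' em]; rewrite em mpolyXD mpolyXD; apply: (V5); apply: suppX.
  by move: Sm nS; rewrite em /weight8 /even8 !mnmDE !mnm1E !inord_eq //=; lia.
have [|m' em] := @split_square 4 m; first by move: Sm nS; rewrite /weight8 /even8; lia.
have S' : weight8 0 m'.
  by move: Sm nS; rewrite em /weight8 /even8 !mnmDE !mnm1E !inord_eq //=; lia.
have -> : 'X_[m] = E * 'X_[m'] + (X 5 * X 5 * 'X_[m'] + 4%:R *: (quad6 r * 'X_[m'])).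
  by rewrite em /E /cover_eq !mpolyXD -mul_mpolyC mpolyC_nat; ring.
apply: (VD); first by exists 0, 0, 'X_[m']; rewrite comp_mpoly0; ring.
apply: (VD); first by apply: (V5); apply: suppX.
apply: (VZ); apply: (V00); rewrite mulrC; apply/suppXM; apply: supp_quad6 => a b ab.
by rewrite addmC weight8_pair //; move: S'; rewrite /weight8 => /andP[-> h]; lia.
Qed.

End Red.
End Cover8.

(** * The ring of the cone over a quadric is a domain *)

(** The two linear factors of a binary quadratic form come from its two roots. *)
Lemma binary_form_factor (F : numClosedFieldType) (a b c : F) : b ^+ 2 - 4%:R * a * c != 0 ->
  exists s t u v, [/\ s * v - t * u != 0, s * u = a, s * v + t * u = b & t * v = c].
Proof.
case: (eqVneq a 0) => [->|a0] h.
  exists 0, 1, b, c; split; try ring.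
  by apply: contra h => /eqP; rewrite mul0r mul1r add0r => /eqP; rewrite oppr_eq0 => /eqP->; apply/eqP; ring.
pose s := sqrtC (b ^+ 2 - 4%:R * a * c).
have s2 : s ^+ 2 = b ^+ 2 - 4%:R * a * c by rewrite sqrtCK.
exists a, ((b - s) / 2%:R), 1, ((b + s) / (2%:R * a)).
have two : (2%:R : F) != 0 by rewrite pnatr_eq0.
split; try by field.
  have -> : a * ((b + s) / (2%:R * a)) - (b - s) / 2%:R * 1 = s by field.
  by rewrite /s sqrtC_eq0.
have -> : (b - s) / 2%:R * ((b + s) / (2%:R * a)) = (b ^+ 2 - s ^+ 2) / (4%:R * a) by field.
by rewrite s2; field.
Qed.

Section Segre.
Variable F : numFieldType.
Local Notation S6 := {mpoly F[6]}.
Local Notation X k := ('X_(inord k) : S6).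

(** The Segre embedding X0, X1, X2, X3 = a c, b d, a d, b c; the two last variables
    are parameters. *)
Definition segre_tbl : seq (seq nat) :=
  [:: [:: 1; 0; 1]; [:: 0; 1; 0; 1]; [:: 1; 0; 0; 1]; [:: 0; 1; 1];
      [:: 0; 0; 0; 0; 1]; [:: 0; 0; 0; 0; 0; 1]]%N.
Local Notation expS := (@tbl_exp 5 5 segre_tbl).

Lemma segre_kernel (f : S6) : f \mPo tbl_map F 5 5 segre_tbl = 0 ->
  exists g, f = (X 0 * X 1 - X 2 * X 3) * g.
Proof.
pose J : set S6 := [set f | exists g, f = (X 0 * X 1 - X 2 * X 3) * g].
have idJ : is_ideal J.
  split; first by exists 0; rewrite mulr0.
    by move=> _ _ [a ->] [b ->]; exists (a + b); ring.
  by move=> h _ [a ->]; exists (h * a); ring.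
have JQ : J (X 0 * X 1 - X 2 * X 3) by exists 1; rewrite mulr1.
move=> f0; suff : J f by [].
apply: (toric_kernel idJ (E := expS)) f0 => [m|]; first exact: tbl_mapX.
have EE : expS (U_(inord 0) + U_(inord 1))%MM = expS (U_(inord 2) + U_(inord 3))%MM.
  apply/mnmP; apply: ord_iota => k; rewrite !inE.
  by do 5?[case/orP]; move/eqP->; rewrite !tbl_expD !tbl_exp1 !mnmDE !mnmE !inordK.
apply: (toric_connected idJ); first exact: tbl_expD.
  move=> i; rewrite tbl_exp1; apply/eqP => /mnmP; move: i; apply: ord_iota => k; rewrite !inE.
  by do 5?[case/orP]; move/eqP-> => h;
    have := (h (inord 0), h (inord 1), h (inord 4), h (inord 5));
    rewrite !mnmE !inordK //= => -[[[]]].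
have half a b : expS a = expS b -> (forall i, (a i == 0%N) || (b i == 0%N)) ->
    (0 < a (inord 0) + a (inord 1))%N ->
    exists c i, [/\ expS c = expS a, c i != 0%N & congruent J b c /\ a i != 0%N].
  move=> E dis pos.
  have e k : (k < 6)%N -> expS a (inord k) = expS b (inord k) by rewrite E.
  have := (e 0%N isT, e 1%N isT, e 2%N isT, e 3%N isT); tblE => -[[[e0 e1] e2] e3].
  have := (dis (inord 0), dis (inord 1)) => -[d0 d1].
  have [|c [h1 h2 h3 h4]] := toric_move idJ (ideal_sym idJ JQ) (esym EE) (a := b).
    apply/mnm_lepP; apply: ord_iota => k; rewrite !inE.
    by do 5?[case/orP]; move/eqP->; rewrite !mnmDE !mnm1E !inord_eq //=; lia.
  case: (posnP (a (inord 0))) => a0.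
    by exists c, (inord 1); split=> //; [congruence | split=> //; lia].
  by exists c, (inord 0); split=> //; [congruence | split=> //; lia].
move=> a b E dis ab.
have [h|[h|[h1 h2]]] : (0 < a (inord 0) + a (inord 1) \/ (0 < b (inord 0) + b (inord 1) \/
   (a (inord 0) + a (inord 1) = 0 /\ b (inord 0) + b (inord 1) = 0)))%N by lia.
- by have [c [i [? ? [? ?]]]] := half a b E dis h; exists c, i; split=> //; right.
- have [|c [i [? ? [? ?]]]] := half b a (esym E) _ h; first by move=> i; rewrite orbC.
  by exists c, i; split=> //; [congruence | left].
have e k : (k < 6)%N -> expS a (inord k) = expS b (inord k) by rewrite E.
have := (e 0%N isT, e 1%N isT, e 2%N isT, e 3%N isT, e 4%N isT, e 5%N isT).
tblE => -[[[[[e0 e1] e2] e3] e4] e5].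
case/eqP: ab; apply/mnmP.
by apply: ord_iota => k; rewrite !inE; do 9?[case/orP]; move/eqP->; lia.
Qed.
End Segre.

Section PrimeQuadric.
Variable F : numClosedFieldType.
Local Notation S6 := {mpoly F[6]}.
Local Notation X k := ('X_(inord k) : S6).

Definition lin6 (s : seq S6) : 6.-tuple S6 := [tuple s`_i | i < 6].

Lemma lin6X s k : (k < 6)%N -> X k \mPo lin6 s = s`_k.
Proof. by move=> k6; rewrite comp_mpolyXU -tnth_nth tnth_mktuple inordK. Qed.

Variable q : quad_coef F.
Hypothesis disc1 : c01 q ^+ 2 - 4%:R * c00 q * c11 q != 0.
Hypothesis disc2 : c23 q ^+ 2 - 4%:R * c22 q * c33 q != 0.

(** A linear change of coordinates turns the quadric into the Segre quadric, whose
    ring is a subring of a polynomial ring. Hence the quadric is prime, and, stated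
    on zeros, it divides G as soon as G H vanishes on it and H does not. *)
Lemma quadric_prime (G H : S6) :
  (forall v, (quad6 q).@[v] = 0 -> (G * H).@[v] = 0) ->
  (exists2 v, (quad6 q).@[v] = 0 & H.@[v] != 0) ->
  exists g, G = quad6 q * g.
Proof.
have [a [b [c [d [D e1 e2 e3]]]]] := binary_form_factor disc1.
have [a' [b' [c' [d' [D' e1' e2' e3']]]]] := binary_form_factor disc2.
pose D1 := (a * d - b * c)^-1; pose D2 := (a' * d' - b' * c')^-1.
have K1 : (a * d - b * c) * D1 = 1 by rewrite mulfV.
have K2 : (a' * d' - b' * c') * D2 = 1 by rewrite mulfV.
have K1p : (a%:MP * d%:MP - b%:MP * c%:MP) * D1%:MP = 1 :> S6.
  by rewrite -!mpolyCM -mpolyCB -mpolyCM K1.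
have K2p : (a'%:MP * d'%:MP - b'%:MP * c'%:MP) * D2%:MP = 1 :> S6.
  by rewrite -!mpolyCM -mpolyCB -mpolyCM K2.
pose psi := lin6 [:: D1%:MP * (d%:MP * X 0 - b%:MP * X 1);
                     D1%:MP * (a%:MP * X 1 - c%:MP * X 0);
                     - D2%:MP * (d'%:MP * X 2 + b'%:MP * X 3);
                     D2%:MP * (a'%:MP * X 3 + c'%:MP * X 2); X 4; X 5].
pose psi' := lin6 [:: a%:MP * X 0 + b%:MP * X 1; c%:MP * X 0 + d%:MP * X 1;
                      - (a'%:MP * X 2 + b'%:MP * X 3); c'%:MP * X 2 + d'%:MP * X 3; X 4; X 5].
have inverse s s' : (forall k, (k < 6)%N -> s`_k \mPo lin6 s' = X k) ->
    forall f, (f \mPo lin6 s) \mPo lin6 s' = f.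
  move=> ss f; rewrite comp_mpolyA -[RHS]comp_mpoly_id; congr (_ \mPo _).
  apply/eq_from_tnth => i; rewrite !tnth_mktuple; move: i; apply: ord_ind => k k6.
  by rewrite inordK // ss.
have psiK : forall f, (f \mPo psi) \mPo psi' = f.
  apply: inverse => k k6; move: k6; do 6?[case: k => [_|k]] => //=;
   rewrite ?(comp_mpolyB, comp_mpolyD, comp_mpolyC, comp_mpolyN, comp_mpolyM, lin6X) //=.
  - by rewrite -[RHS]mul1r -K1p; ring.
  - by rewrite -[RHS]mul1r -K1p; ring.
  - by rewrite -[RHS]mul1r -K2p; ring.
  - by rewrite -[RHS]mul1r -K2p; ring.
have psi'Q : (X 0 * X 1 - X 2 * X 3) \mPo psi' = quad6 q.
  rewrite !(comp_mpolyB, comp_mpolyD, rmorphM) /= !lin6X //= /quad6.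
  by rewrite -e1 -e2 -e3 -e1' -e2' -e3' !(mpolyCD, mpolyCM); ring.
have psiQ : quad6 q \mPo psi = X 0 * X 1 - X 2 * X 3.
  have psi'K : forall f, (f \mPo psi') \mPo psi = f.
    apply: inverse => k k6; move: k6; do 6?[case: k => [_|k]] => //=;
     rewrite ?(comp_mpolyB, comp_mpolyD, comp_mpolyC, comp_mpolyN, comp_mpolyM, lin6X) //=.
    - by rewrite -[RHS]mul1r -K1p; ring.
    - by rewrite -[RHS]mul1r -K1p; ring.
    - by rewrite -[RHS]mul1r -K2p; ring.
    - by rewrite -[RHS]mul1r -K2p; ring.
  by rewrite -psi'Q psi'K.
pose sig (f : S6) := (f \mPo psi) \mPo tbl_map F 5 5 segre_tbl.
have sig0 f : sig f = 0 -> exists g, f = quad6 q * g.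
  move=> /segre_kernel[g fg]; exists (g \mPo psi').
  by rewrite -psi'Q -[LHS]psiK fg rmorphM.
have sigM f g : sig (f * g) = sig f * sig g by rewrite /sig !rmorphM.
have sigQ : sig (quad6 q) = 0.
  rewrite /sig psiQ comp_mpolyB !rmorphM /= !tbl_mapU // !big_cons !big_nil /=; ring.
move=> GH [v Qv Hv].
have : sig G * sig H = 0.
  rewrite -sigM; apply: meval_eq0 => w.
  rewrite /sig !comp_mpoly_meval; apply: GH.
  by rewrite -!comp_mpoly_meval -/(sig _) sigQ meval0.
move/eqP; rewrite mulf_eq0 => /orP[/eqP|/eqP /sig0[h Hh]]; first exact: sig0.
by rewrite Hh mevalM Qv mul0r eqxx in Hv.
Qed.
End PrimeQuadric.

(** * The ideal of the threefold of genus 8 *)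

Section Assemble8.
Variable F : numClosedFieldType.
Local Notation S6 := {mpoly F[6]}.
Local Notation P10 := {mpoly F[10]}.
Local Notation X k := ('X_(inord k) : S6).
Local Notation Z k := ('X_(inord k) : P10).
Local Notation phi f := ((f : P10) \mPo tbl_map F 9 5 bs8_tbl).
Variables q r : quad_coef F.
Local Notation E := (cover_eq r).

Lemma supp_cover_rest (s : F) (j : nat) (P P' : 'X_{1..6} -> Prop) h :
  supp P h -> (forall m, P m -> P' (U_(inord j) + U_(inord j) + m)%MM) ->
  (forall a b m, (a, b) \in quad_pairs -> P m -> P' (U_(inord a) + U_(inord b) + m)%MM) ->
  supp P' ((X j * X j + s%:MP * quad6 r) * h).
Proof.
move=> hP Hj Hq; apply: (supp_ind hP (V := fun h => supp P' ((X j * X j + s%:MP * quad6 r) * h))).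
- by rewrite mulr0; exact: supp0.
- by move=> a b ha hb; rewrite mulrDr; exact: suppD.
- by move=> c a ha; rewrite -scalerAr; exact: suppZ.
move=> m Pm; apply: supp_swap; first exact: Hj.
by move=> a b ab; exact: Hq.
Qed.

(** The exponents that are still in the image after multiplication by p^2 or by m^2. *)
Definition deep8 (m : 'X_{1..6}) :=
  [&& even8 m, m (inord 4) + 2 <= m (inord 0) + m (inord 1) &
      m (inord 5) + 2 <= m (inord 2) + m (inord 3)]%N.

Let square_supp (j : nat) (P : 'X_{1..6} -> Prop) h :
  supp P (X j * X j * h) -> supp (fun m => P (U_(inord j) + U_(inord j) + m)%MM) h.
Proof. by rewrite -mpolyXD; move/suppXM. Qed.

Ltac pairs8 := rewrite !inE; do 5?[case/orP]; move=> /eqP[-> ->];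
  rewrite !mnmDE !mnm1E !inord_eq //=; lia.

(** The leading terms of E for the degrees deg p - deg (x0, x1) and deg m - deg (x2, x3)
    are p^2 and m^2, whose coefficients are 1: a bound on E h gives a bound on h. The
    bound is reached by descent from an obvious one. *)
Lemma cover_supp h : supp (fun m => scroll8 m) (E * h) ->
  exists2 h', E * h = E * h' & supp (fun m => deep8 m) h'.
Proof.
move=> Eh; have Eh_even : supp (fun m => even8 m) (E * h).
  by apply: sub_supp Eh => m /and3P[].
have Eeven : supp (fun e => forall m, even8 (e + m)%MM = even8 m) E.
  rewrite /E /cover_eq; apply: suppB; last apply: suppD.
  - by rewrite -mpolyXD; apply: suppX => m; exact: even_shift.
  - by rewrite -mpolyXD; apply: suppX => m; exact: even_shift.
  rewrite -[4%:R](mpolyC_nat 6 F) mul_mpolyC; apply: suppZ; apply: supp_quad6 => a b ab m.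
  by rewrite even_shift // in_cons in_cons ab !orbT.
have EE := restrict_factor Eeven Eh_even.
move: Eh; rewrite EE; set g := restrict _ h => Eg.
have g_even : supp (fun m => even8 m) g by exact: restrictP.
have g4 N : supp (fun m => m (inord 4) + 2 <= m (inord 0) + m (inord 1) + N)%N g ->
            supp (fun m => m (inord 4) + 2 <= m (inord 0) + m (inord 1))%N g.
  elim: N => [|N IH] gN; first by apply: sub_supp gN => m; rewrite addn0.
  apply: IH; suff : supp (fun m => m (inord 4) <= m (inord 0) + m (inord 1) + N)%N (X 4 * X 4 * g).
    by move/square_supp; apply: sub_supp => m; rewrite !mnmDE !mnm1E !inord_eq //=; lia.
  have -> : X 4 * X 4 * g = E * g + (X 5 * X 5 + (4%:R : F)%:MP * quad6 r) * g.
    by rewrite /cover_eq mpolyC_nat; ring.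
  apply: suppD; first by apply: sub_supp Eg => m /and3P[_]; lia.
  apply: (supp_cover_rest gN) => [m|a b m]; last by pairs8.
  by rewrite !mnmDE !mnm1E !inord_eq //=; lia.
have g5 N : supp (fun m => m (inord 5) + 2 <= m (inord 2) + m (inord 3) + N)%N g ->
            supp (fun m => m (inord 5) + 2 <= m (inord 2) + m (inord 3))%N g.
  elim: N => [|N IH] gN; first by apply: sub_supp gN => m; rewrite addn0.
  apply: IH; suff : supp (fun m => m (inord 5) <= m (inord 2) + m (inord 3) + N)%N (X 5 * X 5 * g).
    by move/square_supp; apply: sub_supp => m; rewrite !mnmDE !mnm1E !inord_eq //=; lia.
  have -> : X 5 * X 5 * g = - (E * g) + (X 4 * X 4 + (- 4%:R : F)%:MP * quad6 r) * g.
    by rewrite /cover_eq mpolyCN mpolyC_nat; ring.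
  apply: suppD; first by apply: suppN; apply: sub_supp Eg => m /and3P[_]; lia.
  apply: (supp_cover_rest gN) => [m|a b m]; last by pairs8.
  by rewrite !mnmDE !mnm1E !inord_eq //=; lia.
have big (i : nat) : supp (fun m => m (inord i) + 2 <= msize g + 2)%N g.
  move=> m mg; rewrite leq_add2r; apply: leq_trans (ltnW (msize_mdeg_lt mg)).
  by rewrite mdegE (bigD1 (inord i)) //= leq_addr.
exists g => // m mg; apply/and3P; split; first exact: g_even.
  by apply: (g4 (msize g + 2)%N) mg; apply: sub_supp (big 4%N) => a; lia.
by apply: (g5 (msize g + 2)%N) mg; apply: sub_supp (big 5%N) => a; lia.
Qed.

(** The cubic that goes to E x_i x_j x_k x_l, where x_i x_j and x_k x_l are the
    coordinates Z_s and Z_t. *)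
Definition bs8_cubic i j s k l t : P10 :=
  Z i * Z j * Z t - Z s * (Z k * Z l + 4%:R * lin10 r * Z t).

Definition group1 : seq (nat * nat * nat) := [:: (0, 0, 4); (1, 1, 5); (0, 1, 8)]%N.
Definition group2 : seq (nat * nat * nat) := [:: (2, 2, 6); (3, 3, 7); (2, 3, 9)]%N.

Lemma phi_cubic i j s k l t : (i, j, s) \in group1 -> (k, l, t) \in group2 ->
  phi (bs8_cubic i j s k l t) = E * 'X_[U_(inord i) + U_(inord j) + (U_(inord k) + U_(inord l))].
Proof.
rewrite /bs8_cubic /cover_eq !inE => h1 h2.
move: (lin10 r) (phi_lin10 r) => L eL.
rewrite !(comp_mpoly_nat, comp_mpolyB, comp_mpolyD, comp_mpolyM) eL !mpolyXD.
by case/or3P: h1 => /eqP[-> -> ->]; case/or3P: h2 => /eqP[-> -> ->]; rewrite !phi_var8 //=; ring.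
Qed.

(** Since x2 and x3 are multiplied by m, the quadric Q goes to m^2 Q only after its
    part in x0, x1 has been corrected by p^2 = m^2 + 4 R. *)
Definition bs8_quadric : P10 :=
  (c00 q)%:MP * (Z 0 * Z 0) + (c11 q)%:MP * (Z 1 * Z 1) + (c01 q)%:MP * (Z 0 * Z 1)
  + (c22 q)%:MP * (Z 2 * Z 2) + (c33 q)%:MP * (Z 3 * Z 3) + (c23 q)%:MP * (Z 2 * Z 3)
  - 4%:R * lin10 r * ((c00 q)%:MP * Z 4 + (c11 q)%:MP * Z 5 + (c01 q)%:MP * Z 8).

Definition half_quad6 : S6 :=
  (c00 q)%:MP * (X 0 * X 0) + (c11 q)%:MP * (X 1 * X 1) + (c01 q)%:MP * (X 0 * X 1).

Lemma phi_quadric : phi bs8_quadric = E * half_quad6 + X 5 * X 5 * quad6 q.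
Proof.
rewrite /bs8_quadric /cover_eq; move: (lin10 r) (phi_lin10 r) => L eL.
rewrite !(comp_mpoly_nat, comp_mpolyB, comp_mpolyD, comp_mpolyM) eL.
rewrite !comp_mpolyC !phi_var8 //= /half_quad6 /quad6; ring.
Qed.

Variable J : set P10.
Hypothesis idJ : is_ideal J.
Hypothesis linJ : J (lin10 q).
Hypothesis minorsJ : scroll_minors J.
Hypothesis quadJ : J bs8_quadric.
Hypothesis cubicJ : forall i j s k l t,
  (i, j, s) \in group1 -> (k, l, t) \in group2 -> J (bs8_cubic i j s k l t).

(** Multiples of E that lie in the image come from the nine cubics. *)
Lemma deep_lift h : supp (fun m => deep8 m) h -> exists2 g, J g & E * h = phi g.
Proof.
move=> hd; apply: (supp_ind hd (V := fun h => exists2 g, J g & E * h = phi g)).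
- by exists 0; rewrite ?mulr0 ?comp_mpoly0 //; exact: ideal0.
- move=> a b [g Jg e] [g' Jg' e']; exists (g + g'); first exact: idealD.
  by rewrite mulrDr e e' comp_mpolyD.
- move=> c a [g Jg e]; exists (c *: g); first exact: idealZ.
  by rewrite -scalerAr e comp_mpolyZ.
move=> m dm.
have [i [j [s [g1 le1]]]] : exists i j s, (i, j, s) \in group1 /\ (U_(inord i) + U_(inord j) <= m)%MM.
  have [h0|[h0|h0]] : (1 < m (inord 0) \/ (1 < m (inord 1) \/ (0 < m (inord 0) /\ 0 < m (inord 1))))%N.
  - by move: dm; rewrite /deep8; lia.
  - by exists 0%N, 0%N, 4%N; split=> //; apply: pair_mnm_le; rewrite ?inord_eq //=; lia.
  - by exists 1%N, 1%N, 5%N; split=> //; apply: pair_mnm_le; rewrite ?inord_eq //=; lia.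
  - by exists 0%N, 1%N, 8%N; split=> //; apply: pair_mnm_le; rewrite ?inord_eq //=; lia.
pose m1 := (m - (U_(inord i) + U_(inord j)))%MM.
have em1 : m = (U_(inord i) + U_(inord j) + m1)%MM by rewrite addmC submK.
have d1 : [/\ even8 m1, m1 (inord 4) <= m1 (inord 0) + m1 (inord 1) &
    m1 (inord 5) + 2 <= m1 (inord 2) + m1 (inord 3)]%N.
  move: dm g1; rewrite em1 /deep8 !inE => dm g1.
  case/or3P: g1 dm => /eqP[-> -> _]; rewrite even_shift // !mnmDE !mnm1E !inord_eq //=.
  - by case/and3P=> -> h1 h2; split; lia.
  - by case/and3P=> -> h1 h2; split; lia.
  by case/and3P=> -> h1 h2; split; lia.
have [k [l [t [g2 le2]]]] : exists k l t, (k, l, t) \in group2 /\ (U_(inord k) + U_(inord l) <= m1)%MM.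
  case: d1 => _ _ d1; have [h0|[h0|h0]] :
     (1 < m1 (inord 2) \/ (1 < m1 (inord 3) \/ (0 < m1 (inord 2) /\ 0 < m1 (inord 3))))%N by lia.
  - by exists 2%N, 2%N, 6%N; split=> //; apply: pair_mnm_le; rewrite ?inord_eq //=; lia.
  - by exists 3%N, 3%N, 7%N; split=> //; apply: pair_mnm_le; rewrite ?inord_eq //=; lia.
  - by exists 2%N, 3%N, 9%N; split=> //; apply: pair_mnm_le; rewrite ?inord_eq //=; lia.
pose m' := (m1 - (U_(inord k) + U_(inord l)))%MM.
have em' : m1 = (U_(inord k) + U_(inord l) + m')%MM by rewrite addmC submK.
have em : m = (U_(inord i) + U_(inord j) + (U_(inord k) + U_(inord l)) + m')%MM.
  by rewrite -addmA -em'.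
have [a ea] : exists a, exp8 a = m'.
  apply: scroll8_lift; move: d1 g2; rewrite em' /scroll8 !inE => -[+ + +] g2.
  by case/or3P: g2 => /eqP[-> -> _]; rewrite even_shift // !mnmDE !mnm1E !inord_eq //= => -> h1 h2; lia.
exists (bs8_cubic i j s k l t * 'X_[a]); first by apply: idealMr => //; exact: cubicJ.
by rewrite comp_mpolyM phi_cubic // tbl_mapX ea -mulrA -mpolyXD -em.
Qed.

Hypothesis disc1 : c01 q ^+ 2 - 4%:R * c00 q * c11 q != 0.
Hypothesis disc2 : c23 q ^+ 2 - 4%:R * c22 q * c33 q != 0.
Hypothesis qr : exists2 v, (quad6 q).@[v] = 0 & (quad6 r).@[v] != 0.

(** Over a point of Q with R <> 0 the two values +-s of p give points of the cover, so F0
    vanishes there, and F1 where moreover s <> 0; this is a dense part of Q. *)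
Lemma cover_vanish (F0 F1 : S6) :
  supp (fun m => m (inord 4) = 0%N) F0 -> supp (fun m => m (inord 4) = 0%N) F1 ->
  (forall v, (quad6 q).@[v] = 0 -> E.@[v] = 0 -> (quad6 r).@[v] != 0 ->
     (F0 + X 4 * F1).@[v] = 0) ->
  (exists g, F0 = quad6 q * g) /\ (exists g, F1 = quad6 q * g).
Proof.
move=> s0 s1 H.
pose w (v : 'I_6 -> F) s i := if i == inord 4 then s else v i.
have wE (f : S6) v s : supp (fun m => m (inord 4) = 0%N) f -> f.@[w v s] = f.@[v].
  by move=> sf; apply: meval_supp; apply: sub_supp sf => m m4 i; rewrite /w; case: eqP => [->|].
have sq (c : quad_coef F) : supp (fun m => m (inord 4) = 0%N) (quad6 c).
  apply: supp_quad6 => i j.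
  by rewrite !inE; do 5?[case/orP]; move=> /eqP[-> ->]; rewrite !mnmDE !mnm1E !inord_eq.
have key v : (quad6 q).@[v] = 0 -> (quad6 r).@[v] != 0 ->
    F0.@[v] = 0 /\ ((v (inord 5)) ^+ 2 + 4%:R * (quad6 r).@[v]) * F1.@[v] = 0.
  move=> Qv Rv; set u := _ ^+ 2 + _; pose s := sqrtC u.
  have s2 : s ^+ 2 = u by rewrite sqrtCK.
  have at_ t : t ^+ 2 = u -> F0.@[v] + t * F1.@[v] = 0.
    have wp : w v t (inord 4) = t by rewrite /w eqxx.
    have w5 : w v t (inord 5) = v (inord 5) by rewrite /w inord_eq.
    move=> tu; have := H (w v t).
    rewrite (wE _ v t (sq q)) (wE _ v t (sq r)) (mevalD _ F0) (mevalM _ (X 4)) (wE _ v t s0) (wE _ v t s1) mevalXU wp.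
    apply=> //.
    rewrite /cover_eq mevalB mevalD !mevalM !mevalXU (wE _ v t (sq r)) wp w5.
    by rewrite -[4%:R](mpolyC_nat 6 F) mevalC -expr2 tu /u; ring.
  have hp := at_ s s2; have hm : F0.@[v] + (- s) * F1.@[v] = 0 by apply: at_; rewrite sqrrN.
  have two : (2%:R : F) != 0 by rewrite pnatr_eq0.
  have F00 : F0.@[v] = 0.
    apply/eqP; have : 2%:R * F0.@[v] == 0.
      by apply/eqP; rewrite -[RHS](addr0 0) -{1}hp -hm; ring.
    by rewrite mulf_eq0 (negbTE two).
  by split=> //; rewrite -s2 expr2 -mulrA; move: hp; rewrite F00 add0r => ->; rewrite mulr0.
have evE (R6 : S6) v : ((X 5 * X 5 + (4%:R : F)%:MP * R6) * R6).@[v] =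
    ((v (inord 5)) ^+ 2 + 4%:R * R6.@[v]) * R6.@[v].
  by rewrite !(mevalM, mevalD) mevalC mevalXU expr2.
split.
  apply: (quadric_prime disc1 disc2 (H := quad6 r)) => // v Qv.
  rewrite mevalM; case: (eqVneq (quad6 r).@[v] 0) => [->|]; first by rewrite mulr0.
  by move=> /(key v Qv)[-> _]; rewrite mul0r.
apply: (quadric_prime disc1 disc2 (H := (X 5 * X 5 + (4%:R : F)%:MP * quad6 r) * quad6 r)) => //.
  move=> v Qv; rewrite mevalM evE.
  case: (eqVneq (quad6 r).@[v] 0) => [->|]; first by rewrite !mulr0.
  by move=> /(key v Qv)[_]; set u := _ + _ => h; rewrite mulrA (mulrC _ u) h mul0r.
have [v Qv Rv] := qr.
have v5 (f : S6) (s : F) : supp (fun m => m (inord 5) = 0%N) f ->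
    f.@[fun i => if i == inord 5 then s else v i] = f.@[v].
  by move=> sf; apply: meval_supp; apply: sub_supp sf => m m4 i; case: eqP => [->|].
have sq5 (c : quad_coef F) : supp (fun m => m (inord 5) = 0%N) (quad6 c).
  apply: supp_quad6 => i j.
  by rewrite !inE; do 5?[case/orP]; move=> /eqP[-> ->]; rewrite !mnmDE !mnm1E !inord_eq.
exists (fun i => if i == inord 5 then 0 else v i); first by rewrite (v5 _ _ (sq5 q)).
rewrite evE eqxx (v5 _ _ (sq5 r)).
by rewrite expr0n add0r !mulf_neq0 // pnatr_eq0.
Qed.

(** The coordinates are the restrictions to the double cover E = 0 of the cone over Q.
    A form f that vanishes there becomes, modulo E, a multiple of Q whose cofactor has
    weight at most 2. That multiple is in the image of J by the linear form and by the
    quadric, and the remaining multiple of E by the cubics; the kernel of phi is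
    generated by the minors. *)
Theorem cover_ideal f :
  (forall v, (quad6 q).@[v] = 0 -> E.@[v] = 0 -> (quad6 r).@[v] != 0 -> (phi f).@[v] = 0) ->
  J f.
Proof.
move=> H.
have pf : supp (fun m => weight8 0 m) (phi f).
  by move=> m mf; apply: weight8_scroll; exact: phi_supp mf.
have [F0 [F1 [h [ef s0 s1]]]] : exists F0 F1 h, [/\ phi f = F0 + X 4 * F1 + E * h,
    supp (fun m => weight8 0 m && (m (inord 4) == 0%N)) F0 &
    supp (fun m => weight8 0 (U_(inord 4) + m)%MM && (m (inord 4) == 0%N)) F1].
  apply: reduce_p pf => [m|i j m ij]; last rewrite (weight8_pair 0 m ij).
    by rewrite /weight8 !even_shift // !mnmDE !mnm1E !inord_eq //= => /andP[-> h1]; lia.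
  by rewrite /weight8 even_shift // !mnmDE !mnm1E !inord_eq //= => /andP[-> h1]; lia.
have [[g0 e0] [g1 e1]] : (exists g, F0 = quad6 q * g) /\ (exists g, F1 = quad6 q * g).
  apply: cover_vanish.
  - by apply: sub_supp s0 => m /andP[_ /eqP].
  - by apply: sub_supp s1 => m /andP[_ /eqP].
  move=> v Qv Ev Rv; have := H v Qv Ev Rv.
  by rewrite ef mevalD (mevalM _ E) Ev mul0r addr0.
have Qg : quad6 q * (g0 + X 4 * g1) = F0 + X 4 * F1 by rewrite e0 e1; ring.
have sQg : supp (fun m => weight8 0 m) (quad6 q * (g0 + X 4 * g1)).
  rewrite Qg; apply: suppD; first by apply: sub_supp s0 => m /andP[].
  by apply/suppXM; apply: sub_supp s1 => m /andP[].
have sQ : supp (fun e => forall m, weight8 0 (e + m)%MM = weight8 2 m) (quad6 q).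
  by apply: supp_quad6 => i j ij m; exact: weight8_pair.
have [a [b [k eg]]] := weight2_lift r (restrictP (S := weight8 2) (f := g0 + X 4 * g1)).
have := restrict_factor sQ sQg; rewrite Qg eg => eF.
have EF : phi (f - lin10 q * a - bs8_quadric * b) = E * (h + quad6 q * k - half_quad6 * phi b).
  rewrite !comp_mpolyB !comp_mpolyM phi_quadric phi_lin10 ef eF; ring.
have [h' eh sh'] : exists2 h', E * (h + quad6 q * k - half_quad6 * phi b) = E * h' &
    supp (fun m => deep8 m) h'.
  by apply: cover_supp; rewrite -EF; exact: phi_supp.
have [g Jg egh] := deep_lift sh'.
have Jker : J (f - lin10 q * a - bs8_quadric * b - g).
  by apply: (scroll_kernel idJ) => //; rewrite comp_mpolyB EF eh egh subrr.
have -> : f = (f - lin10 q * a - bs8_quadric * b - g) + (lin10 q * a + bs8_quadric * b + g) by ring.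
by apply: idealD => //; apply: idealD => //; apply: idealD => //; apply: idealMr.
Qed.

End Assemble8.

Lemma mderivXU (F : fieldType) n (i j : 'I_n) : ('X_i : {mpoly F[n]})^`M(j) = (i == j)%:R%:MP.
Proof.
rewrite mderivX mnm1E; case: eqP => [->|_]; last by rewrite scale0r mpolyC0.
have -> : (U_(j) - U_(j))%MM = 0%MM by apply/mnmP => k; rewrite mnmBE mnm0E subnn.
by rewrite scale1r mpolyX0 mpolyC1.
Qed.

(** * Consequences of smoothness for the two quadrics *)

Section Quadrics4.
Variable F : numClosedFieldType.
Implicit Types (c q r : quad_coef F) (v : 'rV[F]_4).

Definition quad_val (c : quad_coef F) (x0 x1 x2 x3 : F) :=
  c00 c * x0 ^+ 2 + c11 c * x1 ^+ 2 + c22 c * x2 ^+ 2 + c33 c * x3 ^+ 2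
  + c01 c * (x0 * x1) + c23 c * (x2 * x3).

Lemma quadric_val c (v : 'I_4 -> F) :
  (quadric c).@[v] = quad_val c (v (inord 0)) (v (inord 1)) (v (inord 2)) (v (inord 3)).
Proof. by rewrite /quadric !mevalD !mevalZ !mevalM !mevalXU. Qed.

Lemma quadric_atE c (v : 'rV[F]_5) : quadric_at c v =
  quad_val c (v 0 (inord 0)) (v 0 (inord 1)) (v 0 (inord 2)) (v 0 (inord 3)).
Proof.
rewrite /quadric_at quadric_val; congr quad_val; congr (v 0 _);
  by apply: val_inj; rewrite /= !inordK.
Qed.

Lemma quad6_val c (v : 'I_6 -> F) :
  (quad6 c).@[v] = quad_val c (v (inord 0)) (v (inord 1)) (v (inord 2)) (v (inord 3)).
Proof. by rewrite /quad6 !mevalD !mevalM !mevalC !mevalXU /quad_val !expr2. Qed.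

Lemma lin10_val c (z : 'I_10 -> F) : (lin10 c).@[z] =
  c00 c * z (inord 4) + c11 c * z (inord 5) + c22 c * z (inord 6)
  + c33 c * z (inord 7) + c01 c * z (inord 8) + c23 c * z (inord 9).
Proof. by rewrite /lin10 !mevalD !mevalM !mevalC !mevalXU. Qed.

Definition quad_grad c v (k : nat) : F :=
  nth 0 [:: 2%:R * c00 c * v 0 (inord 0) + c01 c * v 0 (inord 1);
            2%:R * c11 c * v 0 (inord 1) + c01 c * v 0 (inord 0);
            2%:R * c22 c * v 0 (inord 2) + c23 c * v 0 (inord 3);
            2%:R * c33 c * v 0 (inord 3) + c23 c * v 0 (inord 2)] k.

Lemma quadric_grad c v (k : 'I_4) : ((quadric c)^`M(k)).@[v 0] = quad_grad c v k.
Proof.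
rewrite /quadric !mderivD !mderivZ !expr2 !mderivM !mderivXU.
rewrite !(mevalD, mevalZ, mevalM, mevalC, mevalXU).
move: k; apply: ord_iota => k; rewrite !inE.
by do 3?[case/orP]; move/eqP->; rewrite !inord_eq // inordK //= /quad_grad /=; ring.
Qed.

Section Smooth.
Variables q r : quad_coef F.
Hypothesis smooth : BS8_smooth q r.

Lemma grad_neq0 (x0 x1 x2 x3 : F) : quad_val q x0 x1 x2 x3 = 0 ->
  [|| x0 != 0, x1 != 0, x2 != 0 | x3 != 0] ->
  2%:R * c00 q * x0 + c01 q * x1 = 0 -> 2%:R * c11 q * x1 + c01 q * x0 = 0 ->
  2%:R * c22 q * x2 + c23 q * x3 = 0 -> 2%:R * c33 q * x3 + c23 q * x2 = 0 -> False.
Proof.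
move=> Qx nz g0 g1 g2 g3; pose v := row_of_seq 4 [:: x0; x1; x2; x3].
have vE k : (k < 4)%N -> v 0 (inord k) = [:: x0; x1; x2; x3]`_k by move=> k4; rewrite mxE inordK.
have v0 : v != 0.
  apply/eqP => /rowP v0; have := (v0 (inord 0), v0 (inord 1), v0 (inord 2), v0 (inord 3)).
  rewrite !vE // !mxE /= => -[[[e0 e1] e2] e3].
  by move: nz; rewrite e0 e1 e2 e3 eqxx.
have rf : row_free (jacobian (tnth [tuple quadric q]) v).
  by apply: (smooth.1 v v0) => i; rewrite (ord1 i) /= quadric_val !vE.
have : jacobian (tnth [tuple quadric q]) v = 0.
  apply/matrixP => i j; rewrite !mxE (ord1 i) /= quadric_grad /quad_grad !vE //=.
  by move: j; apply: ord_iota => k; rewrite !inE; do 3?[case/orP]; move/eqP->; rewrite inordK.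
by move=> J0; move: rf; rewrite J0 /row_free mxrank0.
Qed.

Lemma binary_singular (a b c : F) : b ^+ 2 - 4%:R * a * c = 0 ->
  exists x y, [/\ (x != 0) || (y != 0), 2%:R * a * x + b * y = 0,
                  2%:R * c * y + b * x = 0 & a * x ^+ 2 + c * y ^+ 2 + b * (x * y) = 0].
Proof.
move=> D0; have two : (2%:R : F) != 0 by rewrite pnatr_eq0.
have D1 : b ^+ 2 = 4%:R * a * c by apply/eqP; rewrite -subr_eq0 D0.
suff [x [y [nz g1 g2]]] : exists x y, [/\ (x != 0) || (y != 0), 2%:R * a * x + b * y = 0 &
    2%:R * c * y + b * x = 0].
  exists x, y; split=> //; apply/eqP; have : 2%:R * (a * x ^+ 2 + c * y ^+ 2 + b * (x * y)) == 0.
    apply/eqP; transitivity (x * (2%:R * a * x + b * y) + y * (2%:R * c * y + b * x)); first by ring.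
    by rewrite g1 g2 !mulr0 addr0.
  by rewrite mulf_eq0 (negbTE two).
case: (eqVneq a 0) => a0.
  exists 1, 0; rewrite oner_eq0 a0; split=> //; first by ring.
  have -> : b = 0 by apply/eqP; rewrite -sqrf_eq0 D1 a0; apply/eqP; ring.
  by ring.
exists b, (- (2%:R * a)); rewrite oppr_eq0 mulf_eq0 (negbTE two) (negbTE a0) orbT; split=> //.
  by ring.
by transitivity (b ^+ 2 - 4%:R * a * c); [ring | rewrite D0].
Qed.

(** The quadric Q is a sum of two binary forms, so a singular zero of one of them
    would be a singular point of Q. *)
Lemma disc_neq0 : c01 q ^+ 2 - 4%:R * c00 q * c11 q != 0 /\
                  c23 q ^+ 2 - 4%:R * c22 q * c33 q != 0.
Proof.
split; apply/eqP => /binary_singular[x [y [nz g1 g2 e]]].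
  by apply: (@grad_neq0 x y 0 0); rewrite ?eqxx ?orbF ?mulr0 ?addr0 // /quad_val -[RHS]e; ring.
by apply: (@grad_neq0 0 0 x y); rewrite ?eqxx ?mulr0 ?addr0 // /quad_val -[RHS]e; ring.
Qed.

Lemma quadric_point : exists2 v : 'rV[F]_4, v != 0 & (quadric q).@[v 0] = 0.
Proof.
have [x [y [nz e]]] : exists x y : F, ((x != 0) || (y != 0)) /\ c00 q * x ^+ 2 + c22 q * y ^+ 2 = 0.
  case: (eqVneq (c00 q) 0) => [->|a0]; first by exists 1, 0; rewrite oner_eq0; split=> //; ring.
  exists (sqrtC (- c22 q / c00 q)), 1; rewrite oner_eq0 orbT sqrtCK; split=> //; field.
  by [].
exists (row_of_seq 4 [:: x; 0; y; 0]).
  apply/eqP => /rowP v0; have := (v0 (inord 0), v0 (inord 2)).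
  by rewrite !mxE !inordK //= => -[e0 e1]; move: nz; rewrite e0 e1 eqxx.
by rewrite quadric_val !mxE !inordK //= /quad_val -[RHS]e; ring.
Qed.

(** If R vanished on Q it would be a multiple of Q, and the jacobian of (Q, R) would
    have dependent rows at any point of Q. *)
Lemma quadric_not_contained : exists2 v, (quad6 q).@[v] = 0 & (quad6 r).@[v] != 0.
Proof.
have [d1 d2] := disc_neq0.
case: (pselect (exists2 v, (quad6 q).@[v] = 0 & (quad6 r).@[v] != 0)) => // no.
have [g rg] : exists g, quad6 r = quad6 q * g.
  apply: (quadric_prime d1 d2 (H := 1)) => [v Qv|].
    by rewrite mulr1; apply: contra_notP no => /eqP; exists v.
  exists (fun=> 0); last by rewrite meval1 oner_eq0.
  by rewrite quad6_val /quad_val; ring.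
pose t := [tuple (if (i < 4)%N then 'X_(inord i) else 0) | i < 6] : 6.-tuple {mpoly F[4]}.
have tE c : quad6 c \mPo t = quadric c.
  rewrite /quad6 /quadric !comp_mpolyD !comp_mpolyM !comp_mpolyC !comp_mpolyXU.
  by rewrite -!tnth_nth !tnth_mktuple !inordK //= !mul_mpolyC !expr2.
have r4 : quadric r = quadric q * (g \mPo t) by rewrite -!tE rg comp_mpolyM.
have [v v0 qv] := quadric_point; exfalso.
have rv : (quadric r).@[v 0] = 0 by rewrite r4 mevalM qv mul0r.
have : row_free (jacobian (tnth [tuple quadric q; quadric r]) v).
  by apply: (smooth.2 v v0) => i; case: (unliftP ord0 i) => [j ->|->] //; rewrite (ord1 j).
set jac := jacobian _ _ => /row_freeP[B jB].
have := congr1 (mulmx (\row_(i < 2) (if i == ord0 then (g \mPo t).@[v 0] else -1))) jB.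
rewrite mulmxA mulmx1 => /rowP/(_ ord_max); rewrite [RHS]mxE /=.
rewrite [X in X *m B](_ : _ = 0) ?mul0mx ?mxE.
  by move/eqP; rewrite eq_sym oppr_eq0 oner_eq0.
apply/rowP => k; rewrite !mxE !big_ord_recl big_ord0 !mxE /=.
rewrite /tnth /= r4 mderivM mevalD !mevalM qv; ring.
Qed.
End Smooth.
End Quadrics4.

(** * Quadrics and cubics through the threefold of genus 8 *)

Section Equations8.
Variable F : numClosedFieldType.
Variables (q r : quad_coef F) (A : 'M[F]_(9, 10)).
Hypothesis coordA : BS8_coordinates q A.
Local Notation P10 := {mpoly F[10]}.
Local Notation Z k := ('X_(inord k) : P10).
Let W := BS8_in_P8 q r A.
Let G9 : set {mpoly F[9]} :=
  [set g | vanishing_ideal W g /\ (g \is 2.-homog \/ g \is 3.-homog)].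
Let J : set P10 := [set g | ideal_gen G9 (g \mPo lin_subst A)].

Let idJ : is_ideal J.
Proof.
have idG := ideal_gen_is_ideal G9; split=> [|a b|h a]; rewrite /J /=.
- by rewrite comp_mpoly0; exact: ideal0.
- by rewrite comp_mpolyD; exact: idealD.
- by rewrite comp_mpolyM; exact: idealM.
Qed.

Lemma BS8_map_val (v : 'rV[F]_5) k : (k < 10)%N ->
  let x0 := v 0 (inord 0) in let x1 := v 0 (inord 1) in
  let x2 := v 0 (inord 2) in let x3 := v 0 (inord 3) in
  let x4 := v 0 (inord 4) in let Rx := quad_val r x0 x1 x2 x3 in
  BS8_map r v 0 (inord k) =
   [:: x0 * (x4 ^+ 2 + Rx); x1 * (x4 ^+ 2 + Rx);
        x2 * (x4 ^+ 2 - Rx); x3 * (x4 ^+ 2 - Rx);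
        x4 * x0 ^+ 2; x4 * x1 ^+ 2; x4 * x2 ^+ 2; x4 * x3 ^+ 2;
        x4 * x0 * x1; x4 * x2 * x3]`_k.
Proof. by move=> k10 /=; rewrite row_of_seqE // quadric_atE. Qed.

(** W is a closure, so an equation need only be checked on the image of the rational map. *)
Let equation (g : P10) : g \is 2.-homog \/ g \is 3.-homog ->
  (forall v c, quadric_at q v = 0 -> g.@[(c *: BS8_map r v) 0] = 0) -> J g.
Proof.
move=> hg H; apply: sub_ideal_gen; split; last by case: hg => /dhomog_lin_subst h; [left|right].
move=> t [_ Wt]; rewrite meval_lin_subst; apply: Wt => z [v [[_ Qv] _]] /same_pointP[c _ ->].
exact: H.
Qed.

Let X2 i j : Z i * Z j \is 2.-homog.
Proof. by rewrite -mpolyXD dhomogX /= mdegD !mdeg1. Qed.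

Let lin1 (c : quad_coef F) : lin10 c \is 1.-homog.
Proof.
rewrite /lin10 !mul_mpolyC.
by do 5?[apply: rpredD]; apply: rpredZ; rewrite dhomogX /= mdeg1.
Qed.

Let nat_homog (d : nat) : (d%:R : P10) \is 0.-homog.
Proof. by rewrite -mpolyC_nat -[_%:MP]mulr1 mul_mpolyC; apply: rpredZ; exact: dhomog1. Qed.

Let X1 i : Z i \is 1.-homog.
Proof. by rewrite dhomogX /= mdeg1. Qed.

Let val_scale (c : F) v k : (k < 10)%N ->
  (c *: BS8_map r v) 0 (inord k) = c * BS8_map r v 0 (inord k).
Proof. by move=> _; rewrite mxE. Qed.

Let minor a b c d : all (fun k => k < 10)%N [:: a; b; c; d] ->
  (forall v, BS8_map r v 0 (inord a) * BS8_map r v 0 (inord b) =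
             BS8_map r v 0 (inord c) * BS8_map r v 0 (inord d)) ->
  J (Z a * Z b - Z c * Z d).
Proof.
move=> /=/and5P[ha hb hc hd _] H; apply: equation => [|v s _]; first by left; apply: rpredB; exact: X2.
by rewrite mevalB !mevalM !mevalXU !val_scale // mulrACA H; ring.
Qed.

Lemma BS8_minors : scroll_minors J.
Proof. by split; split; apply: minor => // v; rewrite !BS8_map_val //=; ring. Qed.

Lemma BS8_linear : J (lin10 q).
Proof.
rewrite /J /=; suff -> : lin10 q \mPo lin_subst A = 0 by apply: ideal0; exact: ideal_gen_is_ideal.
apply: meval_eq0 => v; pose t : 'rV[F]_9 := \row_i v i.
have -> : (lin10 q \mPo lin_subst A).@[v] = (lin10 q \mPo lin_subst A).@[t 0].
  by apply: meval_eq => i; rewrite mxE.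
by rewrite meval_lin_subst lin10_val; apply/(coordA.2 (t *m A)); exact: submxMl.
Qed.

Lemma BS8_quadric_mem : J (bs8_quadric q r).
Proof.
apply: equation => [|v c].
  left; rewrite /bs8_quadric; apply: rpredB.
    by rewrite !mul_mpolyC; do 5?[apply: rpredD]; apply: rpredZ; exact: X2.
  rewrite -[2%N]/(0 + 1 + 1)%N; apply: dhomogM; first exact: dhomogM (nat_homog _) (lin1 _).
  by rewrite !mul_mpolyC; do 2?[apply: rpredD]; apply: rpredZ; exact: X1.
rewrite quadric_atE => Qv; rewrite /bs8_quadric.
move: (lin10 r) (lin10_val r) => L LE.
rewrite !(meval_nat, mevalB, mevalD, mevalN, mevalM) LE !mevalC !mevalXU.
rewrite !val_scale // !BS8_map_val //=; move: Qv; rewrite /quad_val.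
move: (v 0 (inord 0)) (v 0 (inord 1)) (v 0 (inord 2)) (v 0 (inord 3)) (v 0 (inord 4)) => x0 x1 x2 x3 x4 Qv.
set Rx := (X in x4 ^+ 2 + X).
rewrite (_ : _ - _ = c ^+ 2 * (x4 ^+ 2 - Rx) ^+ 2 * (c00 q * x0 ^+ 2 + c11 q * x1 ^+ 2 + c22 q * x2 ^+ 2 + c33 q * x3 ^+ 2 +
     c01 q * (x0 * x1) + c23 q * (x2 * x3))); last by rewrite /Rx; ring.
by rewrite Qv mulr0.
Qed.

Lemma BS8_cubic_mem i j s k l t :
  (i, j, s) \in group1 -> (k, l, t) \in group2 -> J (bs8_cubic r i j s k l t).
Proof.
move=> g1 g2; apply: equation => [|v c Qv].
  right; rewrite /bs8_cubic -[3%N]/(2 + 1)%N; apply: rpredB; first exact: dhomogM (X2 _ _) (X1 _).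
  rewrite -[(2 + 1)%N]/(1 + 2)%N; apply: dhomogM (X1 _) _; apply: rpredD; first exact: X2.
  by rewrite -[2%N]/(0 + 1 + 1)%N; apply: dhomogM (X1 _); apply: dhomogM (nat_homog _) (lin1 _).
rewrite /bs8_cubic; move: (lin10 r) (lin10_val r) => L LE.
rewrite !(meval_nat, mevalB, mevalD, mevalN, mevalM) LE !mevalXU.
move: g1 g2; rewrite !inE => g1 g2.
by case/or3P: g1 => /eqP[-> -> ->]; case/or3P: g2 => /eqP[-> -> ->];
  rewrite !val_scale // !BS8_map_val //= /quad_val; ring.
Qed.

Hypothesis smooth : BS8_smooth q r.

(** A point of the double cover over R <> 0 is a point [x0 : ... : x3 : x4] of the cone
    with x4 = (p + m) / 2 <> 0, and the ten monomials are its coordinates divided by x4. *)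
Theorem BS8_generated : generated_by_quadrics_and_cubics (vanishing_ideal W).
Proof.
apply: generated_by_quadrics_and_cubicsI; first exact: vanishing_ideal_is_ideal.
move=> f fW; have [/row_freeP[B AB] hyp] := coordA.
suff : J (f \mPo lin_subst B) by rewrite /J /= lin_substK.
have [d1 d2] := disc_neq0 smooth.
apply: (cover_ideal idJ BS8_linear BS8_minors BS8_quadric_mem BS8_cubic_mem d1 d2
  (quadric_not_contained smooth)) => v Qv Ev Rv.
have two : (2%:R : F) != 0 by rewrite pnatr_eq0.
pose x4 := (v (inord 4) + v (inord 5)) / 2%:R; pose x4' := (v (inord 4) - v (inord 5)) / 2%:R.
have xx : x4 * x4' = (quad6 r).@[v].
  have : x4 * x4' - (quad6 r).@[v] = (cover_eq r).@[v] / 4%:R.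
    rewrite /cover_eq; move: (quad6 r) => R6.
    rewrite !(meval_nat, mevalB, mevalD, mevalN, mevalM) !mevalXU /x4 /x4'.
    by field.
  by rewrite Ev mul0r => /eqP; rewrite subr_eq0 => /eqP.
have e4 : v (inord 4) = x4 + x4' by rewrite /x4 /x4'; field.
have e5 : v (inord 5) = x4 - x4' by rewrite /x4 /x4'; field.
have x40 : x4 != 0 by apply: contraNneq Rv => x0; rewrite -xx x0 mul0r.
pose x := row_of_seq 5 [:: v (inord 0); v (inord 1); v (inord 2); v (inord 3); x4].
pose z : 'rV[F]_10 := \row_j (tnth (tbl_map F 9 5 bs8_tbl) j).@[v].
have zx : z = x4^-1 *: BS8_map r x.
  apply/rowP; apply: ord_iota => k k10; have {}k10 : (k < 10)%N by move: k10; rewrite mem_iota.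
  rewrite [LHS]mxE [RHS]mxE BS8_map_val // (tnth_nth 0) -comp_mpolyXU tbl_mapU // rmorph_prod.
  rewrite !row_of_seqE //= -quad6_val -xx !big_cons big_nil !rmorphXn /= !mevalXU.
  have : k \in iota 0 10 by rewrite mem_iota.
  by rewrite !inE; do 9?[case/orP]; move/eqP->; rewrite /= ?e4 ?e5; field.
have lz : (lin10 q).@[z 0] = 0.
  rewrite -Qv -phi_lin10 comp_mpoly_meval; apply: meval_eq => j; by rewrite mxE.
have /submxP[t zt] : (z <= A)%MS by apply/hyp; rewrite /BS8_hyperplane /= -lin10_val.
have z0 : z != 0.
  apply: contraNneq Rv => /rowP z0; rewrite quad6_val.
  have zval k : (k < 10)%N -> \prod_(j <- iota 0 6)
      v (inord j) ^+ nth 0%N (nth [::] bs8_tbl k) j = 0.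
    move=> k10; have := z0 (inord k); rewrite [LHS]mxE [RHS]mxE (tnth_nth 0) -comp_mpolyXU tbl_mapU //.
    rewrite rmorph_prod /= => <-; apply: eq_bigr => j _.
    by rewrite rmorphXn /= mevalXU.
  have sq (i k : nat) : (k < 10)%N -> \prod_(j <- iota 0 6)
      v (inord j) ^+ nth 0%N (nth [::] bs8_tbl k) j = v (inord i) ^+ 2 -> v (inord i) = 0.
    by move=> k10 e; apply/eqP; rewrite -sqrf_eq0 -e zval.
  have v0 : v (inord 0) = 0 by apply: (sq 0 4)%N; rewrite // !big_cons big_nil /= ?expr0 ?mulr1.
  have v1 : v (inord 1) = 0 by apply: (sq 1 5)%N; rewrite // !big_cons big_nil /= ?expr0 ?mul1r ?mulr1.
  have v2 : v (inord 2) = 0 by apply: (sq 2 6)%N; rewrite // !big_cons big_nil /= ?expr0 ?mul1r ?mulr1.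
  have v3 : v (inord 3) = 0 by apply: (sq 3 7)%N; rewrite // !big_cons big_nil /= ?expr0 ?mul1r ?mulr1.
  by rewrite /quad_val v0 v1 v2 v3 expr0n /= !mulr0 !addr0.
have Wt : W t.
  rewrite /W /BS8_in_P8 /= -zt; split=> // g gW; apply: gW; exists x; split.
  - split; last by rewrite quadric_atE !row_of_seqE //= -quad6_val.
    apply: contraNneq z0 => x0; rewrite zx.
    have := mxE; move: x40; have : x 0 (inord 4) = x4 by rewrite row_of_seqE.
    by rewrite x0 mxE => <-; rewrite eqxx.
  - by apply: contraNneq z0 => x0; rewrite zx x0 scaler0.
  - by apply/same_pointP; exists x4^-1 => //; rewrite invr_eq0.
rewrite comp_mpoly_meval.
have -> : (f \mPo lin_subst B).@[fun i => (tnth (tbl_map F 9 5 bs8_tbl) i).@[v]]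
   = (f \mPo lin_subst B).@[z 0] by apply: meval_eq => j; rewrite mxE.
by rewrite meval_lin_subst zt -mulmxA AB mulmx1; exact: fW.
Qed.
End Equations8.

(** * The scrolls of the threefold of genus 10 *)

Section Split.
Variables (F : fieldType) (n : nat).
Implicit Types f g : {mpoly F[n]}.

Lemma supp_split_var i f : exists f0 f1, f = f0 + 'X_i * f1 /\ supp (fun m => m i = 0%N) f0.
Proof.
exists (restrict (fun m => m i == 0%N) f),
  (\sum_(m <- msupp f | m i != 0%N) f@_m *: 'X_[m - U_(i)]); split; last first.
  by apply: sub_supp (restrictP (S := fun m => m i == 0%N) (f := f)) => m /eqP.
rewrite {1}(restrict_compl (fun m => m i == 0%N) f); congr (_ + _).
rewrite mulr_sumr; apply: eq_bigr => m mi /=.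
by rewrite -scalerAr -mpolyXD addmC submK // lep1mP.
Qed.

(** The divisor D0 + X_i D1 is prime to X_i since D0 <> 0 does not involve X_i. *)
Lemma cancel_var i D0 D1 f g : D0 != 0 -> supp (fun m => m i = 0%N) D0 ->
  'X_i * f = (D0 + 'X_i * D1) * g -> exists h, f = (D0 + 'X_i * D1) * h.
Proof.
move=> D00 sD e; have [g0 [g1 [eg sg]]] := supp_split_var i g.
have e0 : D0 * g0 = 'X_i * (f - D1 * g - D0 * g1).
  by rewrite !mulrBr e eg; ring.
have g00 : g0 = 0.
  apply/eqP; have : D0 * g0 == 0.
    apply/eqP; apply: (supp_contra (P1 := fun m => m i = 0%N) (P2 := fun m => m i != 0%N)).
    - by apply: suppM sD sg _ => a b; rewrite mnmDE => -> ->.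
    - by rewrite e0; apply/suppXM => m _; rewrite mnmDE mnm1E eqxx.
    by move=> m ->.
  by rewrite mulf_eq0 (negbTE D00).
exists g1; have X0 : 'X_i != 0 :> {mpoly F[n]}.
  by apply/eqP => /(congr1 (mcoeff U_(i))); rewrite mcoeffX eqxx mcoeff0 => /eqP; rewrite oner_eq0.
by apply: (mulfI X0); rewrite e eg g00; ring.
Qed.

End Split.

(** The variables of the target are y0, y1, then the invariants s0 = x6, s1 = x0 + x2,
    s2 = x1 + x4, s3 = x3 + x5 of the involution on the sextic surface, and the
    anti-invariants d1 = x0 - x2, d2 = x1 - x4, d3 = x3 - x5. The eleven coordinates
    are the A_k = y0^2 s_k, the B_k = y1^2 s_k and the C_l = y0 y1 d_l. *)
Definition bs10_tbl : seq (seq nat) :=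
  [:: [:: 2; 0; 1]; [:: 2; 0; 0; 1]; [:: 2; 0; 0; 0; 1]; [:: 2; 0; 0; 0; 0; 1];
      [:: 0; 2; 1]; [:: 0; 2; 0; 1]; [:: 0; 2; 0; 0; 1]; [:: 0; 2; 0; 0; 0; 1];
      [:: 1; 1; 0; 0; 0; 0; 1]; [:: 1; 1; 0; 0; 0; 0; 0; 1]; [:: 1; 1; 0; 0; 0; 0; 0; 0; 1]]%N.

Local Notation exp10 := (@tbl_exp 10 8 bs10_tbl).

Lemma exp10E a : [/\ exp10 a (inord 0) = 2 * (a (inord 0) + a (inord 1) + a (inord 2) + a (inord 3))
      + (a (inord 8) + a (inord 9) + a (inord 10)),
  exp10 a (inord 1) = 2 * (a (inord 4) + a (inord 5) + a (inord 6) + a (inord 7))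
      + (a (inord 8) + a (inord 9) + a (inord 10)),
  [/\ exp10 a (inord 2) = a (inord 0) + a (inord 4), exp10 a (inord 3) = a (inord 1) + a (inord 5),
      exp10 a (inord 4) = a (inord 2) + a (inord 6) & exp10 a (inord 5) = a (inord 3) + a (inord 7)] &
  [/\ exp10 a (inord 6) = a (inord 8), exp10 a (inord 7) = a (inord 9) &
      exp10 a (inord 8) = a (inord 10)]]%N.
Proof. by split; [| |split|split]; tblE; lia. Qed.

Section ToricMinors.
Variables (F : fieldType) (J : set {mpoly F[11]}).
Hypothesis idJ : is_ideal J.
Local Notation Z k := ('X_(inord k) : {mpoly F[11]}).
Hypothesis minJ : forall i j, (i < 4)%N -> (j < 4)%N -> J (Z i * Z j.+4 - Z j * Z i.+4).

Let half a b i : exp10 a = exp10 b -> (forall i, (a i == 0%N) || (b i == 0%N)) ->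
  (i < 4)%N -> (0 < a (inord i))%N ->
  exists c j, [/\ exp10 c = exp10 a, c j != 0%N & congruent J b c /\ a j != 0%N].
Proof.
move=> E dis i4 ai.
have [e0 e1 [e2 e3 e4 e5] [e6 e7 e8]] := exp10E a; have [f0 f1 [f2 f3 f4 f5] [f6 f7 f8]] := exp10E b.
rewrite E in e0 e1 e2 e3 e4 e5 e6 e7 e8.
have bi : (0 < b (inord i.+4))%N.
  have := dis (inord i); move: ai.
  have : i \in iota 0 4 by rewrite mem_iota.
  by rewrite !inE; do 3?[case/orP]; move/eqP-> => /=; lia.
have [j j4 bj] : exists2 j, (j < 4)%N & (0 < b (inord j))%N.
  have : (0 < a (inord 0) + a (inord 1) + a (inord 2) + a (inord 3))%N.
    have : i \in iota 0 4 by rewrite mem_iota.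
    by move: ai; rewrite !inE => ai; do 3?[case/orP]; move/eqP => ie; rewrite ie in ai; lia.
  have [h|[h|[h|h]]] : (0 < b (inord 0) \/ (0 < b (inord 1) \/ (0 < b (inord 2) \/
     (0 < b (inord 3) \/ (b (inord 0) + b (inord 1) + b (inord 2) + b (inord 3) = 0)))))%N by lia.
  - by exists 0%N. - by exists 1%N. - by exists 2%N.
  by case: h; [exists 3%N | lia].
have EE : exp10 (U_(inord j) + U_(inord i.+4))%MM = exp10 (U_(inord i) + U_(inord j.+4))%MM.
  apply/mnmP; apply: ord_iota => k k9; rewrite !tbl_expD !tbl_exp1 !mnmDE !mnmE !inordK ?(ltn_addr 7) //;
    try by [move: k9; rewrite mem_iota | lia].
  pose t i k := nth 0%N (nth [::] bs10_tbl i) k.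
  have /allP/(_ i) : all (fun i => all (fun j => all (fun k => t j k + t i.+4 k == t i k + t j.+4 k)%N
     (iota 0 9)) (iota 0 4)) (iota 0 4) by [].
  by rewrite mem_iota => /(_ i4)/allP/(_ j); rewrite mem_iota => /(_ j4)/allP/(_ k k9)/eqP.
have [|c [h1 h2 h3 h4]] := toric_move idJ (minJ j4 i4) EE (a := b).
  by apply: pair_mnm_le => //; rewrite inord_eq; lia.
exists c, (inord i); split; [congruence | done | split=> //; lia].
Qed.

(** The C_l are free, and the A_k, B_k are the coordinates of a Segre variety. *)
Lemma minors_kernel f : f \mPo tbl_map F 10 8 bs10_tbl = 0 -> J f.
Proof.
apply: (toric_kernel idJ (E := exp10)) => [m|]; first exact: tbl_mapX.
apply: (toric_connected idJ) => [a b|i|a b E dis ab]; first exact: tbl_expD.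
  rewrite tbl_exp1; apply/eqP => /mnmP; move: i; apply: ord_iota => k; rewrite !inE.
  by do 10?[case/orP]; move/eqP-> => h;
    have := (h (inord 0), h (inord 1)); rewrite !mnmE !inordK //= => -[].
case: (pickP (fun i : 'I_4 => 0 < a (inord i)))%N => [i ai|az].
  have [c [j [? ? [? ?]]]] := half E dis (ltn_ord i) ai.
  by exists c, j; split=> //; right.
case: (pickP (fun i : 'I_4 => 0 < b (inord i)))%N => [i bi|bz].
  have [|c [j [? ? [? ?]]]] := half (esym E) _ (ltn_ord i) bi; first by move=> k; rewrite orbC.
  by exists c, j; split=> //; [congruence | left].
have [e0 e1 [e2 e3 e4 e5] [e6 e7 e8]] := exp10E a; have [f0 f1 [f2 f3 f4 f5] [f6 f7 f8]] := exp10E b.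
rewrite E in e0 e1 e2 e3 e4 e5 e6 e7 e8.
have az' k : (k < 4)%N -> (a (inord k) = 0 /\ b (inord k) = 0)%N.
  by move=> k4; have := (az (Ordinal k4), bz (Ordinal k4)) => /= -[]; lia.
have [[a0 b0] [a1 b1]] := (az' 0%N isT, az' 1%N isT).
have [[a2 b2] [a3 b3]] := (az' 2%N isT, az' 3%N isT).
case/eqP: ab; apply/mnmP.
by apply: ord_iota => k; rewrite !inE; do 10?[case/orP]; move/eqP->; lia.
Qed.
End ToricMinors.

(** * Multiples of the Cayley cubic *)

Lemma joukowski (F : numClosedFieldType) (l s : F) : l != 0 ->
  exists2 a, a != 0 & l * (a + a^-1) = s.
Proof.
move=> l0; pose t := sqrtC (s ^+ 2 - 4%:R * l ^+ 2).
have t2 : t ^+ 2 = s ^+ 2 - 4%:R * l ^+ 2 by rewrite sqrtCK.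
have two : (2%:R : F) != 0 by rewrite pnatr_eq0.
have key : (s + t) * (s - t) = 4%:R * l ^+ 2 by rewrite mulrC -subr_sqr t2; ring.
have st : s + t != 0.
  apply: contraTneq (l0) => st; rewrite negbK; move: key; rewrite st mul0r => /esym/eqP.
  by rewrite mulf_eq0 pnatr_eq0 /= sqrf_eq0.
exists ((s + t) / (2%:R * l)); first by rewrite mulf_neq0 // invr_eq0 mulf_neq0.
have -> : ((s + t) / (2%:R * l))^-1 = (s - t) / (2%:R * l).
  apply: (mulfI (_ : (s + t) / (2%:R * l) != 0)); first by rewrite mulf_neq0 // invr_eq0 mulf_neq0.
  rewrite mulfV; last by rewrite mulf_neq0 // invr_eq0 mulf_neq0.
  transitivity ((s + t) * (s - t) / (4%:R * l ^+ 2)); last by field.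
  by rewrite key divff // mulf_neq0 ?pnatr_eq0 // expf_neq0.
by field; rewrite ?l0 ?two.
Qed.

Section Cayley.
Variable F : numClosedFieldType.
Local Notation S9 := {mpoly F[9]}.
Local Notation X k := ('X_(inord k) : S9).

(** The point (a, c) of the torus of the sextic surface, scaled by l, together with a
    point of the line. *)
Definition torus_point (y0 y1 l a c : F) : 'I_9 -> F := fun i =>
  [:: y0; y1; l; l * (a + a^-1); l * (a * c + (a * c)^-1); l * (c + c^-1);
      l * (a - a^-1); l * (a * c - (a * c)^-1); l * (c - c^-1)]`_i.

Definition on_torus (P : S9) := forall y0 y1 l a c, y0 != 0 -> y1 != 0 -> l != 0 ->
  a != 0 -> c != 0 -> P.@[torus_point y0 y1 l a c] = 0.

Definition no_d (m : 'X_{1..9}) := [&& m (inord 6) == 0, m (inord 7) == 0 & m (inord 8) == 0]%N.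

(** Half the determinant of the symmetric matrix M with rows (2 s0, s3, s2),
    (s3, 2 s0, s1), (s2, s1, 2 s0). Its zeros form the Cayley cubic surface, which is
    the quotient of the sextic surface by the involution. *)
Definition cayley : S9 :=
  4%:R * (X 2 * X 2 * X 2) + X 3 * X 4 * X 5 - X 2 * (X 3 * X 3 + X 4 * X 4 + X 5 * X 5).

(** The cubic is quadratic in s2, with leading coefficient - s0. *)
Let pseudo_division (P : S9) : supp (fun m => no_d m) P ->
  exists N g r0 r1, [/\ X 2 ^+ N * P = cayley * g + r0 + X 4 * r1,
    supp (fun m => no_d m && (m (inord 4) == 0%N)) r0 &
    supp (fun m => no_d m && (m (inord 4) == 0%N)) r1].
Proof.
pose S m := no_d m && (m (inord 4) == 0%N).
pose V (P : S9) := exists N g r0 r1, [/\ X 2 ^+ N * P = cayley * g + r0 + X 4 * r1,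
    supp (fun m => S m) r0 & supp (fun m => S m) r1].
have V0 : V 0.
  by exists 0%N, 0, 0, 0; rewrite !mulr0 !addr0; split=> //; exact: supp0.
have SX N (r : S9) : supp (fun m => S m) r -> supp (fun m => S m) (X 2 ^+ N * r).
  elim: N => [|N IH] sr; first by rewrite mul1r.
  rewrite exprS -mulrA; apply/suppXM; apply: sub_supp (IH sr) => m.
  by rewrite /S /no_d !mnmDE !mnm1E !inord_eq.
have VD a b : V a -> V b -> V (a + b).
  move=> [N [g [r0 [r1 [e s0 s1]]]]] [N' [g' [r0' [r1' [e' s0' s1']]]]].
  exists (N + N')%N, (X 2 ^+ N' * g + X 2 ^+ N * g'),
    (X 2 ^+ N' * r0 + X 2 ^+ N * r0'), (X 2 ^+ N' * r1 + X 2 ^+ N * r1').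
  split; try by apply: suppD; apply: SX.
  transitivity (X 2 ^+ N' * (X 2 ^+ N * a) + X 2 ^+ N * (X 2 ^+ N' * b)).
    by rewrite exprD; ring.
  by rewrite e e'; ring.
have VZ (c : F) a : V a -> V (c *: a).
  move=> [N [g [r0 [r1 [e s0 s1]]]]]; exists N, (c *: g), (c *: r0), (c *: r1).
  split; try exact: suppZ.
  by rewrite -scalerAr e !scalerDr !scalerAr.
move=> sP; suff VX m : no_d m -> V 'X_[m] by exact: (supp_ind sP V0 VD VZ).
have [K] := ubnP (m (inord 4)); elim: K m => // K IH m mK nd.
case: (leqP (m (inord 4)) 1) => m4.
  case: (posnP (m (inord 4))) => m40.
    exists 0%N, 0, 'X_[m], 0; rewrite mul1r !mulr0 !(addr0, add0r); split=> //; last exact: supp0.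
    by apply: suppX; rewrite /S nd m40.
  have [m' em] : exists m', m = (U_(inord 4) + m')%MM.
    by exists (m - U_(inord 4))%MM; rewrite addmC submK // lep1mP; lia.
  exists 0%N, 0, 0, 'X_[m']; rewrite mul1r !mulr0 !(addr0, add0r) em mpolyXD; split=> //; first exact: supp0.
  by apply: suppX; move: nd m4; rewrite em /S /no_d !mnmDE !mnm1E !inord_eq //=; lia.
have [m' em] : exists m', m = (U_(inord 4) + U_(inord 4) + m')%MM.
  exists (m - (U_(inord 4) + U_(inord 4)))%MM; rewrite addmC submK //.
  by apply: pair_mnm_le; rewrite ?eqxx // (ltn_trans _ m4).
pose rest : S9 := X 3 * X 5 * X 4 + (4%:R *: (X 2 * X 2 * X 2) - X 2 * X 3 * X 3 - X 2 * X 5 * X 5).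
have : V (rest * 'X_[m']).
  have sr : supp (fun m => no_d m && (m (inord 4) < K)%N) (rest * 'X_[m']).
    rewrite mulrC; apply/suppXM; rewrite /rest -!mpolyXD.
    move: mK nd; rewrite em /no_d !mnmDE !mnm1E !inord_eq //= => mK nd.
    apply: suppD; last apply: suppB; last apply: suppX; first apply: suppX; last first.
    - by rewrite !mnmDE !mnm1E !inord_eq //=; lia.
    - apply: suppB; first apply: suppZ; apply: suppX; rewrite !mnmDE !mnm1E !inord_eq //=; lia.
    - by rewrite !mnmDE !mnm1E !inord_eq //=; lia.
  by apply: (supp_ind sr V0 VD VZ) => a /andP[nda aK]; exact: IH.
move=> [N [g [r0 [r1 [e s0 s1]]]]]; exists N.+1, (g - X 2 ^+ N * 'X_[m']), r0, r1; split=> //.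
transitivity (X 2 ^+ N * (rest * 'X_[m']) - cayley * (X 2 ^+ N * 'X_[m'])).
  by rewrite exprSr /rest /cayley em !mpolyXD -mul_mpolyC mpolyC_nat; ring.
by rewrite e; ring.
Qed.

Let ev (v : 'I_9 -> F) (P : S9) : supp (fun m => no_d m && (m (inord 4) == 0%N)) P ->
  forall w : 'I_9 -> F, (forall k, k \in [:: 0; 1; 2; 3; 5]%N -> w (inord k) = v (inord k)) -> P.@[w] = P.@[v].
Proof.
move=> sP w H; apply: meval_supp; apply: sub_supp sP => m.
case/andP=> /and3P[/eqP m6 /eqP m7 /eqP m8] /eqP m4.
by apply: ord_iota => k; rewrite !inE; do 8?[case/orP]; move/eqP-> => wv //; case: wv; apply: H.
Qed.

Lemma no_zero_product (P Q : S9) (v : 'I_9 -> F) : Q.@[v] != 0 ->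
  (forall v, Q.@[v] * P.@[v] = 0) -> P = 0.
Proof.
move=> Qv H; apply/eqP; have : Q * P == 0.
  by apply/eqP; apply: meval_eq0 => w; rewrite mevalM.
rewrite mulf_eq0 => /orP[/eqP Q0|//].
by rewrite Q0 meval0 eqxx in Qv.
Qed.

(** The projection to the coordinates (s0, s1, s3) makes the Cayley cubic a double
    plane, and over a general point of the plane both points of the surface are torus
    points, (a, c) and (a, 1 / c). So a remainder r0 + s2 r1 that vanishes on the torus
    is 0; the powers of s0 are then cancelled. *)
Lemma cayley_dvd (P : S9) : supp (fun m => no_d m) P -> on_torus P -> exists g, P = cayley * g.
Proof.
move=> /pseudo_division[N [g [r0 [r1 [e s0 s1]]]]] tP.
have D0 y0 y1 l a c : a != 0 -> c != 0 -> cayley.@[torus_point y0 y1 l a c] = 0.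
  move=> a0 c0; rewrite /cayley !(meval_nat, mevalB, mevalD, mevalM) !mevalXU /torus_point !inordK //=.
  by field; rewrite a0 c0.
have tr y0 y1 l a c : y0 != 0 -> y1 != 0 -> l != 0 -> a != 0 -> c != 0 ->
    r0.@[torus_point y0 y1 l a c] +
    l * (a * c + (a * c)^-1) * r1.@[torus_point y0 y1 l a c] = 0.
  move=> h0 h1 hl ha hc; have := congr1 (meval (torus_point y0 y1 l a c)) e.
  rewrite mevalM tP // mulr0 mevalD (mevalD _ (cayley * g)) mevalM D0 // mul0r add0r mevalM mevalXU.
  have -> : torus_point y0 y1 l a c (inord 4) = l * (a * c + (a * c)^-1).
    by rewrite /torus_point inordK.
  by move=> <-.
have key v : v (inord 0) != 0 -> v (inord 1) != 0 -> v (inord 2) != 0 ->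
    (v (inord 3) ^+ 2 - 4%:R * v (inord 2) ^+ 2) * (v (inord 5) ^+ 2 - 4%:R * v (inord 2) ^+ 2) * r1.@[v] = 0 /\
    (r1.@[v] = 0 -> r0.@[v] = 0).
  move=> h0 h1 h2.
  have [a a0 ea] := joukowski (v (inord 3)) h2; have [c c0 ec] := joukowski (v (inord 5)) h2.
  have ci0 : c^-1 != 0 by rewrite invr_eq0.
  have E1 := tr _ _ _ _ _ h0 h1 h2 a0 c0; have E2 := tr _ _ _ _ _ h0 h1 h2 a0 ci0.
  have tv c' : v (inord 2) * (c' + c'^-1) = v (inord 5) -> forall k, k \in [:: 0; 1; 2; 3; 5]%N ->
      torus_point (v (inord 0)) (v (inord 1)) (v (inord 2)) a c' (inord k) = v (inord k).
    move=> ec' k; rewrite !inE /torus_point.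
    by do 4?[case/orP]; move/eqP->; rewrite inordK //= ?ea ?ec'.
  have ec' : v (inord 2) * (c^-1 + c^-1^-1) = v (inord 5) by rewrite invrK addrC.
  rewrite (ev s0 (tv _ ec)) (ev s1 (tv _ ec)) in E1.
  rewrite (ev s0 (tv _ ec')) (ev s1 (tv _ ec')) in E2.
  split; last by move=> r10; move: E1; rewrite r10 mulr0 addr0.
  set l := v (inord 2) in h2 ea ec E1 E2 *.
  have : l * (a - a^-1) * (c - c^-1) * r1.@[v] = 0.
    rewrite -[RHS](subrr 0) -{1}E1 -E2; field; by rewrite a0 c0.
  rewrite -ea -ec => E3; transitivity (l ^+ 3 * (a - a^-1) * (c - c^-1) *
    (l * (a - a^-1) * (c - c^-1) * r1.@[v])); last by rewrite E3 mulr0.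
  by field; rewrite a0 c0.
(* A point at which the factors of r1 and r0 below do not vanish. *)
pose v1 : 'I_9 -> F := fun i => if i == inord 3 then 0 else if i == inord 5 then 0 else 1.
have v1E k : (k < 9)%N -> v1 (inord k) = if (k == 3)%N || (k == 5)%N then 0 else 1.
  by move=> k9; rewrite /v1 !inord_eq //; case: eqP; case: eqP.
have r10 : r1 = 0.
  pose Q : S9 := X 0 * X 1 * X 2 * ((X 3 ^+ 2 - 4%:R * X 2 ^+ 2) * (X 5 ^+ 2 - 4%:R * X 2 ^+ 2)).
  have QE v : Q.@[v] = v (inord 0) * v (inord 1) * v (inord 2) *
     ((v (inord 3) ^+ 2 - 4%:R * v (inord 2) ^+ 2) * (v (inord 5) ^+ 2 - 4%:R * v (inord 2) ^+ 2)).
    by rewrite /Q !expr2 !(meval_nat, mevalB, mevalM) !mevalXU.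
  apply: (@no_zero_product _ Q v1).
    rewrite QE !v1E //= expr0n expr1n !mul1r sub0r mulr1 mulrNN mulf_neq0 // pnatr_eq0 //.
  move=> v; rewrite QE.
  case: (eqVneq (v (inord 0)) 0) => [->|h0]; first by rewrite !mul0r.
  case: (eqVneq (v (inord 1)) 0) => [->|h1]; first by rewrite mulr0 !mul0r.
  case: (eqVneq (v (inord 2)) 0) => [->|h2]; first by rewrite mulr0 !mul0r.
  by rewrite -mulrA (key v h0 h1 h2).1 mulr0.
have r00 : r0 = 0.
  apply: (@no_zero_product _ (X 0 * X 1 * X 2) v1).
    by rewrite !mevalM !mevalXU !v1E //= !mul1r oner_eq0.
  move=> v; rewrite !mevalM !mevalXU.
  case: (eqVneq (v (inord 0)) 0) => [->|h0]; first by rewrite !mul0r.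
  case: (eqVneq (v (inord 1)) 0) => [->|h1]; first by rewrite mulr0 !mul0r.
  case: (eqVneq (v (inord 2)) 0) => [->|h2]; first by rewrite mulr0 !mul0r.
  by rewrite (key v h0 h1 h2).2 ?mulr0 // r10 meval0.
move: e; rewrite r00 r10 mulr0 !addr0; elim: N P {tP} g => [|N IH] P g e.
  by exists g; rewrite -e mul1r.
have cE : cayley = X 3 * X 4 * X 5 + X 2 * (4%:R * (X 2 * X 2) - (X 3 * X 3 + X 4 * X 4 + X 5 * X 5)).
  by rewrite /cayley; ring.
have [h eh] : exists h, X 2 ^+ N * P = (X 3 * X 4 * X 5 + X 2 * (4%:R * (X 2 * X 2) - (X 3 * X 3 + X 4 * X 4 + X 5 * X 5))) * h.
  apply: (cancel_var (g := g)).
  - by rewrite !mulf_neq0 //; apply/eqP => /(congr1 (meval (fun=> 1)))/eqP; rewrite mevalXU meval0 oner_eq0.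
  - by rewrite -!mpolyXD; apply: suppX; rewrite !mnmDE !mnm1E !inord_eq.
  by rewrite -cE mulrA -exprS.
by apply: (IH P h); rewrite cE.
Qed.

End Cayley.

(** * Reduction to the sextic surface *)

Section Assemble10.
Variable F : numClosedFieldType.
Local Notation S9 := {mpoly F[9]}.
Local Notation P11 := {mpoly F[11]}.
Local Notation X k := ('X_(inord k) : S9).
Local Notation Z k := ('X_(inord k) : P11).
Local Notation phi f := ((f : P11) \mPo tbl_map F 10 8 bs10_tbl).

Lemma phi_var10 k : (k < 11)%N -> phi (Z k) =
  [:: X 0 ^+ 2 * X 2; X 0 ^+ 2 * X 3; X 0 ^+ 2 * X 4; X 0 ^+ 2 * X 5;
      X 1 ^+ 2 * X 2; X 1 ^+ 2 * X 3; X 1 ^+ 2 * X 4; X 1 ^+ 2 * X 5;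
      X 0 * X 1 * X 6; X 0 * X 1 * X 7; X 0 * X 1 * X 8]`_k.
Proof.
move=> k11; rewrite tbl_mapU // !big_cons big_nil.
by move: k11; do 11?[case: k => [_|k]] => //=; ring.
Qed.

Lemma cayley_neq0 : cayley F != 0.
Proof.
apply/eqP => /(congr1 (meval (fun i => if i == inord 2 then 1 else 0))) /eqP.
rewrite meval0 /cayley !(meval_nat, mevalB, mevalD, mevalM) !mevalXU !inord_eq //= ?eqxx.
by rewrite !(mulr0, mul0r, addr0, subr0, mulr1) pnatr_eq0.
Qed.

(** On the sextic surface e = (d1, - d2, d3) spans the kernel of M, and the adjugate
    of M is - e e^T. If e . F vanishes there, then adj(M) F vanishes, hence is a
    multiple H of the Cayley cubic; multiplying by M gives F = M H / 2. *)
Lemma cayley_syzygy (F1 F2 F3 : S9) :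
  supp (fun m => no_d m) F1 -> supp (fun m => no_d m) F2 -> supp (fun m => no_d m) F3 ->
  on_torus (X 6 * F1 - X 7 * F2 + X 8 * F3) ->
  exists G1 G2 G3, [/\ F1 = 2%:R * X 2 * G1 + X 5 * G2 + X 4 * G3,
    F2 = X 5 * G1 + 2%:R * X 2 * G2 + X 3 * G3 & F3 = X 4 * G1 + X 3 * G2 + 2%:R * X 2 * G3].
Proof.
move=> s1 s2 s3 T.
pose A11 : S9 := 4%:R * (X 2 * X 2) - X 3 * X 3.
pose A22 : S9 := 4%:R * (X 2 * X 2) - X 4 * X 4.
pose A33 : S9 := 4%:R * (X 2 * X 2) - X 5 * X 5.
pose A12 : S9 := X 3 * X 4 - 2%:R * (X 2 * X 5).
pose A13 : S9 := X 3 * X 5 - 2%:R * (X 2 * X 4).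
pose A23 : S9 := X 4 * X 5 - 2%:R * (X 2 * X 3).
have sX i j : (i < 6)%N -> (j < 6)%N -> supp (fun m => no_d m) (X i * X j).
  move=> i6 j6; rewrite -mpolyXD; apply: suppX; rewrite /no_d !mnmDE !mnm1E !inord_eq //; lia.
have sN d (P : S9) : supp (fun m => no_d m) P -> supp (fun m => no_d m) (d%:R * P).
  by move=> sP; rewrite -mpolyC_nat mul_mpolyC; exact: suppZ.
have sM (P Q : S9) : supp (fun m => no_d m) P -> supp (fun m => no_d m) Q -> supp (fun m => no_d m) (P * Q).
  by move=> sP sQ; apply: suppM sP sQ _ => a b; rewrite /no_d !mnmDE; lia.
have row (a1 a2 a3 e : S9) : supp (fun m => no_d m) a1 -> supp (fun m => no_d m) a2 ->
   supp (fun m => no_d m) a3 ->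
   (forall y0 y1 l a c, a != 0 -> c != 0 -> let w := torus_point y0 y1 l a c in
     [/\ a1.@[w] = - e.@[w] * (X 6).@[w], a2.@[w] = e.@[w] * (X 7).@[w] &
         a3.@[w] = - e.@[w] * (X 8).@[w]]) ->
   exists h, a1 * F1 + a2 * F2 + a3 * F3 = cayley F * h.
  move=> sa1 sa2 sa3 H; apply: cayley_dvd.
    by do 2?[apply: suppD]; apply: sM.
  move=> y0 y1 l a c h0 h1 hl ha hc; have [E1 E2 E3] := H y0 y1 l a c ha hc.
  have := T y0 y1 l a c h0 h1 hl ha hc.
  rewrite 2!(mevalD _ _ (_ * F3)) mevalB mevalD !mevalM E1 E2 E3 => E4.
  rewrite -[RHS](mulr0 (- e.@[torus_point y0 y1 l a c])) -E4; ring.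
have [H1 e1] : exists h, A11 * F1 + A12 * F2 + A13 * F3 = cayley F * h.
  apply: (row _ _ _ (X 6)); rewrite /A11 /A12 /A13; try by apply: suppB; rewrite ?(sN, sX); try apply: sN; apply: sX.
  move=> y0 y1 l a c ha hc /=; rewrite !(meval_nat, mevalB, mevalM) !mevalXU /torus_point !inordK //=.
  by split; field; rewrite ?ha ?hc.
have [H2 e2] : exists h, A12 * F1 + A22 * F2 + A23 * F3 = cayley F * h.
  apply: (row _ _ _ (- X 7)); rewrite /A22 /A12 /A23; try by apply: suppB; rewrite ?(sN, sX); try apply: sN; apply: sX.
  move=> y0 y1 l a c ha hc /=; rewrite !(meval_nat, mevalB, mevalM, mevalN) !mevalXU /torus_point !inordK //=.
  by split; field; rewrite ?ha ?hc.
have [H3 e3] : exists h, A13 * F1 + A23 * F2 + A33 * F3 = cayley F * h.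
  apply: (row _ _ _ (X 8)); rewrite /A33 /A13 /A23; try by apply: suppB; rewrite ?(sN, sX); try apply: sN; apply: sX.
  move=> y0 y1 l a c ha hc /=; rewrite !(meval_nat, mevalB, mevalM, mevalN) !mevalXU /torus_point !inordK //=.
  by split; field; rewrite ?ha ?hc.
pose hf : S9 := (2%:R^-1 : F)%:MP.
have hf2 : 2%:R * hf = 1.
  by rewrite /hf -(mpolyC_nat 9 F) -mpolyCM mulfV ?mpolyC1 // pnatr_eq0.
have c2 : 2%:R * cayley F != 0.
  by rewrite mulf_neq0 ?cayley_neq0 // -(mpolyC_nat 9 F) mpolyC_eq0 pnatr_eq0.
exists (hf * H1), (hf * H2), (hf * H3); split; apply: (mulfI c2).
- apply: (lincomb (eqD (eqD (eqM (2%:R * X 2) e1) (eqD (eqM (X 5) e2) (eqM (X 4) e3)))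
    (eqM (- (cayley F * (2%:R * X 2 * H1 + X 5 * H2 + X 4 * H3))) hf2))).
  by rewrite /A11 /A12 /A13 /A22 /A23 /A33 /cayley; ring.
- apply: (lincomb (eqD (eqD (eqM (X 5) e1) (eqD (eqM (2%:R * X 2) e2) (eqM (X 3) e3)))
    (eqM (- (cayley F * (X 5 * H1 + 2%:R * X 2 * H2 + X 3 * H3))) hf2))).
  by rewrite /A11 /A12 /A13 /A22 /A23 /A33 /cayley; ring.
apply: (lincomb (eqD (eqD (eqM (X 4) e1) (eqD (eqM (X 3) e2) (eqM (2%:R * X 2) e3)))
  (eqM (- (cayley F * (X 4 * H1 + X 3 * H2 + 2%:R * X 2 * H3))) hf2))).
by rewrite /A11 /A12 /A13 /A22 /A23 /A33 /cayley; ring.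
Qed.

(** The three equations M e = 0, multiplied by y0 y1 and evaluated on the block of
    coordinates that begins at t. *)
Definition syz (l : nat) (t : nat) : P11 :=
  nth 0 [:: 2%:R * Z t * Z 8 - Z t.+3 * Z 9 + Z t.+2 * Z 10;
            Z t.+3 * Z 8 - 2%:R * Z t * Z 9 + Z t.+1 * Z 10;
            Z t.+2 * Z 8 - Z t.+1 * Z 9 + 2%:R * Z t * Z 10] l.

(** The adjugate of M, up to sign, with one factor in each of the two blocks. *)
Definition adj (i j : nat) : P11 :=
  nth 0 (nth [::] [:: [:: Z 1 * Z 5 - 4%:R * (Z 0 * Z 4); Z 1 * Z 6 - 2%:R * (Z 0 * Z 7); 2%:R * (Z 0 * Z 6) - Z 1 * Z 7];
          [:: Z 1 * Z 6 - 2%:R * (Z 0 * Z 7); Z 2 * Z 6 - 4%:R * (Z 0 * Z 4); Z 2 * Z 7 - 2%:R * (Z 0 * Z 5)];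
          [:: 2%:R * (Z 0 * Z 6) - Z 1 * Z 7; Z 2 * Z 7 - 2%:R * (Z 0 * Z 5); Z 3 * Z 7 - 4%:R * (Z 0 * Z 4)]] i) j.

(** The polarizations of the Cayley cubic to the two blocks. *)
Definition cub (u v w : nat) : P11 :=
  4%:R * (Z u * Z v * Z w) + Z u.+1 * Z v.+2 * Z w.+3
  - Z u * (Z v.+1 * Z w.+1 + Z v.+2 * Z w.+2 + Z v.+3 * Z w.+3).

Definition blocks : seq (nat * nat * nat) := [:: (0, 0, 0); (0, 0, 4); (0, 4, 4); (4, 4, 4)]%N.

Variable J : set P11.
Hypothesis idJ : is_ideal J.
Hypothesis adjJ : forall i j, (i < 3)%N -> (j < 3)%N -> J (Z (8 + i)%N * Z (8 + j)%N - adj i j).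

Definition low (m : 'X_{1..11}) := (m (inord 8) + m (inord 9) + m (inord 10) <= 1)%N.

(** The products C_i C_j are quadratic in the A_k, B_k modulo J. *)
Lemma reduce_C (f : P11) : exists2 f', J (f - f') & supp (fun m => low m) f'.
Proof.
pose V (f : P11) := exists2 f', J (f - f') & supp (fun m => low m) f'.
have V0 : V 0 by exists 0; [rewrite subrr; exact: ideal0 | exact: supp0].
have VD a b : V a -> V b -> V (a + b).
  move=> [a' Ja sa] [b' Jb sb]; exists (a' + b'); last exact: suppD.
  by rewrite opprD addrACA; exact: idealD.
have VZ (c : F) a : V a -> V (c *: a).
  move=> [a' Ja sa]; exists (c *: a'); last exact: suppZ.
  by rewrite -scalerBr; exact: idealZ.
have VJ a b : J (a - b) -> V b -> V a.
  by move=> Jab [b' Jb sb]; exists b' => //; exact: ideal_trans Jab Jb.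
suff VX m : True -> V 'X_[m] by exact: (supp_ind (P := fun=> True) (f := f) (fun _ _ => I) V0 VD VZ).
move=> _; pose cd (m : 'X_{1..11}) := (m (inord 8) + m (inord 9) + m (inord 10))%N.
have [K] := ubnP (cd m); elim: K m => // K IH m mK.
case: (boolP (low m)) => [lm|]; first by exists 'X_[m]; [rewrite subrr; exact: ideal0 | exact: suppX].
rewrite /low -ltnNge => hm.
have [i [j [i3 j3 le]]] : exists i j, [/\ (i < 3)%N, (j < 3)%N & (U_(inord (8 + i)) + U_(inord (8 + j)) <= m)%MM].
  have [h|[h|[h|[h|[h|h]]]]] : (1 < m (inord 8) \/ (1 < m (inord 9) \/ (1 < m (inord 10) \/
      ((0 < m (inord 8) /\ 0 < m (inord 9)) \/ ((0 < m (inord 8) /\ 0 < m (inord 10)) \/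
       (0 < m (inord 9) /\ 0 < m (inord 10)))))))%N by lia.
  - by exists 0%N, 0%N; split=> //; rewrite ?addn0 ?addn1 ?addn2; apply: pair_mnm_le; rewrite ?inord_eq //=; lia.
  - by exists 1%N, 1%N; split=> //; rewrite ?addn0 ?addn1 ?addn2; apply: pair_mnm_le; rewrite ?inord_eq //=; lia.
  - by exists 2%N, 2%N; split=> //; rewrite ?addn0 ?addn1 ?addn2; apply: pair_mnm_le; rewrite ?inord_eq //=; lia.
  - by exists 0%N, 1%N; split=> //; rewrite ?addn0 ?addn1 ?addn2; apply: pair_mnm_le; rewrite ?inord_eq //=; lia.
  - by exists 0%N, 2%N; split=> //; rewrite ?addn0 ?addn1 ?addn2; apply: pair_mnm_le; rewrite ?inord_eq //=; lia.
  - by exists 1%N, 2%N; split=> //; rewrite ?addn0 ?addn1 ?addn2; apply: pair_mnm_le; rewrite ?inord_eq //=; lia.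
have [m' em] : exists m', m = (U_(inord (8 + i)) + U_(inord (8 + j)) + m')%MM.
  by exists (m - (U_(inord (8 + i)) + U_(inord (8 + j))))%MM; rewrite addmC submK.
apply: (VJ _ (adj i j * 'X_[m'])).
  by rewrite em !mpolyXD -mulrBl; apply: idealMr => //; exact: adjJ.
have sadj : supp (fun e => cd e = 0%N) (adj i j).
  have sX a b : (a < 8)%N -> (b < 8)%N -> supp (fun e => cd e = 0%N) (Z a * Z b).
    by move=> a8 b8; rewrite -mpolyXD; apply: suppX; rewrite /cd !mnmDE !mnm1E !inord_eq //; lia.
  have sN d a b : (a < 8)%N -> (b < 8)%N -> supp (fun e => cd e = 0%N) (d%:R * (Z a * Z b)).
    by move=> a8 b8; rewrite -mpolyC_nat mul_mpolyC; apply: suppZ; exact: sX.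
  move: i3 j3 {le em}; rewrite /adj; do 3?[case: i => [|i]//]; do 3?[case: j => [|j]//];
    move=> _ _; apply: suppB;
    lazymatch goal with |- supp _ (_%:R * _) => exact: sN | _ => exact: sX end.
have sr : supp (fun e => (cd e < K)%N) (adj i j * 'X_[m']).
  apply: suppM sadj (suppX (P := fun e => (cd e + 1 < K)%N) _) _; last first.
    by rewrite /cd => a b; rewrite !mnmDE; lia.
  have : (cd m' + 2 = cd m)%N; last by lia.
  rewrite em /cd !mnmDE !mnm1E; move: i3 j3 {le em}.
  by do 3?[case: i => [|i]//]; do 3?[case: j => [|j]//]; rewrite !inord_eq //=; lia.
by apply: (supp_ind sr V0 VD VZ) => a; exact: IH.
Qed.

Definition sdeg (m : 'X_{1..9}) := (m (inord 2) + m (inord 3) + m (inord 4) + m (inord 5))%N.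
(** The exponents of the polynomials that come from forms in the A_k, B_k times (y0 y1)^p,
    with k more variables y than twice the number of variables s. *)
Definition shape (p : bool) (k : nat) (m : 'X_{1..9}) :=
  [&& no_d m, odd (m (inord 0)) == p, odd (m (inord 1)) == p &
      m (inord 0) + m (inord 1) == 2 * sdeg m + k]%N.

Lemma shape_var p k i m : i \in [:: 2; 3; 4; 5]%N -> shape p k (U_(inord i) + m)%MM = shape p k.+2 m.
Proof.
rewrite /shape /no_d /sdeg !inE.
by do 3?[case/orP]; move/eqP->; rewrite !mnmDE !mnm1E !inord_eq //=; congr [&& _, _, _ & _]; lia.
Qed.

Lemma shape_lift m : shape false 0 m -> exists a, exp10 a = m.
Proof.
case/and4P=> /and3P[/eqP m6 /eqP m7 /eqP m8] /eqP o0 /eqP o1 /eqP; rewrite /sdeg.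
set a := m (inord 0); set b := m (inord 1); set s0 := m (inord 2); set s1 := m (inord 3).
set s2 := m (inord 4); set s3 := m (inord 5) => ab.
have [a0 [a1 [a2 [a3 [b0 [b1 [b2 [b3 [ea eb [e0 e1] [e2 e3]]]]]]]]]] :
  exists a0 a1 a2 a3 b0 b1 b2 b3 : nat, [/\ 2 * (a0 + a1 + a2 + a3) = a, 2 * (b0 + b1 + b2 + b3) = b,
   a0 + b0 = s0 /\ a1 + b1 = s1 & a2 + b2 = s2 /\ a3 + b3 = s3]%N.
  have part s r h : (h <= s + r)%N -> exists x h', [/\ x <= s, h' <= r & h = x + h']%N.
    by move=> hsr; exists (minn s h), (h - minn s h)%N; split; lia.
  have [|a0 [h0 [l0 r0 E0]]] := part s0 (s1 + s2 + s3)%N a./2; first by lia.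
  have [|a1 [h1 [l1 r1 E1]]] := part s1 (s2 + s3)%N h0; first by lia.
  have [a2 [a3 [l2 r2 E2]]] := part s2 s3 h1 ltac:(by lia).
  exists a0, a1, a2, a3, (s0 - a0)%N, (s1 - a1)%N, (s2 - a2)%N, (s3 - a3)%N.
  have Ea : (2 * a./2 = a)%N by rewrite mul2n; have := odd_double_half a; rewrite o0.
  clear part; split; last by lia.
  - by rewrite -Ea E0 E1 E2; lia.
  - by lia.
  - by lia.
exists (multinom_of_seq 11 [:: a0; a1; a2; a3; b0; b1; b2; b3]).
apply/mnmP; apply: ord_iota => k; rewrite !inE.
do 8?[case/orP]; move/eqP->; tblE; rewrite !multinom_of_seqE //=; lia.
Qed.

(** The splitting into the invariant and the anti-invariant part. *)
Lemma phi_split f : supp (fun m => low m) f -> exists F0 F1 F2 F3,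
  [/\ phi f = F0 + (X 6 * F1 - X 7 * F2 + X 8 * F3), supp (fun m => shape false 0 m) F0,
   supp (fun m => shape true 2 m) F1, supp (fun m => shape true 2 m) F2 &
   supp (fun m => shape true 2 m) F3].
Proof.
move=> sf; pose V f := exists F0 F1 F2 F3,
  [/\ phi f = F0 + (X 6 * F1 - X 7 * F2 + X 8 * F3), supp (fun m => shape false 0 m) F0,
   supp (fun m => shape true 2 m) F1, supp (fun m => shape true 2 m) F2 &
   supp (fun m => shape true 2 m) F3].
apply: (supp_ind sf (V := V)).
- by exists 0, 0, 0, 0; split; try exact: supp0; rewrite comp_mpoly0; ring.
- move=> a b [F0 [F1 [F2 [F3 [e s0 s1 s2 s3]]]]] [G0 [G1 [G2 [G3 [e' t0 t1 t2 t3]]]]].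
  exists (F0 + G0), (F1 + G1), (F2 + G2), (F3 + G3); split; try exact: suppD.
  by rewrite comp_mpolyD e e'; ring.
- move=> c a [F0 [F1 [F2 [F3 [e s0 s1 s2 s3]]]]].
  exists (c *: F0), (c *: F1), (c *: F2), (c *: F3); split; try exact: suppZ.
  by rewrite comp_mpolyZ e -!mul_mpolyC; ring.
move=> m lm; rewrite /V tbl_mapX.
pose u := exp10 m.
have uE : [/\ u (inord 0) + u (inord 1) = 2 * sdeg u + 2 * (m (inord 8) + m (inord 9) + m (inord 10)),
   odd (u (inord 0)) = odd (m (inord 8) + m (inord 9) + m (inord 10)),
   odd (u (inord 1)) = odd (m (inord 8) + m (inord 9) + m (inord 10)) &
   [/\ u (inord 6) = m (inord 8), u (inord 7) = m (inord 9) & u (inord 8) = m (inord 10)]]%N.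
  rewrite /u /sdeg; have [-> -> [-> -> -> ->] [-> -> ->]] := exp10E m.
  by clear lm; split; [lia | lia | lia | split].
rewrite -/u; move: u uE => u [uab ua ub [u6 u7 u8]].
have red k : k \in [:: 6; 7; 8]%N -> (0 < u (inord k))%N ->
    exists2 u', 'X_[u] = X k * 'X_[u'] & shape true 2 u'.
  move=> hk uk; exists (u - U_(inord k))%MM.
    by rewrite -mpolyXD addmC submK // lep1mP -lt0n.
  have [u' eu] : exists u', u = (U_(inord k) + u')%MM.
    by exists (u - U_(inord k))%MM; rewrite addmC submK // lep1mP -lt0n.
  have -> : (u - U_(inord k))%MM = u' by rewrite eu addmC addmK.
  move: lm uab ua ub u6 u7 u8; rewrite eu /shape /no_d /low /sdeg.
  by move: hk; rewrite !inE; do 2?[case/orP]; move/eqP->; rewrite !mnmDE !mnm1E !inord_eq //=; lia.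
case: (posnP (u (inord 6))) => h6; last first.
  have [u' -> su'] := red 6%N isT h6; exists 0, 'X_[u'], 0, 0.
  by split; try exact: supp0; [ring | exact: suppX].
case: (posnP (u (inord 7))) => h7; last first.
  have [u' -> su'] := red 7%N isT h7; exists 0, 0, (- 'X_[u']), 0.
  by split; try exact: supp0; [ring | apply: suppN; exact: suppX].
case: (posnP (u (inord 8))) => h8; last first.
  have [u' -> su'] := red 8%N isT h8; exists 0, 0, 0, 'X_[u'].
  by split; try exact: supp0; [ring | exact: suppX].
exists 'X_[u], 0, 0, 0; split; try exact: supp0; first by ring.
by apply: suppX; rewrite /shape /no_d h6 h7 h8 ua ub uab -u6 -u7 -u8 h6 h7 h8 /=.
Qed.

Lemma phi_cub u v w : (u, v, w) \in blocks ->
  phi (cub u v w) = X 0 ^+ (2 * ((u == 0) + (v == 0) + (w == 0)))%N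
    * X 1 ^+ (2 * ((u != 0) + (v != 0) + (w != 0)))%N * cayley F.
Proof.
rewrite /cub !inE => h; rewrite !(comp_mpoly_nat, comp_mpolyB, comp_mpolyD, comp_mpolyM).
by case/or4P: h => /eqP[-> -> ->]; rewrite !phi_var10 //= /cayley; ring.
Qed.

Lemma phi_syz l t : (l < 3)%N -> t \in [:: 0; 4]%N ->
  phi (syz l t) = X 0 ^+ (if t == 0%N then 3 else 1)%N * X 1 ^+ (if t == 0%N then 1 else 3)%N *
   [:: 2%:R * X 2 * X 6 - X 5 * X 7 + X 4 * X 8;
       X 5 * X 6 - 2%:R * X 2 * X 7 + X 3 * X 8;
       X 4 * X 6 - X 3 * X 7 + 2%:R * X 2 * X 8]`_l.
Proof.
rewrite /syz !inE => l3 h.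
by case/orP: h => /eqP->; do 3?[case: l l3 => [|l] l3 //=];
  rewrite !(comp_mpoly_nat, comp_mpolyB, comp_mpolyD, comp_mpolyM) !phi_var10 //=; ring.
Qed.

End Assemble10.

(** * The ideal of the threefold of genus 10 *)

Section TorusIdeal.
Variable F : numClosedFieldType.
Local Notation S9 := {mpoly F[9]}.
Local Notation P11 := {mpoly F[11]}.
Local Notation X k := ('X_(inord k) : S9).
Local Notation Z k := ('X_(inord k) : P11).
Local Notation phi f := ((f : P11) \mPo tbl_map F 10 8 bs10_tbl).
Variable J : set P11.
Hypothesis idJ : is_ideal J.
Hypothesis minJ : forall i j, (i < 4)%N -> (j < 4)%N -> J (Z i * Z j.+4 - Z j * Z i.+4).
Hypothesis syzJ : forall l t, (l < 3)%N -> t \in [:: 0; 4]%N -> J (syz F l t).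
Hypothesis adjJ : forall i j, (i < 3)%N -> (j < 3)%N -> J (Z (8 + i)%N * Z (8 + j)%N - adj F i j).
Hypothesis cubJ : forall u v w, (u, v, w) \in blocks -> J (cub F u v w).
Hypothesis torusJ : forall g, J g -> on_torus (phi g).

Let imJ (P : S9) := exists2 g, J g & P = phi g.
Let imJ0 : imJ 0. Proof. by exists 0; [exact: ideal0 | rewrite comp_mpoly0]. Qed.
Let imJD (a b : S9) : imJ a -> imJ b -> imJ (a + b).
Proof.
by move=> [g Jg ->] [h Jh ->]; exists (g + h); [exact: idealD | rewrite comp_mpolyD].
Qed.
Let imJZ (c : F) (a : S9) : imJ a -> imJ (c *: a).
Proof. by move=> [g Jg ->]; exists (c *: g); [exact: idealZ | rewrite comp_mpolyZ]. Qed.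

(** A monomial of this shape contains six variables y that can be distributed over the
    factors of a polarized cubic. *)
Lemma cayley_lift P : supp (fun m => shape false 6 m) P -> imJ (cayley F * P).
Proof.
move=> sP; apply: (supp_ind sP (V := fun P => imJ (cayley F * P))).
- by rewrite mulr0.
- by move=> a b ha hb; rewrite mulrDr; exact: imJD.
- by move=> c a ha; rewrite -scalerAr; exact: imJZ.
move=> m sm.
have [u [v [w [m' [uvw em sm']]]]] : exists u v w m', [/\ (u, v, w) \in blocks,
   m = (U_(inord 0) *+ (2 * ((u == 0) + (v == 0) + (w == 0)))%N +
        U_(inord 1) *+ (2 * ((u != 0) + (v != 0) + (w != 0)))%N + m')%MM & shape false 0 m'].
  have [i [i3 h0 h1]] : exists i, [/\ i <= 3, 2 * i <= m (inord 0) & 2 * (3 - i) <= m (inord 1)]%N.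
    move: sm => /and4P[_ /eqP o0 /eqP o1 /eqP ab].
    by exists (minn 3 (m (inord 0))./2); split; lia.
  have [m' em] : exists m', m = (U_(inord 0) *+ (2 * i)%N + U_(inord 1) *+ (2 * (3 - i))%N + m')%MM.
    exists (m - (U_(inord 0) *+ (2 * i)%N + U_(inord 1) *+ (2 * (3 - i))%N))%MM; rewrite addmC submK //.
    apply/mnm_lepP; apply: ord_ind => k k9; rewrite mnmDE !mulmnE !mnm1E !inord_eq //.
    by case: eqP => [<-|_]; [|case: eqP => [<-|_]] => //=; lia.
  have sm' : shape false 0 m'.
    move: sm; rewrite em /shape /no_d /sdeg !mnmDE !mulmnE !mnm1E !inord_eq //=; lia.
  by case: i i3 {h0 h1} em => [|[|[|[|i]]]] // _ em;
   [exists 4%N, 4%N, 4%N, m' | exists 0%N, 4%N, 4%N, m' | exists 0%N, 0%N, 4%N, m' | exists 0%N, 0%N, 0%N, m'].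
have [a ea] := shape_lift sm'.
exists (cub F u v w * 'X_[a]); first by apply: idealMr => //; exact: cubJ.
by rewrite comp_mpolyM phi_cub // tbl_mapX ea em !mpolyXD -!mpolyXn; ring.
Qed.

Lemma syz_lift l G : (l < 3)%N -> supp (fun m => shape true 4 m) G ->
  imJ ([:: 2%:R * X 2 * X 6 - X 5 * X 7 + X 4 * X 8;
       X 5 * X 6 - 2%:R * X 2 * X 7 + X 3 * X 8;
       X 4 * X 6 - X 3 * X 7 + 2%:R * X 2 * X 8]`_l * G).
Proof.
set q := _`_l => l3 sG; apply: (supp_ind sG (V := fun G => imJ (q * G))).
- by rewrite mulr0.
- by move=> a b ha hb; rewrite mulrDr; exact: imJD.
- by move=> c a ha; rewrite -scalerAr; exact: imJZ.
move=> m sm.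
have [t [m' [ht em sm']]] : exists t m', [/\ t \in [:: 0; 4]%N,
   m = (U_(inord 0) *+ (if t == 0%N then 3 else 1) +
        U_(inord 1) *+ (if t == 0%N then 1 else 3) + m')%MM & shape true 4 m && shape false 0 m'].
  have [t [ht h0 h1]] : exists t, [/\ t \in [:: 0; 4]%N, (if t == 0 then 3 else 1) <= m (inord 0) &
     (if t == 0 then 1 else 3) <= m (inord 1)]%N.
    move: sm => /and4P[_ /eqP o0 /eqP o1 /eqP ab].
    by case: (leqP 3 (m (inord 0))) => h; [exists 0%N | exists 4%N]; split=> //=; lia.
  exists t; set i := (if _ then 3 else _)%N in h0 *; set j := (if _ then 1 else _)%N in h1 *.
  have [m' em] : exists m', m = (U_(inord 0) *+ i + U_(inord 1) *+ j + m')%MM.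
    exists (m - (U_(inord 0) *+ i + U_(inord 1) *+ j))%MM; rewrite addmC submK //.
    apply/mnm_lepP; apply: ord_ind => k k9; rewrite mnmDE !mulmnE !mnm1E !inord_eq //.
    by case: eqP => [<-|_]; [|case: eqP => [<-|_]] => //=; lia.
  exists m'; split=> //; rewrite sm /=.
  move: sm; rewrite em /shape /no_d /sdeg !mnmDE !mulmnE !mnm1E !inord_eq //= /i /j.
  by move: ht; rewrite !inE => /orP[] /eqP-> /=; lia.
case/andP: sm' => _ sm'; have [a ea] := shape_lift sm'.
exists (syz F l t * 'X_[a]); first by apply: idealMr => //; exact: syzJ.
by rewrite comp_mpolyM phi_syz // -/q tbl_mapX ea em !mpolyXD -!mpolyXn; ring.
Qed.

(** The involution (a, c) |-> (1 / a, 1 / c) of the torus separates the invariant part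
    F0 from the anti-invariant part e . F. The first is a multiple of the Cayley cubic,
    the second is a combination of the rows of M e; restricting the cofactors to
    the right shape, both come from J. *)
Theorem torus_ideal f : on_torus (phi f) -> J f.
Proof.
move=> T; have [f' Jff' low'] := reduce_C idJ adjJ f.
have T' : on_torus (phi f').
  move=> y0 y1 l a c h0 h1 hl ha hc.
  have := torusJ Jff' h0 h1 hl ha hc; rewrite comp_mpolyB mevalB T // sub0r => /eqP.
  by rewrite oppr_eq0 => /eqP.
have [F0 [F1 [F2 [F3 [ef s0 s1 s2 s3]]]]] := phi_split low'.
have nd p k (P : S9) : supp (fun m => shape p k m) P -> supp (fun m => no_d m) P.
  by move=> sP m /sP /and4P[].
have flip y0 y1 l a c (P : S9) : supp (fun m => no_d m) P -> a != 0 -> c != 0 ->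
    P.@[torus_point y0 y1 l a^-1 c^-1] = P.@[torus_point y0 y1 l a c].
  move=> sP ha hc; apply: meval_supp => m /sP /and3P[/eqP m6 /eqP m7 /eqP m8].
  apply: ord_iota => k; rewrite !inE /torus_point.
  do 8?[case/orP]; move/eqP-> => //; rewrite inordK //= ?invrK => -[]; by [| field; rewrite ?ha ?hc].
have two : (2%:R : F) != 0 by rewrite pnatr_eq0.
have TT y0 y1 l a c : y0 != 0 -> y1 != 0 -> l != 0 -> a != 0 -> c != 0 ->
    F0.@[torus_point y0 y1 l a c] = 0 /\
    (X 6 * F1 - X 7 * F2 + X 8 * F3).@[torus_point y0 y1 l a c] = 0.
  move=> h0 h1 hl ha hc; have := T' y0 y1 l a c h0 h1 hl ha hc.
  have ha' : a^-1 != 0 by rewrite invr_eq0.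
  have hc' : c^-1 != 0 by rewrite invr_eq0.
  have := T' y0 y1 l _ _ h0 h1 hl ha' hc'.
  rewrite ef !(mevalB, mevalD, mevalN, mevalM) !mevalXU (flip _ _ _ _ _ _ (nd _ _ _ s0)) //.
  rewrite (flip _ _ _ _ _ _ (nd _ _ _ s1)) // (flip _ _ _ _ _ _ (nd _ _ _ s2)) //.
  rewrite (flip _ _ _ _ _ _ (nd _ _ _ s3)) //.
  move: (F0.@[_]) (F1.@[_]) (F2.@[_]) (F3.@[_]) => f0 f1 f2 f3.
  rewrite /torus_point !inordK //= => e1 e2.
  split; apply: (mulfI two); rewrite mulr0.
    by rewrite -[RHS](addr0 0) -{1}e1 -e2; field; rewrite ha hc.
  by rewrite -[RHS](subrr 0) -{1}e2 -e1; field; rewrite ha hc.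
have [P eP] : exists P, F0 = cayley F * P.
  by apply: cayley_dvd => [|y0 y1 l a c *]; [exact: nd s0 | exact: (TT _ _ _ _ _ _ _ _ _ _).1].
have [G1 [G2 [G3 [eG1 eG2 eG3]]]] : exists G1 G2 G3, [/\ F1 = 2%:R * X 2 * G1 + X 5 * G2 + X 4 * G3,
    F2 = X 5 * G1 + 2%:R * X 2 * G2 + X 3 * G3 & F3 = X 4 * G1 + X 3 * G2 + 2%:R * X 2 * G3].
  by apply: cayley_syzygy => [||| y0 y1 l a c *]; [exact: nd s1 | exact: nd s2 | exact: nd s3 | exact: (TT _ _ _ _ _ _ _ _ _ _).2].
have sX i : i \in [:: 2; 3; 4; 5]%N -> supp (fun e => forall m, shape true 2 (e + m)%MM = shape true 4 m) (X i).
  by move=> hi; apply: suppX => m; exact: shape_var.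
have sX2 : supp (fun e => forall m, shape true 2 (e + m)%MM = shape true 4 m) (2%:R * X 2).
  by rewrite -mpolyC_nat mul_mpolyC; apply: suppZ; exact: sX.
have scay : supp (fun e => forall m, shape false 0 (e + m)%MM = shape false 6 m) (cayley F).
  have s3X i j k : i \in [:: 2; 3; 4; 5]%N -> j \in [:: 2; 3; 4; 5]%N -> k \in [:: 2; 3; 4; 5]%N ->
      supp (fun e => forall m, shape false 0 (e + m)%MM = shape false 6 m) (X i * X j * X k).
    by move=> hi hj hk; rewrite -!mpolyXD; apply: suppX => m; rewrite -!addmA !shape_var.
  rewrite /cayley -mpolyC_nat mul_mpolyC !mulrDr !mulrA.
  apply: suppB; last by do 2?[apply: suppD]; apply: s3X.
  by apply: suppD; [apply: suppZ; apply: s3X | apply: s3X].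
have rF0 := restrictM P scay; rewrite -eP (restrict_id s0) in rF0.
have rF1 : F1 = 2%:R * X 2 * restrict (shape true 4) G1 + X 5 * restrict (shape true 4) G2 + X 4 * restrict (shape true 4) G3.
  by rewrite -(restrict_id s1) eG1 !restrictD (restrictM G1 sX2) (restrictM G2 (sX 5%N isT)) (restrictM G3 (sX 4%N isT)).
have rF2 : F2 = X 5 * restrict (shape true 4) G1 + 2%:R * X 2 * restrict (shape true 4) G2 + X 3 * restrict (shape true 4) G3.
  by rewrite -(restrict_id s2) eG2 !restrictD (restrictM G2 sX2) (restrictM G1 (sX 5%N isT)) (restrictM G3 (sX 3%N isT)).
have rF3 : F3 = X 4 * restrict (shape true 4) G1 + X 3 * restrict (shape true 4) G2 + 2%:R * X 2 * restrict (shape true 4) G3.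
  by rewrite -(restrict_id s3) eG3 !restrictD (restrictM G3 sX2) (restrictM G1 (sX 4%N isT)) (restrictM G2 (sX 3%N isT)).
have rs (G : S9) : supp (fun m => shape true 4 m) (restrict (shape true 4) G) by exact: restrictP.
have [g Jg eg] : imJ (phi f').
  rewrite ef rF0 rF1 rF2 rF3.
  have L1 := @syz_lift 0 _ isT (rs G1); have L2 := @syz_lift 1 _ isT (rs G2).
  have L3 := @syz_lift 2 _ isT (rs G3).
  have L0 : imJ (cayley F * restrict (shape false 6) P) by apply: cayley_lift; exact: restrictP.
  have := imJD L0 (imJD L1 (imJD L2 L3)).
  rewrite /=; move: (restrict _ G1) (restrict _ G2) (restrict _ G3) (cayley F * _) => g1 g2 g3 c.
  by congr imJ; ring.
apply: (ideal_congl idJ Jff'); apply: (ideal_congl idJ _ Jg).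
by apply: (minors_kernel idJ) => //; rewrite comp_mpolyB eg subrr.
Qed.

End TorusIdeal.

(** * Tangent spaces *)

Section DirectionalDerivative.
Variables (F : numFieldType) (n : nat).
Implicit Types (f g : {mpoly F[n]}) (z v : 'rV[F]_n).

Definition dirder z v f := \sum_j (f^`M(j)).@[z 0] * v 0 j.

Lemma dirderD z v f g : dirder z v (f + g) = dirder z v f + dirder z v g.
Proof. by rewrite /dirder -big_split; apply: eq_bigr => j _; rewrite mderivD mevalD mulrDl. Qed.
Lemma dirderZ z v c f : dirder z v (c *: f) = c * dirder z v f.
Proof. by rewrite /dirder mulr_sumr; apply: eq_bigr => j _; rewrite mderivZ mevalZ mulrA. Qed.
Lemma dirderN z v f : dirder z v (- f) = - dirder z v f.
Proof. by rewrite -scaleN1r dirderZ mulN1r. Qed.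
Lemma dirderB z v f g : dirder z v (f - g) = dirder z v f - dirder z v g.
Proof. by rewrite dirderD dirderN. Qed.
Lemma dirderM z v f g :
  dirder z v (f * g) = dirder z v f * g.@[z 0] + f.@[z 0] * dirder z v g.
Proof.
rewrite /dirder mulr_suml mulr_sumr -big_split; apply: eq_bigr => j _ /=.
by rewrite mderivM mevalD !mevalM; ring.
Qed.
Lemma dirder_nat z v d : dirder z v d%:R = 0.
Proof.
by rewrite /dirder big1 // => j _; rewrite -mpolyC_nat mderivC meval0 mul0r.
Qed.
Lemma dirder0 z v : dirder z v 0 = 0.
Proof. exact: (dirder_nat z v 0). Qed.
Lemma dirder1 z v : dirder z v 1 = 0.
Proof. exact: (dirder_nat z v 1). Qed.
Lemma dirderX z v i : dirder z v 'X_i = v 0 i.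
Proof.
rewrite /dirder (bigD1 i) //= mderivXU eqxx mevalC mul1r big1 ?addr0 // => j ji.
by rewrite mderivXU eq_sym (negbTE ji) mevalC mul0r.
Qed.

(** The Taylor expansion to order one along a line. *)
Lemma meval_line z v f : exists g : {poly F},
  forall t, f.@[(z + t *: v) 0] = f.@[z 0] + t * dirder z v f + t ^+ 2 * g.[t].
Proof.
pose V f := exists g : {poly F},
  forall t, f.@[(z + t *: v) 0] = f.@[z 0] + t * dirder z v f + t ^+ 2 * g.[t].
have VM f1 f2 : V f1 -> V f2 -> V (f1 * f2).
  move=> [g1 h1] [g2 h2]; exists ((dirder z v f1 * dirder z v f2)%:P
    + (f1.@[z 0])%:P * g2 + (f2.@[z 0])%:P * g1 + (dirder z v f1)%:P * 'X * g2
    + (dirder z v f2)%:P * 'X * g1 + 'X * 'X * g1 * g2) => t.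
  by rewrite dirderM !mevalM h1 h2 !(hornerD, hornerM, hornerC, hornerX); ring.
have V1 : V 1.
  by exists 0 => t; rewrite !meval1 dirder1 horner0; ring.
have VX i : V 'X_i.
  by exists 0 => t; rewrite !mevalXU dirderX horner0 !mxE; ring.
have VXm m : V 'X_[m].
  rewrite mpolyXE_id; apply: (big_ind V) => // i _.
  by elim: (m i) => [|k IH]; [rewrite expr0 | rewrite exprS; exact: VM].
apply: (supp_ind (P := fun=> True) (f := f) (V := V)) => //.
- by exists 0 => t; rewrite !meval0 dirder0 horner0; ring.
- move=> a b [g h] [g' h']; exists (g + g') => t.
  by rewrite dirderD !mevalD h h' hornerD; ring.
move=> c a [g h]; exists (c%:P * g) => t.
by rewrite dirderZ !mevalZ h hornerM hornerC; ring.
Qed.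

(** The exceptional parameter allows for the direction of z itself, for which z + t v
    is 0 at t = -1. *)
Lemma dirder_line0 z v f : (forall t, t != -1 -> f.@[(z + t *: v) 0] = 0) -> dirder z v f = 0.
Proof.
move=> H; have [g hg] := meval_line z v f.
pose p : {poly F} := (f.@[z 0])%:P + (dirder z v f)%:P * 'X + 'X ^+ 2 * g.
have : ('X + 1%:P) * p = 0.
  apply: poly_eq0_vanish => t; rewrite hornerM !(hornerXn, hornerD, hornerM, hornerC, hornerX).
  case: (eqVneq t (-1)) => [->|t1]; first by rewrite addNr mul0r.
  by rewrite (mulrC _ t) -hg H ?mulr0.
have /negbTE X1 : 'X + 1%:P != 0 :> {poly F} by rewrite -size_poly_eq0 size_XaddC.
move/eqP; rewrite mulf_eq0 X1 /= => /eqP/polyP/(_ 1%N).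
by rewrite !coefD coefC coefCM coefX exprS expr1 -mulrA coefXM coefXM /= coef0 mulr1 add0r addr0.
Qed.

End DirectionalDerivative.

Section Jacobian.
Variable F : numFieldType.

(** The gradients at z are orthogonal to the lines of the cone through z, here to a
    space of dimension 5, so they span a space of dimension at most 6 < 10 - 3. *)
Lemma singular_of_lines (W : set 'rV[F]_11) z (U : 'M[F]_(5, 11)) : W z -> row_free U ->
  (forall i t, t != -1 -> W (z + t *: row i U)) -> singular_point W z.
Proof.
move=> Wz fU H; split=> // f fW; apply/negP => fJ.
have : jacobian f z *m U^T = 0.
  apply/matrixP => i j; transitivity (dirder z (row j U) (f i)).
    by rewrite mxE; apply: eq_bigr => k _; rewrite !mxE.
  by rewrite mxE; apply: dirder_line0 => t t1; apply: fW; exact: H.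
move/mulmx0_rank_max; rewrite mxrank_tr (eqP fU).
by move: fJ; rewrite /row_free => /eqP->.
Qed.

(** The four columns of L raise the rank of the matrix of gradients by four at most, and
    they raise it to 11. *)
Lemma smooth_of_tangent (W : set 'rV[F]_11) z (gens : seq {mpoly F[11]})
    (L : 'M[F]_(11, 4)) :
  (forall g, g \in gens -> vanishing_ideal W g) ->
  (forall v : 'rV_11, (forall g, g \in gens -> dirder z v g = 0) -> v *m L = 0 -> v = 0) ->
  ~ singular_point W z.
Proof.
move=> gW H [_]; pose f := tnth (in_tuple gens); pose D := jacobian f z.
have rD : (7 <= \rank D)%N.
  have : row_free (row_mx D^T L).
    rewrite -kermx_eq0; apply/rowV0P => v /sub_kermxP.
    rewrite mul_mx_row => /eqP; rewrite row_mx_eq0 => /andP[/eqP vD /eqP vL].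
    apply: H => // g /(nth_index 0) <-; set i := index g gens.
    case: (ltnP i (size gens)) => [ilt|ige]; last first.
      by rewrite nth_default // dirder0.
    have /matrixP/(_ 0 (Ordinal ilt)) := vD.
    rewrite mxE [RHS]mxE => <-; apply: eq_bigr => j _.
    by rewrite !mxE mulrC /f (tnth_nth 0).
  rewrite /row_free => /eqP rk; have := rank_leq_col L.
  have : (\rank (row_mx D^T L) <= \rank D^T + \rank L)%N.
    by rewrite -mxrank_tr tr_row_mx -(mxrank_tr D^T) -(mxrank_tr L) -addsmxE mxrank_adds_leqif.
  by rewrite rk mxrank_tr; lia.
have [K eK] : exists K : 'M_(7, _), row_free (K *m D).
  have [C eC] : exists C, row_base D = C *m D by apply/submxP; rewrite eq_row_base.
  exists (pid_mx 7 *m C); rewrite -mulmxA -eC /row_free mxrankMfree ?row_base_free //.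
  by rewrite rank_pid_mx.
pose fK i := \sum_j K i j *: f j.
move=> /(_ fK) sing; have /negP[] : ~~ row_free (jacobian fK z).
  apply: sing => i; apply: (ideal_sum (vanishing_ideal_is_ideal W)) => j _.
  by apply: (idealZ (vanishing_ideal_is_ideal W)); apply: gW; rewrite /f mem_tnth.
rewrite (_ : jacobian fK z = K *m D) //; apply/matrixP => i j; rewrite !mxE /fK (linear_sum (mderiv j)) raddf_sum.
by apply: eq_bigr => k _; rewrite /= mderivZ mevalZ !mxE.
Qed.

End Jacobian.

(** * The sextic del Pezzo surface and the Cayley cubic *)

Section DelPezzo.
Variable F : numClosedFieldType.
Local Notation P11 := {mpoly F[11]}.
Local Notation Z k := ('X_(inord k) : P11).
Local Notation phi f := ((f : P11) \mPo tbl_map F 10 8 bs10_tbl).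

(** The equations M e = 0 and e e^T = - adj M, for e = (d1, - d2, d3). *)
Definition sextic_rel (s0 s1 s2 s3 d1 d2 d3 : F) : Prop :=
  [/\ d1 * d1 = s1 * s1 - 4%:R * (s0 * s0), d2 * d2 = s2 * s2 - 4%:R * (s0 * s0) &
      d3 * d3 = s3 * s3 - 4%:R * (s0 * s0)] /\
  [/\ d1 * d2 = s1 * s2 - 2%:R * (s0 * s3), d1 * d3 = 2%:R * (s0 * s2) - s1 * s3 &
      d2 * d3 = s2 * s3 - 2%:R * (s0 * s1)] /\
  [/\ 2%:R * s0 * d1 - s3 * d2 + s2 * d3 = 0, s3 * d1 - 2%:R * s0 * d2 + s1 * d3 = 0 &
      s2 * d1 - s1 * d2 + 2%:R * s0 * d3 = 0].

(** Equations of the parametrized surface hold on its closure. *)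
Lemma del_pezzo6_binomial (x : 'rV[F]_7) (i j k l : nat) : del_pezzo6 x ->
  (forall u0 u1 u2 : F, let m := [:: u1 ^+ 2 * u2; u1 * u2 ^+ 2; u0 ^+ 2 * u2; u0 * u2 ^+ 2;
          u0 ^+ 2 * u1; u0 * u1 ^+ 2; u0 * u1 * u2] in m`_i * m`_j = m`_k * m`_l) ->
  all (fun i => i < 7)%N [:: i; j; k; l] ->
  x 0 (inord i) * x 0 (inord j) = x 0 (inord k) * x 0 (inord l).
Proof.
move=> [_ H] mono /and5P[i7 j7 k7 l7 _].
have /H : vanishing_ideal (proj_image [set: 'rV[F]_3] (fun v : 'rV[F]_3 =>
    let u k := v 0 (inord k) in
    let u0 := u 0%N in let u1 := u 1%N in let u2 := u 2%N in
    row_of_seq 7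
      [:: u1 ^+ 2 * u2; u1 * u2 ^+ 2; u0 ^+ 2 * u2; u0 * u2 ^+ 2;
          u0 ^+ 2 * u1; u0 * u1 ^+ 2; u0 * u1 * u2]))
    ('X_(inord i) * 'X_(inord j) - 'X_(inord k) * 'X_(inord l) : {mpoly F[7]}).
  move=> z [u [_ _ /same_pointP[c _ ->]]].
  rewrite mevalB !mevalM !mevalXU !mxE !inordK //.
  by rewrite mulrACA mono mulrACA subrr.
by rewrite mevalB !mevalM !mevalXU => /eqP; rewrite subr_eq0 => /eqP.
Qed.

Lemma del_pezzo6_rel (x : 'rV[F]_7) : del_pezzo6 x -> let y k := x 0 (inord k) in
  sextic_rel (y 6) (y 0 + y 2) (y 1 + y 4) (y 3 + y 5) (y 0 - y 2) (y 1 - y 4) (y 3 - y 5).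
Proof.
move=> dx /=; have b i j k l := @del_pezzo6_binomial x i j k l dx.
have e02 : x 0 (inord 0) * x 0 (inord 2) = x 0 (inord 6) * x 0 (inord 6) by apply: b => //= *; ring.
have e14 : x 0 (inord 1) * x 0 (inord 4) = x 0 (inord 6) * x 0 (inord 6) by apply: b => //= *; ring.
have e35 : x 0 (inord 3) * x 0 (inord 5) = x 0 (inord 6) * x 0 (inord 6) by apply: b => //= *; ring.
have e03 : x 0 (inord 0) * x 0 (inord 3) = x 0 (inord 6) * x 0 (inord 1) by apply: b => //= *; ring.
have e12 : x 0 (inord 1) * x 0 (inord 2) = x 0 (inord 6) * x 0 (inord 3) by apply: b => //= *; ring.
have e34 : x 0 (inord 3) * x 0 (inord 4) = x 0 (inord 6) * x 0 (inord 2) by apply: b => //= *; ring.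
have e25 : x 0 (inord 2) * x 0 (inord 5) = x 0 (inord 6) * x 0 (inord 4) by apply: b => //= *; ring.
have e40 : x 0 (inord 4) * x 0 (inord 0) = x 0 (inord 6) * x 0 (inord 5) by apply: b => //= *; ring.
have e51 : x 0 (inord 5) * x 0 (inord 1) = x 0 (inord 6) * x 0 (inord 0) by apply: b => //= *; ring.
move: e02 e14 e35 e03 e12 e34 e25 e40 e51.
move: (x 0 (inord 0)) (x 0 (inord 1)) (x 0 (inord 2)) (x 0 (inord 3)) (x 0 (inord 4)) (x 0 (inord 5)) (x 0 (inord 6)).
move=> x0 x1 x2 x3 x4 x5 x6 e02 e14 e35 e03 e12 e34 e25 e40 e51.
split; [|split]; split.
- by rewrite -e02; ring.
- by rewrite -e14; ring.
- by rewrite -e35; ring.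
- transitivity ((x0 + x2) * (x1 + x4) - 2%:R * (x4 * x0 + x1 * x2)); first by ring.
  by rewrite e40 e12; ring.
- transitivity (2%:R * (x0 * x3 + x2 * x5) - (x0 + x2) * (x3 + x5)); first by ring.
  by rewrite e03 e25; ring.
- transitivity ((x1 + x4) * (x3 + x5) - 2%:R * (x5 * x1 + x3 * x4)); first by ring.
  by rewrite e51 e34; ring.
- transitivity (2%:R * (x6 * x0 - x6 * x2 + x3 * x4 - x5 * x1)); first by ring.
  by rewrite e34 e51; ring.
- transitivity (2%:R * (x0 * x3 - x2 * x5 - x6 * x1 + x6 * x4)); first by ring.
  by rewrite e03 e25; ring.
transitivity (2%:R * (x4 * x0 - x1 * x2 + x6 * x3 - x6 * x5)); first by ring.
by rewrite e40 e12; ring.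
Qed.

Lemma sextic_cayley s0 s1 s2 s3 d1 d2 d3 : sextic_rel s0 s1 s2 s3 d1 d2 d3 ->
  4%:R * (s0 * s0 * s0) + s1 * s2 * s3 - s0 * (s1 * s1 + s2 * s2 + s3 * s3) = 0.
Proof.
move=> [[r11 _ _] [[r12 r13 _] [l1 _ _]]].
have two : (2%:R : F) != 0 by rewrite pnatr_eq0.
apply: (mulfI two); rewrite mulr0.
apply: (lincomb (eqD (eqM (2%:R * s0) r11) (eqD (eqM (- s3) r12) (eqD (eqM s2 r13) (eqM (- d1) l1))))).
by ring.
Qed.

(** Square roots of scalars being available, a point of W is always given by values of
    y0, y1 and of the seven coordinates of the sextic surface. *)
Definition bs10_coords (y0 y1 s0 s1 s2 s3 d1 d2 d3 : F) : seq F :=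
  [:: y0 ^+ 2 * s0; y0 ^+ 2 * s1; y0 ^+ 2 * s2; y0 ^+ 2 * s3;
      y1 ^+ 2 * s0; y1 ^+ 2 * s1; y1 ^+ 2 * s2; y1 ^+ 2 * s3;
      y0 * y1 * d1; y0 * y1 * d2; y0 * y1 * d3].

Lemma BS10_coords z : BS10 F z -> exists y0 y1 s0 s1 s2 s3 d1 d2 d3,
  [/\ sextic_rel s0 s1 s2 s3 d1 d2 d3, z = row_of_seq 11 (bs10_coords y0 y1 s0 s1 s2 s3 d1 d2 d3) & z != 0].
Proof.
move=> [[y x] [[/= y0 dx] nz /same_pointP[c c0 ez]]].
pose g := sqrtC c; have g2 : g ^+ 2 = c by rewrite sqrtCK.
pose xx k := x 0 (inord k).
exists (g * y 0 (inord 0)), (g * y 0 (inord 1)), (xx 6%N), (xx 0%N + xx 2%N), (xx 1%N + xx 4%N),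
  (xx 3%N + xx 5%N), (xx 0%N - xx 2%N), (xx 1%N - xx 4%N), (xx 3%N - xx 5%N).
split; first exact: del_pezzo6_rel.
- rewrite ez; apply/rowP; apply: ord_iota => k hk; rewrite mxE !row_of_seqE; try by move: hk; rewrite mem_iota.
  rewrite -g2; move: hk; rewrite !inE /bs10_coords /xx /=.
  by do 10?[case/orP]; move/eqP-> => /=; ring.
by apply: contraNneq nz => z0; rewrite -(scale1r (BS10_map _)) -(mulVf c0) -scalerA -ez z0 scaler0.
Qed.

Lemma sextic_in_BS10 y0 y1 (x : 'rV[F]_7) (z : 'rV[F]_11) : del_pezzo6 x -> z != 0 ->
  let y k := x 0 (inord k) in
  z = row_of_seq 11 (bs10_coords y0 y1 (y 6) (y 0 + y 2) (y 1 + y 4) (y 3 + y 5)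
    (y 0 - y 2) (y 1 - y 4) (y 3 - y 5)) -> BS10 F z.
Proof.
move=> dx z0 /= ez; pose y := row_of_seq 2 [:: y0; y1].
have yE k : (k < 2)%N -> y 0 (inord k) = [:: y0; y1]`_k by move=> k2; rewrite row_of_seqE.
have e : z = BS10_map (y, x).
  by rewrite ez /BS10_map /= !yE.
exists (y, x); split; [split=> //= | by rewrite -e | by rewrite -e same_point_refl].
apply: contraNneq z0 => y00; rewrite ez; apply/eqP/rowP; apply: ord_iota => k.
have e0 : y0 = 0 by rewrite -[y0]/([:: y0; y1]`_0) -yE // y00 mxE.
have e1 : y1 = 0 by rewrite -[y1]/([:: y0; y1]`_1) -yE // y00 mxE.
rewrite !inE [RHS]mxE /bs10_coords e0 e1.
by do 10?[case/orP]; move/eqP->; rewrite row_of_seqE //= ?expr0n /= !mul0r.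
Qed.

Lemma del_pezzo6_param (u0 u1 u2 c : F) (x : 'rV[F]_7) : c != 0 ->
  row_of_seq 7 [:: u1 ^+ 2 * u2; u1 * u2 ^+ 2; u0 ^+ 2 * u2; u0 * u2 ^+ 2;
          u0 ^+ 2 * u1; u0 * u1 ^+ 2; u0 * u1 * u2] != 0 ->
  x = c *: row_of_seq 7 [:: u1 ^+ 2 * u2; u1 * u2 ^+ 2; u0 ^+ 2 * u2; u0 * u2 ^+ 2;
          u0 ^+ 2 * u1; u0 * u1 ^+ 2; u0 * u1 * u2] -> del_pezzo6 x.
Proof.
move=> c0 nz ->; split; first by rewrite scaler_eq0 negb_or c0.
move=> f; apply; exists (row_of_seq 3 [:: u0; u1; u2]).
have uE k : (k < 3)%N -> row_of_seq 3 [:: u0; u1; u2] 0 (inord k) = [:: u0; u1; u2]`_k.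
  by move=> k3; rewrite row_of_seqE.
by split=> //=; rewrite !uE //=; apply/same_pointP; exists c.
Qed.

(** * Quadrics and cubics through the threefold of genus 10 *)

Local Notation I10 := (vanishing_ideal (BS10 F)).

Definition bs10_minor (i j : nat) : P11 := Z i * Z j.+4 - Z j * Z i.+4.

Lemma minor_mem i j : (i < 4)%N -> (j < 4)%N -> I10 (bs10_minor i j).
Proof.
move=> i4 j4 z /BS10_coords[y0 [y1 [s0 [s1 [s2 [s3 [d1 [d2 [d3 [_ -> _]]]]]]]]]].
rewrite mevalB !mevalM !mevalXU !row_of_seqE; try lia.
have nE k : (k < 4)%N -> (bs10_coords y0 y1 s0 s1 s2 s3 d1 d2 d3)`_k = y0 ^+ 2 * [:: s0; s1; s2; s3]`_k /\
   (bs10_coords y0 y1 s0 s1 s2 s3 d1 d2 d3)`_k.+4 = y1 ^+ 2 * [:: s0; s1; s2; s3]`_k.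
  by case: k => [|[|[|[|k]]]].
have [-> ->] := nE i i4; have [-> ->] := nE j j4; ring.
Qed.

Lemma syz_mem l t : (l < 3)%N -> t \in [:: 0; 4]%N -> I10 (syz F l t).
Proof.
move=> l3 ht z /BS10_coords[y0 [y1 [s0 [s1 [s2 [s3 [d1 [d2 [d3 [[_ [_ [l1 l2 l4]]] -> _]]]]]]]]]].
have two v : (2%:R : P11).@[v] = 2%:R := meval_nat v 2.
move: l3 ht; rewrite !inE => l3 ht.
case: l l3 => [|[|[|l]]] // _; case/orP: ht => /eqP->;
  rewrite /syz /= !(two, mevalB, mevalD, mevalN, mevalM) !mevalXU !row_of_seqE //=.
- by apply: (lincomb (eqM (y0 ^+ 3 * y1) l1)); ring.
- by apply: (lincomb (eqM (y1 ^+ 3 * y0) l1)); ring.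
- by apply: (lincomb (eqM (y0 ^+ 3 * y1) l2)); ring.
- by apply: (lincomb (eqM (y1 ^+ 3 * y0) l2)); ring.
- by apply: (lincomb (eqM (y0 ^+ 3 * y1) l4)); ring.
by apply: (lincomb (eqM (y1 ^+ 3 * y0) l4)); ring.
Qed.

Lemma adj_mem i j : (i < 3)%N -> (j < 3)%N -> I10 (Z (8 + i)%N * Z (8 + j)%N - adj F i j).
Proof.
move=> i3 j3 z /BS10_coords[y0 [y1 [s0 [s1 [s2 [s3 [d1 [d2 [d3 [rel -> _]]]]]]]]]].
case: rel => [[r11 r22 r33] [[r12 r13 r23] _]].
have nat v k : (k%:R : P11).@[v] = k%:R := meval_nat v k.
move: i3 j3; case: i => [|[|[|i]]] //; case: j => [|[|[|j]]] // _ _;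
  rewrite /adj /= !(nat, mevalB, mevalD, mevalN, mevalM) !mevalXU !row_of_seqE //=;
  first [ring: r11 | ring: r22 | ring: r33 | ring: r12 | ring: r13 | ring: r23].
Qed.

Lemma cub_mem u v w : (u, v, w) \in blocks -> I10 (cub F u v w).
Proof.
move=> h z /BS10_coords[y0 [y1 [s0 [s1 [s2 [s3 [d1 [d2 [d3 [rel -> _]]]]]]]]]].
have D0 := sextic_cayley rel; have nat w' k : (k%:R : P11).@[w'] = k%:R := meval_nat w' k.
rewrite /cub !(nat, mevalB, mevalD, mevalN, mevalM).
move: h; rewrite !inE; do 3?[case/orP]; move/eqP=> [-> -> ->]; rewrite !mevalXU !row_of_seqE //=.
- by rewrite -[RHS](mulr0 (y0 ^+ 6)) -D0; ring.
- by rewrite -[RHS](mulr0 (y0 ^+ 4 * y1 ^+ 2)) -D0; ring.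
- by rewrite -[RHS](mulr0 (y0 ^+ 2 * y1 ^+ 4)) -D0; ring.
by rewrite -[RHS](mulr0 (y1 ^+ 6)) -D0; ring.
Qed.

Lemma ideal_on_torus f : I10 f -> on_torus (phi f).
Proof.
move=> If y0 y1 l a c h0 h1 hl ha hc; rewrite comp_mpoly_meval.
pose x := row_of_seq 7 [:: l * a; l * (a * c); l * a^-1; l * c; l * (a * c)^-1; l * c^-1; l].
have dx : del_pezzo6 x.
  apply: (@del_pezzo6_param 1 a (a * c) (l / (a * (a * c)))).
  - by rewrite mulf_neq0 // invr_eq0 !mulf_neq0.
  - apply/eqP => /rowP/(_ (inord 6)); rewrite row_of_seqE // mxE /= mul1r => /eqP.
    by rewrite !mulf_eq0 (negbTE ha) (negbTE hc).
  apply/rowP; apply: ord_iota => k; rewrite /x !inE [RHS]mxE.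
  by do 6?[case/orP]; move/eqP->; rewrite !row_of_seqE //=; field; rewrite ?ha ?hc.
pose z : 'rV[F]_11 := \row_j (tnth (tbl_map F 10 8 bs10_tbl) j).@[torus_point y0 y1 l a c].
have -> : f.@[fun i => (tnth (tbl_map F 10 8 bs10_tbl) i).@[torus_point y0 y1 l a c]] = f.@[z 0].
  by apply: meval_eq => j; rewrite mxE.
have zE k : (k < 11)%N -> z 0 (inord k) = \prod_(j <- iota 0 9)
      torus_point y0 y1 l a c (inord j) ^+ nth 0%N (nth [::] bs10_tbl k) j.
  move=> k11; rewrite mxE (tnth_nth 0) -comp_mpolyXU tbl_mapU // rmorph_prod.
  by apply: eq_bigr => j _; rewrite rmorphXn /= mevalXU.
apply: If; apply: (@sextic_in_BS10 y0 y1 x) => //.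
  apply/eqP => /rowP/(_ (inord 0)); rewrite zE // mxE !big_cons big_nil /torus_point !inordK //=.
  by move/eqP; rewrite !expr0 !mulr1 !mul1r expr1 mulf_eq0 sqrf_eq0 (negbTE h0) (negbTE hl).
have xE k : (k < 7)%N -> x 0 (inord k) = [:: l * a; l * (a * c); l * a^-1; l * c; l * (a * c)^-1; l * c^-1; l]`_k.
  by move=> k7; rewrite row_of_seqE.
apply/rowP; apply: ord_iota => k hk.
have k11 : (k < 11)%N by move: hk; rewrite mem_iota.
rewrite zE // row_of_seqE // !xE // !big_cons big_nil /torus_point !inordK //=.
move: hk; rewrite !inE /bs10_coords.
by do 10?[case/orP]; move/eqP->; rewrite /=; ring.
Qed.

Lemma nat_dhomog n d : (d%:R : {mpoly F[n]}) \is 0.-homog.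
Proof. by rewrite -mpolyC_nat -[_%:MP]mulr1 mul_mpolyC; apply: rpredZ; exact: dhomog1. Qed.

Lemma X1_dhomog n i : ('X_i : {mpoly F[n]}) \is 1.-homog.
Proof. by rewrite dhomogX /= mdeg1. Qed.

Lemma X2_dhomog n i j : ('X_i * 'X_j : {mpoly F[n]}) \is 2.-homog.
Proof. exact: dhomogM (X1_dhomog i) (X1_dhomog j). Qed.

Lemma X3_dhomog n i j k : ('X_i * 'X_j * 'X_k : {mpoly F[n]}) \is 3.-homog.
Proof. exact: dhomogM (X2_dhomog i j) (X1_dhomog k). Qed.

Theorem BS10_generated : generated_by_quadrics_and_cubics I10.
Proof.
apply: generated_by_quadrics_and_cubicsI; first exact: vanishing_ideal_is_ideal.
set G := [set g | _]; move=> f If.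
have idG := ideal_gen_is_ideal G.
have sub2 g : I10 g -> g \is 2.-homog -> ideal_gen G g.
  by move=> Ig hg; apply: sub_ideal_gen; split=> //; left.
have sub3 g : I10 g -> g \is 3.-homog -> ideal_gen G g.
  by move=> Ig hg; apply: sub_ideal_gen; split=> //; right.
have n2 d i j : (d%:R * ('X_i * 'X_j) : P11) \is 2.-homog.
  exact: dhomogM (nat_dhomog _ d) (X2_dhomog i j).
have n2' d i j : (d%:R * 'X_i * 'X_j : P11) \is 2.-homog by rewrite -mulrA; exact: n2.
apply: (torus_ideal idG) => //.
- move=> i j i4 j4; apply: sub2; first exact: minor_mem.
  by apply: rpredB; exact: X2_dhomog.
- move=> l t l3 ht; apply: sub2; first exact: syz_mem.
  case: l l3 => [|[|[|l]]] // _; rewrite /syz /=.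
  + by apply: rpredD; [apply: rpredB; [exact: n2' | exact: X2_dhomog] | exact: X2_dhomog].
  + by apply: rpredD; [apply: rpredB; [exact: X2_dhomog | exact: n2'] | exact: X2_dhomog].
  by apply: rpredD; [apply: rpredB; exact: X2_dhomog | exact: n2'].
- move=> i j i3 j3; apply: sub2; first exact: adj_mem.
  apply: rpredB; first exact: X2_dhomog.
  case: i i3 => [|[|[|i]]] // _; case: j j3 => [|[|[|j]]] // _; rewrite /adj /=; apply: rpredB;
  lazymatch goal with |- context [_%:R * _] => exact: n2 | _ => exact: X2_dhomog end.
- move=> u v w uvw; apply: sub3; first exact: cub_mem.
  rewrite /cub; apply: rpredB; first apply: rpredD.
  + exact: dhomogM (nat_dhomog _ 4) (X3_dhomog _ _ _).
  + exact: X3_dhomog.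
  by rewrite !mulrDr !mulrA; apply: rpredD; first apply: rpredD; exact: X3_dhomog.
- move=> g Gg; apply: ideal_on_torus; move: g Gg.
  by apply: ideal_gen_min => [|g []]; first exact: vanishing_ideal_is_ideal.
exact: ideal_on_torus.
Qed.

End DelPezzo.

(** * Tangent vectors of the threefold of genus 10 *)

Section TangentSpaces.
Variable F : numClosedFieldType.
Implicit Types s d p r : F.

Let two : (2%:R : F) != 0. Proof. by rewrite pnatr_eq0. Qed.

(** The gradient of the Cayley cubic at s, up to a factor: the differential of det M is
    the trace of adj M = - e e^T times the differential of M. *)
Definition cayley_grad (d1 d2 d3 : F) : seq F :=
  [:: d1 * d1 + d2 * d2 + d3 * d3; - (d2 * d3); d1 * d3; - (d1 * d2)].

Lemma cayley_grad_neq0 d1 d2 d3 : [|| d1 != 0, d2 != 0 | d3 != 0] ->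
  exists2 j, (j < 4)%N & (cayley_grad d1 d2 d3)`_j != 0.
Proof.
move=> h; case: (eqVneq (d2 * d3) 0) => e1; last by exists 1%N; rewrite //= oppr_eq0.
case: (eqVneq (d1 * d3) 0) => e2; last by exists 2%N.
case: (eqVneq (d1 * d2) 0) => e3; last by exists 3%N; rewrite //= oppr_eq0.
exists 0%N => //=; move/eqP: e1; move/eqP: e2; move/eqP: e3; rewrite !mulf_eq0.
case: (eqVneq d1 0) h => [->|h1]; case: (eqVneq d2 0) => [->|h2]; case: (eqVneq d3 0) => [->|h3] //= _ _ _ _;
 by rewrite ?mulr0 ?add0r ?addr0 mulf_neq0.
Qed.

Lemma hyperplane_coord (c : seq F) (p : nat -> F) j : (j < 4)%N -> c`_j != 0 ->
  (forall k, (k < 4)%N -> k != j -> p k = 0) ->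
  c`_0 * p 0%N + c`_1 * p 1%N + c`_2 * p 2%N + c`_3 * p 3%N = 0 ->
  forall k, (k < 4)%N -> p k = 0.
Proof.
move=> j4 cj H e k k4; case: (eqVneq k j) => [->|kj]; last exact: H.
suff : c`_j * p j = 0 by move/eqP; rewrite mulf_eq0 (negbTE cj) => /eqP.
move: j4 H e; case: j {cj} => [|[|[|[|j]]]] // _ H e; rewrite -[RHS]e.
- by rewrite (H 1%N) // (H 2%N) // (H 3%N) //; ring.
- by rewrite (H 0%N) // (H 2%N) // (H 3%N) //; ring.
- by rewrite (H 0%N) // (H 1%N) // (H 3%N) //; ring.
by rewrite (H 0%N) // (H 1%N) // (H 2%N) //; ring.
Qed.

(** Where d <> 0 the adjugate of M is nonzero, so the kernel of M is the line spanned by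
    e = (d1, - d2, d3). *)
Lemma cayley_kernel s0 s1 s2 s3 d1 d2 d3 r1 r2 r3 (k : nat) :
  sextic_rel s0 s1 s2 s3 d1 d2 d3 ->
  2%:R * s0 * r1 - s3 * r2 + s2 * r3 = 0 -> s3 * r1 - 2%:R * s0 * r2 + s1 * r3 = 0 ->
  s2 * r1 - s1 * r2 + 2%:R * s0 * r3 = 0 ->
  (k < 3)%N -> [:: d1; d2; d3]`_k != 0 -> [:: r1; r2; r3]`_k = 0 -> [/\ r1 = 0, r2 = 0 & r3 = 0].
Proof.
move=> [[r11 r22 r33] _] e1 e2 e3.
have cancel d x : d != 0 -> d * d * x = 0 -> x = 0.
  by move=> d0 /eqP; rewrite !mulf_eq0 (negbTE d0) => /eqP.
case: k => [|[|[|k]]] //= _ dk rk; rewrite rk in e1 e2 e3 *; split=> //; apply: (cancel _ _ dk).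
- by apply: (lincomb (eqD (eqM r2 r11) (eqD (eqM (2%:R * s0) e2) (eqM (- s1) e3)))); ring.
- by apply: (lincomb (eqD (eqM r3 r11) (eqD (eqM s1 e2) (eqM (- (2%:R * s0)) e3)))); ring.
- by apply: (lincomb (eqD (eqM r1 r22) (eqD (eqM s2 e3) (eqM (- (2%:R * s0)) e1)))); ring.
- by apply: (lincomb (eqD (eqM r3 r22) (eqD (eqM s2 e1) (eqM (- (2%:R * s0)) e3)))); ring.
- by apply: (lincomb (eqD (eqM r1 r33) (eqD (eqM s3 e2) (eqM (- (2%:R * s0)) e1)))); ring.
by apply: (lincomb (eqD (eqM r2 r33) (eqD (eqM (2%:R * s0) e2) (eqM (- s3) e1)))); ring.
Qed.

(** Tangent vectors (p, r) of the cone over the sextic surface, at a point with d <> 0: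
    pairing the derivative of M e = 0 with e shows that p is tangent to the Cayley
    cubic, so three of its coordinates determine p; then r is in the kernel of M, and
    the derivative of the squares of the d_i makes one of its coordinates zero. *)
Lemma sextic_tangent s0 s1 s2 s3 d1 d2 d3 (p : nat -> F) r1 r2 r3 j :
  sextic_rel s0 s1 s2 s3 d1 d2 d3 -> [|| d1 != 0, d2 != 0 | d3 != 0] ->
  (j < 4)%N -> (cayley_grad d1 d2 d3)`_j != 0 ->
  [/\ 2%:R * p 0%N * d1 - p 3%N * d2 + p 2%N * d3 + (2%:R * s0 * r1 - s3 * r2 + s2 * r3) = 0,
      p 3%N * d1 - 2%:R * p 0%N * d2 + p 1%N * d3 + (s3 * r1 - 2%:R * s0 * r2 + s1 * r3) = 0 &
      p 2%N * d1 - p 1%N * d2 + 2%:R * p 0%N * d3 + (s2 * r1 - s1 * r2 + 2%:R * s0 * r3) = 0] ->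
  [/\ 2%:R * (d1 * r1) = 2%:R * (p 1%N * s1) - 8%:R * (p 0%N * s0),
      2%:R * (d2 * r2) = 2%:R * (p 2%N * s2) - 8%:R * (p 0%N * s0) &
      2%:R * (d3 * r3) = 2%:R * (p 3%N * s3) - 8%:R * (p 0%N * s0)] ->
  (forall k, (k < 4)%N -> k != j -> p k = 0) ->
  (forall k, (k < 4)%N -> p k = 0) /\ [/\ r1 = 0, r2 = 0 & r3 = 0].
Proof.
move=> rel dn j4 cj [e1 e2 e3] [f1 f2 f3] H.
have p0 : forall k, (k < 4)%N -> p k = 0.
  apply: (hyperplane_coord j4 cj H); rewrite /=; apply: (mulfI two); rewrite mulr0.
  case: rel => [_ [_ [l1 l2 l3]]].
  by apply: (lincomb (eqD (eqD (eqM d1 e1) (eqD (eqM (- d2) e2) (eqM d3 e3)))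
    (eqD (eqM (- r1) l1) (eqD (eqM r2 l2) (eqM (- r3) l3))))); ring.
split=> //.
have [p00 p10 p20 p30] := And4 (p0 0%N isT) (p0 1%N isT) (p0 2%N isT) (p0 3%N isT).
rewrite p00 p10 p20 p30 !(mul0r, mulr0, subr0, addr0, add0r, oppr0) in e1 e2 e3 f1 f2 f3.
have nz d r : d != 0 -> 2%:R * (d * r) = 0 -> r = 0.
  by move=> d0 /eqP; rewrite !mulf_eq0 (negbTE two) (negbTE d0) => /eqP.
case/or3P: dn => dn.
- exact: (@cayley_kernel _ _ _ _ _ _ _ _ _ _ 0 rel e1 e2 e3 isT dn (nz _ _ dn f1)).
- exact: (@cayley_kernel _ _ _ _ _ _ _ _ _ _ 1 rel e1 e2 e3 isT dn (nz _ _ dn f2)).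
exact: (@cayley_kernel _ _ _ _ _ _ _ _ _ _ 2 rel e1 e2 e3 isT dn (nz _ _ dn f3)).
Qed.

End TangentSpaces.

Section SmoothPoints.
Variable F : numClosedFieldType.
Local Notation P11 := {mpoly F[11]}.
Local Notation Z k := ('X_(inord k) : P11).
Local Notation W := (BS10 F).

Let two : (2%:R : F) != 0. Proof. by rewrite pnatr_eq0. Qed.

Definition minor_gens : seq P11 := [seq bs10_minor F i j | i <- iota 0 4, j <- iota 0 4].
Definition syz_gens : seq P11 := [seq syz F l 0 | l <- iota 0 3] ++ [seq syz F l 4 | l <- iota 0 3].
Definition adj_sq (i : nat) : P11 := Z (8 + i)%N * Z (8 + i)%N - adj F i i.
Definition adj_gens : seq P11 := [seq adj_sq i | i <- iota 0 3].
Definition cub_gens : seq P11 := [seq cub F t t t | t <- [:: 0; 4]%N].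
Definition bs10_gens : seq P11 := minor_gens ++ syz_gens ++ adj_gens ++ cub_gens.

Lemma bs10_gensE g : (g \in bs10_gens) =
  [|| g \in minor_gens, g \in syz_gens, g \in adj_gens | g \in cub_gens].
Proof. by rewrite /bs10_gens (mem_cat _ minor_gens) (mem_cat _ syz_gens) (mem_cat _ adj_gens). Qed.

Lemma bs10_gens_mem g : g \in bs10_gens -> vanishing_ideal W g.
Proof.
rewrite bs10_gensE => /or4P[].
- by rewrite /minor_gens => /allpairsP[[i j] [i4 j4 ->]]; apply: minor_mem; [move: i4 | move: j4]; rewrite mem_iota.
- by rewrite /syz_gens mem_cat => /orP[] /mapP[l]; rewrite mem_iota => l3 ->; exact: syz_mem.
- by rewrite /adj_gens => /mapP[k]; rewrite mem_iota => k3 ->; exact: adj_mem.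
by rewrite /cub_gens => /mapP[t ht ->]; apply: cub_mem; move: ht; rewrite !inE => /orP[] /eqP->.
Qed.

Lemma smooth_of_functionals z (Ls : seq ('I_11 -> F)) :
  (forall v : 'rV_11, (forall g, g \in bs10_gens -> dirder z v g = 0) ->
     (forall l, l \in iota 0 4 -> \sum_i v 0 i * nth (fun=> 0) Ls l i = 0) -> v = 0) ->
  ~ singular_point W z.
Proof.
move=> H; apply: (smooth_of_tangent (gens := bs10_gens)
  (L := \matrix_(i, k) nth (fun=> 0) Ls k i)); first exact: bs10_gens_mem.
move=> v vg /rowP vL; apply: H => // l; rewrite mem_iota => l4.
have e := vL (Ordinal (l4 : (l < 4)%N)); rewrite mxE [RHS]mxE in e; rewrite -[RHS]e.
by apply: eq_bigr => i _; rewrite mxE.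
Qed.

Definition coord (j : nat) : 'I_11 -> F := fun i => (i == inord j)%:R.

Lemma sum_coord (v : 'rV[F]_11) j : \sum_i v 0 i * coord j i = v 0 (inord j).
Proof.
rewrite (bigD1 (inord j)) //= /coord eqxx mulr1 big1 ?addr0 // => i /negbTE->.
by rewrite mulr0.
Qed.

(** In the lemmas below, v is a vector killed by the gradients at z of the equations. *)
Section Tangent.
Variables (y0 y1 s0 s1 s2 s3 d1 d2 d3 : F).
Hypothesis rel : sextic_rel s0 s1 s2 s3 d1 d2 d3.
Let z := row_of_seq 11 (bs10_coords y0 y1 s0 s1 s2 s3 d1 d2 d3).
Let s k := [:: s0; s1; s2; s3]`_k.
Variable v : 'rV[F]_11.
Hypothesis vg : forall g, g \in bs10_gens -> dirder z v g = 0.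
Let p k := v 0 (inord k).

Let zE k : (k < 11)%N -> z 0 (inord k) = (bs10_coords y0 y1 s0 s1 s2 s3 d1 d2 d3)`_k.
Proof. by move=> k11; rewrite row_of_seqE. Qed.

Let zs k : (k < 4)%N -> z 0 (inord k) = y0 ^+ 2 * s k /\ z 0 (inord k.+4) = y1 ^+ 2 * s k.
Proof. by case: k => [|[|[|[|k]]]] // _; rewrite !zE. Qed.

Lemma tangent_minor i j : (i < 4)%N -> (j < 4)%N ->
  s i * (y0 ^+ 2 * p j.+4 - y1 ^+ 2 * p j) = s j * (y0 ^+ 2 * p i.+4 - y1 ^+ 2 * p i).
Proof.
move=> i4 j4; have : dirder z v (bs10_minor F i j) = 0.
  by apply: vg; rewrite bs10_gensE; apply/or4P/Or41; apply/allpairsP; exists (i, j); rewrite !mem_iota.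
rewrite dirderB !dirderM !dirderX !mevalXU; have [-> ->] := zs i4; have [-> ->] := zs j4.
move=> e; apply/eqP; rewrite -subr_eq0; apply/eqP; rewrite -[RHS]e /p; ring.
Qed.

Let syzg l t : (l < 3)%N -> t \in [:: 0; 4]%N -> dirder z v (syz F l t) = 0.
Proof.
move=> l3 ht; apply: vg; rewrite bs10_gensE; apply/or4P/Or42.
have : (t == 0%N) || (t == 4%N) by move: ht; rewrite !inE.
rewrite /syz_gens mem_cat => /orP[] /eqP->; apply/orP.
  by left; apply/mapP; exists l; rewrite // mem_iota.
by right; apply/mapP; exists l; rewrite // mem_iota.
Qed.

Lemma tangent_syz t : t \in [:: 0; 4]%N -> let y := if t == 0%N then y0 else y1 in
  let r1 := p 8 in let r2 := p 9 in let r3 := p 10 in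
  [/\ y0 * y1 * (2%:R * p t * d1 - p t.+3 * d2 + p t.+2 * d3) + y ^+ 2 * (2%:R * s0 * r1 - s3 * r2 + s2 * r3) = 0,
      y0 * y1 * (p t.+3 * d1 - 2%:R * p t * d2 + p t.+1 * d3) + y ^+ 2 * (s3 * r1 - 2%:R * s0 * r2 + s1 * r3) = 0 &
      y0 * y1 * (p t.+2 * d1 - p t.+1 * d2 + 2%:R * p t * d3) + y ^+ 2 * (s2 * r1 - s1 * r2 + 2%:R * s0 * r3) = 0].
Proof.
move=> ht /=; have nat (w : 'I_11 -> F) k : (k%:R : P11).@[w] = k%:R := meval_nat w k.
have := syzg (isT : 0 < 3)%N ht; have := syzg (isT : 1 < 3)%N ht; have := syzg (isT : 2 < 3)%N ht.
rewrite /syz /= !(dirder_nat, dirderX, dirderB, dirderN, dirderM, dirderD) !(nat, mevalM) !mevalXU.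
move: ht; rewrite !inE => /orP[] /eqP-> /=; rewrite !zE //= => e1 e2 e3;
 by split; [rewrite -e3 | rewrite -e2 | rewrite -e1]; rewrite /p; ring.
Qed.

Lemma tangent_adj :
  [/\ 2%:R * (y0 * y1 * d1 * p 8) = y1 ^+ 2 * (p 1 * s1 - 4%:R * (p 0 * s0)) + y0 ^+ 2 * (s1 * p 5 - 4%:R * (s0 * p 4)),
      2%:R * (y0 * y1 * d2 * p 9) = y1 ^+ 2 * (p 2 * s2 - 4%:R * (p 0 * s0)) + y0 ^+ 2 * (s2 * p 6 - 4%:R * (s0 * p 4)) &
      2%:R * (y0 * y1 * d3 * p 10) = y1 ^+ 2 * (p 3 * s3 - 4%:R * (p 0 * s0)) + y0 ^+ 2 * (s3 * p 7 - 4%:R * (s0 * p 4))].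
Proof.
have nat (w : 'I_11 -> F) k : (k%:R : P11).@[w] = k%:R := meval_nat w k.
have mem i : (i < 3)%N -> dirder z v (adj_sq i) = 0.
  by move=> i3; apply: vg; rewrite bs10_gensE; apply/or4P/Or43; apply/mapP; exists i; rewrite // mem_iota.
have := mem 0%N isT; have := mem 1%N isT; have := mem 2%N isT.
rewrite /adj_sq /adj /= !(dirder_nat, dirderX, dirderB, dirderN, dirderM, dirderD) !(nat, mevalM) !mevalXU !zE //=.
by move=> e1 e2 e3; split; apply/eqP; rewrite -subr_eq0; apply/eqP;
  [rewrite -[RHS]e3 | rewrite -[RHS]e2 | rewrite -[RHS]e1]; rewrite /p; ring.
Qed.

Lemma tangent_cub t : t \in [:: 0; 4]%N -> let y := if t == 0%N then y0 else y1 in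
  let c := cayley_grad d1 d2 d3 in
  y ^+ 4 * (c`_0 * p t + c`_1 * p t.+1 + c`_2 * p t.+2 + c`_3 * p t.+3) = 0.
Proof.
move=> ht /=; have nat (w : 'I_11 -> F) k : (k%:R : P11).@[w] = k%:R := meval_nat w k.
have : dirder z v (cub F t t t) = 0.
  by apply: vg; rewrite bs10_gensE; apply/or4P/Or44; apply/mapP; exists t.
case: rel => [[r11 r22 r33] [[r12 r13 r23] _]].
rewrite /cub !(dirder_nat, dirderX, dirderB, dirderN, dirderM, dirderD) !(nat, mevalB, mevalD, mevalM) !mevalXU.
move: ht; rewrite !inE => /orP[] /eqP-> /=; rewrite !zE //= => e;
 by rewrite r11 r22 r33 r12 r13 r23 -[RHS]oppr0 -[in RHS]e /p; ring.
Qed.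
End Tangent.
End SmoothPoints.

(** * Smooth points *)

Section Classification.
Variable F : numClosedFieldType.
Local Notation W := (BS10 F).

Let two : (2%:R : F) != 0. Proof. by rewrite pnatr_eq0. Qed.

(** The three groups of coordinates A_k, B_k, C_l. *)
Lemma row11P (u v : 'rV[F]_11) : (forall k, (k < 4)%N -> u 0 (inord k) = v 0 (inord k)) ->
  (forall k, (k < 4)%N -> u 0 (inord k.+4) = v 0 (inord k.+4)) ->
  (forall k, (k < 3)%N -> u 0 (inord (8 + k)) = v 0 (inord (8 + k))) -> u = v.
Proof.
move=> h1 h2 h3; apply/rowP; apply: ord_iota => l; rewrite !inE.
do 10?[case/orP]; move/eqP->; try by apply: h1.
- exact: (h2 0%N). - exact: (h2 1%N). - exact: (h2 2%N). - exact: (h2 3%N).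
- exact: (h3 0%N). - exact: (h3 1%N). exact: (h3 2%N).
Qed.

(** The signs of the four singular points (1, +-2, +-2, +-2) of the Cayley cubic; the
    last three have product 1. *)
Definition node_sign (i k : nat) : F :=
  nth 0 (nth [::] [:: [:: 1; 1; 1; 1]; [:: 1; 1; -1; -1]; [:: 1; -1; 1; -1]; [:: 1; -1; -1; 1]] i) k.

Definition block (b : bool) (x : seq F) : 'rV[F]_11 :=
  row_of_seq 11 (if b then [:: 0; 0; 0; 0; x`_0; x`_1; x`_2; x`_3; 0; 0; 0]
                 else [:: x`_0; x`_1; x`_2; x`_3; 0; 0; 0; 0; 0; 0; 0]).

Definition node (b : bool) (i : nat) : 'rV[F]_11 :=
  block b [:: 1; 2%:R * node_sign i 1; 2%:R * node_sign i 2; 2%:R * node_sign i 3].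

Definition other (j m : nat) : nat :=
  nth 0%N (nth [::] [:: [:: 1; 2; 3]; [:: 0; 2; 3]; [:: 0; 1; 3]; [:: 0; 1; 2]] j) m.

Lemma smooth_of_coords z (w : 'I_11 -> F) (t j : nat) : (j < 4)%N ->
  (forall v : 'rV_11, (forall g, g \in bs10_gens F -> dirder z v g = 0) ->
     \sum_i v 0 i * w i = 0 -> (forall k, (k < 4)%N -> k != j -> v 0 (inord (t + k)) = 0) -> v = 0) ->
  ~ singular_point W z.
Proof.
move=> j4 H.
apply: (@smooth_of_functionals _ z [:: w; coord F (t + other j 0); coord F (t + other j 1); coord F (t + other j 2)]) => //.
move=> v vg vL; apply: H => //; first exact: (vL 0%N isT).
have := vL 1%N isT; have := vL 2%N isT; have := vL 3%N isT; rewrite /= !sum_coord => h3 h2 h1.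
by case: j j4 h1 h2 h3 {vL} => [|[|[|[|j]]]] // _ h1 h2 h3; case=> [|[|[|[|k]]]].
Qed.

(** The derivatives of the minors make q proportional to s, and those of the squares of
    the d_i add d_k^2 q = 0. *)
Lemma other_block_zero (s0 s1 s2 s3 d1 d2 d3 : F) (q : nat -> F) k : sextic_rel s0 s1 s2 s3 d1 d2 d3 ->
  (k < 3)%N -> [:: d1; d2; d3]`_k != 0 ->
  (forall i j, (i < 4)%N -> (j < 4)%N -> [:: s0; s1; s2; s3]`_i * q j = [:: s0; s1; s2; s3]`_j * q i) ->
  [/\ s1 * q 1%N = 4%:R * (s0 * q 0%N), s2 * q 2%N = 4%:R * (s0 * q 0%N) & s3 * q 3%N = 4%:R * (s0 * q 0%N)] ->
  forall j, (j < 4)%N -> q j = 0.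
Proof.
move=> [[r11 r22 r33] _] k3 dk m [e1 e2 e3] j j4.
have cancel (d x : F) : d != 0 -> d * d * x = 0 -> x = 0.
  by move=> d0 /eqP; rewrite !mulf_eq0 (negbTE d0) => /eqP.
apply: (cancel _ _ dk); have m0 := m 0%N j isT j4.
case: k k3 {dk} => [|[|[|k]]] //= _.
- by apply: (lincomb (eqD (eqD (eqM (q j) r11) (eqM s1 (m 1%N j isT j4)))
    (eqD (eqM (- (4%:R * s0)) m0) (eqM [:: s0; s1; s2; s3]`_j e1)))) => /=; ring.
- by apply: (lincomb (eqD (eqD (eqM (q j) r22) (eqM s2 (m 2%N j isT j4)))
    (eqD (eqM (- (4%:R * s0)) m0) (eqM [:: s0; s1; s2; s3]`_j e2)))) => /=; ring.
by apply: (lincomb (eqD (eqD (eqM (q j) r33) (eqM s3 (m 3%N j isT j4)))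
  (eqD (eqM (- (4%:R * s0)) m0) (eqM [:: s0; s1; s2; s3]`_j e3)))) => /=; ring.
Qed.

Section Cases.
Variables (y0 y1 s0 s1 s2 s3 d1 d2 d3 : F).
Hypothesis rel : sextic_rel s0 s1 s2 s3 d1 d2 d3.
Let z := row_of_seq 11 (bs10_coords y0 y1 s0 s1 s2 s3 d1 d2 d3).

Let pick_d : [|| d1 != 0, d2 != 0 | d3 != 0] -> exists2 k, (k < 3)%N & [:: d1; d2; d3]`_k != 0.
Proof. by case/or3P=> h; [exists 0%N | exists 1%N | exists 2%N]. Qed.

Let canc (a b : F) : a != 0 -> a * b = 0 -> b = 0.
Proof. by move=> a0 /eqP; rewrite mulf_eq0 (negbTE a0) => /eqP. Qed.

(** Over y0 = 0 or y1 = 0 the involution is free near a point with d <> 0. There the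
    four linear forms are one of the C_l and three coordinates of the block t that
    does not vanish. *)
Lemma smooth_boundary : [|| d1 != 0, d2 != 0 | d3 != 0] ->
  (y1 = 0 /\ y0 != 0) \/ (y0 = 0 /\ y1 != 0) -> ~ singular_point W z.
Proof.
move=> dn hy; have [k k3 dk] := pick_d dn; have [j j4 cj] := cayley_grad_neq0 dn.
pose t := if y1 == 0 then 0%N else 4%N.
apply: (@smooth_of_coords z (coord F (8 + k)) t j) => // v vg; rewrite sum_coord => rk hp.
have ht : t \in [:: 0; 4]%N by rewrite /t; case: eqP.
pose y := if t == 0%N then y0 else y1.
have y_neq0 : y != 0 by rewrite /y /t; case: hy => -[-> h]; rewrite ?eqxx ?(negbTE h).
have yy : y0 * y1 = 0 by case: hy => -[-> _]; rewrite ?mulr0 ?mul0r.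
have pt k' : (k' < 4)%N -> v 0 (inord (t + k')) = 0.
  apply: (hyperplane_coord j4 cj hp); have := tangent_cub rel vg ht.
  by rewrite /= -/y !addn0 !addn1 !addn2 !addn3 => /canc; apply; rewrite expf_neq0.
have [r1 r2 r3] : [/\ v 0 (inord 8) = 0, v 0 (inord 9) = 0 & v 0 (inord 10) = 0].
  have [] := tangent_syz vg ht; rewrite /= -/y yy !mul0r !add0r.
  have y2 : y ^+ 2 != 0 by rewrite expf_neq0.
  move=> /(canc y2) e1 /(canc y2) e2 /(canc y2) e3.
  apply: (cayley_kernel rel e1 e2 e3 k3 dk).
  by move: k3 rk; case: (k) => [|[|[|k']]].
have [a1 a2 a3] := tangent_adj vg.
have m i' j' (hi : (i' < 4)%N) (hj : (j' < 4)%N) := tangent_minor vg hi hj.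
have qt k' : (k' < 4)%N -> v 0 (inord ((4 - t) + k')) = 0.
  case: hy => -[y00 h].
    have -> : t = 0%N by rewrite /t y00 eqxx.
    have h2 : y0 ^+ 2 != 0 by rewrite expf_neq0.
    move: k'; apply: (other_block_zero (k := k) rel) => //.
      move=> i' j' hi hj; have := m i' j' hi hj; rewrite y00 expr0n /= !mul0r !subr0 => e.
      by apply: (mulfI h2); rewrite mulrCA e; ring.
    move: a1 a2 a3; rewrite y00 expr0n /= !mulr0 !mul0r !mulr0 !add0r.
    by move=> /esym/(canc h2)/eqP + /esym/(canc h2)/eqP + /esym/(canc h2)/eqP;
      rewrite !subr_eq0 => /eqP + /eqP + /eqP.
  have -> : t = 4%N by rewrite /t (negbTE h).
  have h2 : y1 ^+ 2 != 0 by rewrite expf_neq0.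
  move: k'; apply: (other_block_zero (k := k) rel) => //.
    move=> i' j' hi hj; have := m i' j' hi hj; rewrite y00 expr0n /= !mul0r !sub0r => e.
    rewrite !subnn !add0n; apply: (mulfI h2); apply: oppr_inj.
    transitivity ([:: s0; s1; s2; s3]`_i' * - (y1 ^+ 2 * v 0 (inord j'))); first by ring.
    by rewrite e; ring.
  move: a1 a2 a3; rewrite y00 expr0n /= !mul0r !mulr0 !addr0.
  move=> /esym/(canc h2)/eqP + /esym/(canc h2)/eqP + /esym/(canc h2)/eqP.
  by rewrite !subr_eq0 !subnn !add0n => /eqP h1 /eqP h3 /eqP h4; split; rewrite mulrC ?h1 ?h3 ?h4; ring.
have b0 k' : (k' < 4)%N -> v 0 (inord k') = 0.
  by move: ht qt pt; rewrite !inE => /orP[] /eqP-> qt pt hk; [have := pt _ hk | have := qt _ hk].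
have b4 k' : (k' < 4)%N -> v 0 (inord (4 + k')) = 0.
  by move: ht qt pt; rewrite !inE => /orP[] /eqP-> qt pt hk; [have := qt _ hk | have := pt _ hk].
apply: row11P => l l4; rewrite [RHS]mxE; [exact: b0 | exact: b4 |].
by move: l4; do 3?[case: l => [_|l]].
Qed.

Let w (i0 : nat) : 'I_11 -> F := fun i => y0 ^+ 2 * coord F i0.+4 i - y1 ^+ 2 * coord F i0 i.

Let sum_w (v : 'rV[F]_11) i0 :
  \sum_i v 0 i * w i0 i = y0 ^+ 2 * v 0 (inord i0.+4) - y1 ^+ 2 * v 0 (inord i0).
Proof.
rewrite -2!sum_coord !mulr_sumr -sumrB; apply: eq_bigr => i _; rewrite /w; ring.
Qed.

(** Over the open part of the line W is locally the product of the line and the sextic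
    surface. One linear form, w, fixes the direction of the line; if d = 0, the point
    lies over a fixed point of the involution of the sextic surface, and the tangent
    plane of that surface has the coordinates d2, d3. *)
Lemma smooth_interior : y0 != 0 -> y1 != 0 -> z != 0 -> ~ singular_point W z.
Proof.
move=> h0 h1 nz; have h02 : y0 ^+ 2 != 0 by rewrite expf_neq0.
have h12 : y1 ^+ 2 != 0 by rewrite expf_neq0.
have zero_of (v : 'rV[F]_11) : (forall k, (k < 4)%N -> v 0 (inord k) = 0) ->
    (forall k, (k < 4)%N -> v 0 (inord k.+4) = 0) ->
    v 0 (inord 8) = 0 -> v 0 (inord 9) = 0 -> v 0 (inord 10) = 0 -> v = 0.
  move=> b0 b4 r1 r2 r3; apply: row11P => l l4; rewrite [RHS]mxE; [exact: b0 | exact: b4 |].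
  by move: l4; do 3?[case: l => [_|l]].
have ratio (v : 'rV[F]_11) i0 : (forall g, g \in bs10_gens F -> dirder z v g = 0) ->
    (i0 < 4)%N -> [:: s0; s1; s2; s3]`_i0 != 0 -> \sum_i v 0 i * w i0 i = 0 ->
    forall k, (k < 4)%N -> y0 ^+ 2 * v 0 (inord k.+4) = y1 ^+ 2 * v 0 (inord k).
  move=> vg i04 si; rewrite sum_w => w0 k k4; apply/eqP; rewrite -subr_eq0; apply/eqP.
  by apply: (canc si); rewrite (tangent_minor vg i04 k4) w0 mulr0.
case: (boolP [|| d1 != 0, d2 != 0 | d3 != 0]) => [dn|].
  have [i0 i04 si] : exists2 i0, (i0 < 4)%N & [:: s0; s1; s2; s3]`_i0 != 0.
    case: (eqVneq s0 0) => e0; last by exists 0%N.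
    case: (eqVneq s1 0) => e1; last by exists 1%N.
    case: (eqVneq s2 0) => e2; last by exists 2%N.
    case: (eqVneq s3 0) => e3; last by exists 3%N.
    case: rel => [[r11 r22 r33] _]; move/eqP: r11; move/eqP: r22; move/eqP: r33.
    rewrite e0 e1 e2 e3 !mulr0 subrr !mulf_eq0 !orbb => /eqP x3 /eqP x2 /eqP x1.
    by move: dn; rewrite x1 x2 x3 eqxx.
  have [j j4 cj] := cayley_grad_neq0 dn.
  apply: (@smooth_of_coords z (w i0) 0 j) => // v vg wv hp.
  have rat := ratio v i0 vg i04 si wv.
  pose rho l := y0 / y1 * v 0 (inord l).
  have [p0 [r1 r2 r3]] : (forall k, (k < 4)%N -> v 0 (inord k) = 0) /\ [/\ rho 8%N = 0, rho 9%N = 0 & rho 10%N = 0].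
    apply: (sextic_tangent rel dn j4 cj _ _ hp).
      have [e1 e2 e3] := tangent_syz vg (isT : 0%N \in [:: 0; 4]%N); rewrite /= in e1 e2 e3.
      have yy : y0 * y1 != 0 by rewrite mulf_neq0.
      by split; apply: (mulfI yy); rewrite mulr0;
        [rewrite -[RHS]e1 | rewrite -[RHS]e2 | rewrite -[RHS]e3]; rewrite /rho; field.
    have [a1 a2 a3] := tangent_adj vg.
    have R1 := rat 1%N isT; have R2 := rat 2%N isT; have R3 := rat 3%N isT; have R0 := rat 0%N isT.
    split; apply: (mulfI h12).
    + by apply: (lincomb (eqD a1 (eqD (eqM s1 R1) (eqM (- (4%:R * s0)) R0)))); rewrite /rho; field.
    + by apply: (lincomb (eqD a2 (eqD (eqM s2 R2) (eqM (- (4%:R * s0)) R0)))); rewrite /rho; field.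
    by apply: (lincomb (eqD a3 (eqD (eqM s3 R3) (eqM (- (4%:R * s0)) R0)))); rewrite /rho; field.
  have yy : y0 / y1 != 0 by rewrite mulf_neq0 // invr_eq0.
  apply: zero_of => //; try exact: (canc yy).
  by move=> k k4; apply: (canc h02); rewrite rat // p0 // mulr0.
rewrite !negb_or !negbK => /and3P[/eqP d10 /eqP d20 /eqP d30].
case: (rel) => [[r11 r22 r33] _].
have sq s : 0 = s * s - 4%:R * (s0 * s0) -> s0 = 0 -> s = 0.
  by move=> /esym/eqP + s00; rewrite s00 !mulr0 subr0 mulf_eq0 orbb => /eqP.
rewrite d10 mulr0 in r11; rewrite d20 mulr0 in r22; rewrite d30 mulr0 in r33.
have s00 : s0 != 0.
  apply: contraNneq nz => s00; apply/eqP/rowP; apply: ord_iota => l; rewrite [RHS]mxE /z.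
  rewrite d10 d20 d30 (sq _ r11 s00) (sq _ r22 s00) (sq _ r33 s00) s00 /bs10_coords !mulr0 !inE.
  by do 10?[case/orP]; move/eqP->; rewrite row_of_seqE.
have sk s : 0 = s * s - 4%:R * (s0 * s0) -> s != 0.
  move=> /esym e; apply/eqP => s0'; move: e; rewrite s0' mul0r sub0r => /eqP.
  by rewrite oppr_eq0 !mulf_eq0 pnatr_eq0 (negbTE s00).
apply: (@smooth_of_functionals _ z [:: w 0; coord F 0; coord F 9; coord F 10]) => v vg vL.
have wv := vL 0%N isT; have := vL 1%N isT; have := vL 2%N isT; have := vL 3%N isT.
rewrite /= !sum_coord in wv * => r3 r2 p0.
have rat := ratio v 0%N vg isT s00 wv.
have [a1 a2 a3] := tangent_adj vg.
have R1 := rat 1%N isT; have R2 := rat 2%N isT; have R3 := rat 3%N isT; have R0 := rat 0%N isT.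
rewrite p0 mulr0 in R0.
have q0 := canc h02 R0.
have [e1 _ _] := tangent_syz vg (isT : 0%N \in [:: 0; 4]%N); rewrite /= in e1.
have r1 : v 0 (inord 8) = 0.
  apply: (canc (_ : y0 ^+ 2 * (2%:R * s0) != 0)); first by rewrite !mulf_neq0.
  by rewrite -[RHS]e1 d10 d20 d30 r2 r3; ring.
have pk p q s (dv : F) : s != 0 -> y0 ^+ 2 * q = y1 ^+ 2 * p ->
    2%:R * dv = y1 ^+ 2 * (p * s - 4%:R * (0 * s0)) + y0 ^+ 2 * (s * q - 4%:R * (s0 * 0)) -> dv = 0 -> p = 0.
  move=> sn R e dv0; apply: (canc (_ : 2%:R * (y1 ^+ 2 * s) != 0)); first by rewrite !mulf_neq0.
  by apply: (lincomb (eqD (eqM (-1) e) (eqD (eqM (- s) R) (eqM 2%:R dv0)))); ring.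
rewrite p0 q0 in a1 a2 a3.
have p1 := pk _ _ _ _ (sk _ r11) R1 a1; have p2 := pk _ _ _ _ (sk _ r22) R2 a2; have p3 := pk _ _ _ _ (sk _ r33) R3 a3.
have {}p1 : v 0 (inord 1) = 0 by apply: p1; rewrite d10; ring.
have {}p2 : v 0 (inord 2) = 0 by apply: p2; rewrite d20; ring.
have {}p3 : v 0 (inord 3) = 0 by apply: p3; rewrite d30; ring.
have pp k : (k < 4)%N -> v 0 (inord k) = 0 by case: k => [|[|[|[|k]]]].
by apply: zero_of => // k k4; apply: (canc h02); rewrite rat // pp // mulr0.
Qed.

End Cases.
End Classification.

(** * The eight singular points and their lines *)

Section Nodes.
Variable F : numClosedFieldType.
Local Notation W := (BS10 F).
Local Notation eps := (node_sign F).

Let two : (2%:R : F) != 0. Proof. by rewrite pnatr_eq0. Qed.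

Lemma node_signP i : (i < 4)%N -> [/\ eps i 1 * eps i 3 = eps i 2, eps i 1 * eps i 1 = 1,
   eps i 2 * eps i 2 = 1 & eps i 3 * eps i 3 = 1].
Proof. by case: i => [|[|[|[|i]]]] // _; rewrite /node_sign /=; split; ring. Qed.

Lemma blockE b (x : seq F) k : (k < 4)%N ->
  block b x 0 (inord k) = (if b then 0 else x`_k) /\ block b x 0 (inord k.+4) = (if b then x`_k else 0).
Proof. by case: k => [|[|[|[|k]]]] // _; rewrite /block !row_of_seqE //=; case: b. Qed.

Lemma blockE8 b (x : seq F) k : (k < 3)%N -> block b x 0 (inord (8 + k)) = 0.
Proof. by case: k => [|[|[|k]]] // _; rewrite /block !row_of_seqE //=; case: b. Qed.

Definition node_vec (i : nat) : seq F := [:: 1; 2%:R * eps i 1; 2%:R * eps i 2; 2%:R * eps i 3].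

Lemma nodeE b i k : (k < 4)%N ->
  node F b i 0 (inord k) = (if b then 0 else (node_vec i)`_k) /\
  node F b i 0 (inord k.+4) = (if b then (node_vec i)`_k else 0).
Proof. exact: blockE. Qed.

Lemma BS10_scale (z : 'rV[F]_11) c : c != 0 -> W z -> W (c *: z).
Proof.
move=> c0 [x [Dx nz sz]]; exists x; split=> //; apply: same_point_trans sz.
by apply/same_pointP; exists c.
Qed.

(** A singular point has y0 y1 = 0 and d = 0. Then M has rank 1, so that
    s = (1, +-2, +-2, +-2) up to scale, the product of the three signs being 1. *)
Lemma singular_is_node z : singular_point W z -> exists b (i : 'I_4), same_point z (node F b i).
Proof.
move=> sz; have [y0 [y1 [s0 [s1 [s2 [s3 [d1 [d2 [d3 [rel ez nz]]]]]]]]]] := BS10_coords sz.1.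
case: (boolP ((y0 != 0) && (y1 != 0))) => [/andP[h0 h1]|hy].
  by exfalso; move: sz; rewrite ez; apply: smooth_interior => //; rewrite -ez.
have hy' : (y1 = 0 /\ y0 != 0) \/ (y0 = 0 /\ y1 != 0).
  move: hy; rewrite negb_and !negbK; case: (eqVneq y1 0) => [e1|h1]; case: (eqVneq y0 0) => [e0|h0] //= _.
  - exfalso; move: nz; rewrite ez e0 e1; case/eqP; apply/rowP; apply: ord_iota => l; rewrite [RHS]mxE !inE.
    by do 10?[case/orP]; move/eqP->; rewrite row_of_seqE //= ?expr0n /= ?mul0r ?mulr0.
  - by left.
  by right.
case: (boolP [|| d1 != 0, d2 != 0 | d3 != 0]) => [dn|].
  by exfalso; move: sz; rewrite ez; exact: smooth_boundary.
rewrite !negb_or !negbK => /and3P[/eqP d10 /eqP d20 /eqP d30]; subst d1 d2 d3.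
case: (rel) => [[r11 r22 r33] [[r12 r13 r23] _]].
have sgn (s : F) : 0 * 0 = s * s - 4%:R * (s0 * s0) -> s = 2%:R * s0 \/ s = - (2%:R * s0).
  move=> e; have : (s - 2%:R * s0) * (s + 2%:R * s0) == 0.
    by apply/eqP; rewrite -[RHS](mul0r 0) e; ring.
  by rewrite mulf_eq0 subr_eq0 addr_eq0 => /orP[] /eqP ->; [left | right].
have s00 : s0 != 0.
  apply: contraNneq nz => e; apply/eqP; rewrite ez.
  have := (sgn _ r11, sgn _ r22, sgn _ r33); rewrite e mulr0 oppr0.
  move=> [[h1 h2] h3]; have [-> -> ->] : [/\ s1 = 0, s2 = 0 & s3 = 0] by split; tauto.
  apply/rowP; apply: ord_iota => l; rewrite [RHS]mxE !inE.
  by do 10?[case/orP]; move/eqP->; rewrite row_of_seqE //= !mulr0.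
have e3 : s3 = s1 * s2 / (2%:R * s0).
  apply: (mulfI (mulf_neq0 two s00)); rewrite [RHS]mulrC mulfVK ?mulf_neq0 //.
  by apply/eqP; rewrite -subr_eq0 -oppr_eq0 opprB -mulrA -r12 mul0r.
have [i [h1 h2 h3]] : exists i : 'I_4, [/\ s1 = s0 * (2%:R * eps i 1), s2 = s0 * (2%:R * eps i 2) &
    s3 = s0 * (2%:R * eps i 3)].
  rewrite e3; case: (sgn _ r11) => ->; case: (sgn _ r22) => ->.
  - by exists (@Ordinal 4 0 isT); rewrite /node_sign /=; split; field.
  - by exists (@Ordinal 4 1 isT); rewrite /node_sign /=; split; field.
  - by exists (@Ordinal 4 2 isT); rewrite /node_sign /=; split; field.
  by exists (@Ordinal 4 3 isT); rewrite /node_sign /=; split; field.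
case: hy' => -[yz yn].
  exists false, i; apply/same_pointP; exists (y0 ^+ 2 * s0); first by rewrite mulf_neq0 // expf_neq0.
  rewrite ez yz h1 h2 h3; apply: row11P => k hk; rewrite [RHS]mxE.
  - by rewrite (nodeE _ _ hk).1; case: k hk => [|[|[|[|k]]]] // _; rewrite row_of_seqE //= ?mulr1 -?mulrA.
  - by rewrite (nodeE _ _ hk).2; case: k hk => [|[|[|[|k]]]] // _; rewrite row_of_seqE //= ?expr0n /= ?mul0r ?mulr0.
  by rewrite blockE8 //; case: k hk => [|[|[|k]]] // _; rewrite row_of_seqE //= !mulr0.
exists true, i; apply/same_pointP; exists (y1 ^+ 2 * s0); first by rewrite mulf_neq0 // expf_neq0.
rewrite ez yz h1 h2 h3; apply: row11P => k hk; rewrite [RHS]mxE.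
- by rewrite (nodeE _ _ hk).1; case: k hk => [|[|[|[|k]]]] // _; rewrite row_of_seqE //= ?expr0n /= ?mul0r ?mulr0.
- by rewrite (nodeE _ _ hk).2; case: k hk => [|[|[|[|k]]]] // _; rewrite row_of_seqE //= ?mulr1 -?mulrA.
by rewrite blockE8 //; case: k hk => [|[|[|k]]] // _; rewrite row_of_seqE //= !mulr0.
Qed.

(** The square root of l is absorbed in the coordinate of the line. *)
Lemma block_in_BS10 b l (x : 'rV[F]_7) (s : seq F) : l != 0 -> del_pezzo6 x -> block b s != 0 ->
  let y k := x 0 (inord k) in
  [/\ s`_0 = l * y 6, s`_1 = l * (y 0 + y 2), s`_2 = l * (y 1 + y 4) & s`_3 = l * (y 3 + y 5)] ->
  W (block b s).
Proof.
move=> l0 dx nz /= [e0 e1 e2 e3].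
pose g := sqrtC l; have g2 : g ^+ 2 = l by rewrite sqrtCK.
apply: (@sextic_in_BS10 _ (if b then 0 else g) (if b then g else 0) x) => //.
apply: row11P => k hk; rewrite ?(blockE _ _ hk).1 ?(blockE _ _ hk).2 ?blockE8 //.
- case: k hk => [|[|[|[|k]]]] // _; rewrite row_of_seqE //=; case: b {nz};
  by rewrite ?expr0n ?g2 /= ?mul0r ?e0 ?e1 ?e2 ?e3.
- case: k hk => [|[|[|[|k]]]] // _; rewrite row_of_seqE //=; case: b {nz};
  by rewrite ?expr0n ?g2 /= ?mul0r ?e0 ?e1 ?e2 ?e3.
by case: k hk => [|[|[|k]]] // _; rewrite row_of_seqE //=; case: b {nz}; rewrite !(mulr0, mul0r).
Qed.

(** A point [S : D] of the projective line is [t : (t^2 + 1) / 2] for some t. *)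
Lemma line_parameter (S D : F) : (S != 0) || (D != 0) ->
  exists l t, [/\ l != 0, l * t = S & l * (t ^+ 2 + 1) = 2%:R * D].
Proof.
case: (eqVneq S 0) => [->|S0] /= h.
  by exists (2%:R * D), 0; rewrite mulf_neq0 //; split=> //; ring.
have [t t0 e] := @joukowski F 1 (2%:R * D / S) (oner_neq0 _).
exists (S / t), t; rewrite mulf_neq0 ?invr_eq0 //; split=> //; first by rewrite divfK.
transitivity (S * (1 * (t + t^-1))); first by field.
by rewrite e; field.
Qed.

(** The line of the Cayley cubic joining two nodes that agree in the k-th sign is the
    image of the conic of the sextic surface on which one of the u_i is +-t and the
    two others are +-1; the involution acts on it by t |-> 1 / t. *)
Lemma cayley_line b (S D e1 e2 e3 : F) k : (S != 0) || (D != 0) ->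
  [/\ e1 * e3 = e2, e1 * e1 = 1, e2 * e2 = 1 & e3 * e3 = 1] -> (k < 3)%N ->
  let c m := if k == m then S else D in
  W (block b [:: S; 2%:R * (e1 * c 0%N); 2%:R * (e2 * c 1%N); 2%:R * (e3 * c 2%N)]).
Proof.
move=> SD [e13 e11 e22 e33] k3 c; have [l [t [l0 lS lD]]] := line_parameter SD.
have n1 : e1 != 0 by apply: contraTneq (oner_neq0 F) => h; rewrite -e11 h mul0r eqxx.
have n2 : e2 != 0 by apply: contraTneq (oner_neq0 F) => h; rewrite -e22 h mul0r eqxx.
have n3 : e3 != 0 by apply: contraTneq (oner_neq0 F) => h; rewrite -e33 h mul0r eqxx.
have nz : block b [:: S; 2%:R * (e1 * c 0%N); 2%:R * (e2 * c 1%N); 2%:R * (e3 * c 2%N)] != 0.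
  have at_ m : (m < 4)%N -> [:: S; 2%:R * (e1 * c 0%N); 2%:R * (e2 * c 1%N); 2%:R * (e3 * c 2%N)]`_m != 0 ->
    block b [:: S; 2%:R * (e1 * c 0%N); 2%:R * (e2 * c 1%N); 2%:R * (e3 * c 2%N)] != 0.
    move=> m4; apply: contraNneq => /rowP h; have [E1 E2] := blockE b [:: S; 2%:R * (e1 * c 0%N); 2%:R * (e2 * c 1%N); 2%:R * (e3 * c 2%N)] m4.
    have := h (inord m); have := h (inord m.+4); rewrite E1 E2 !mxE.
    by case: (b) => [->|_ ->].
  case/orP: SD => h; first exact: (at_ 0%N).
  case: k k3 @c at_ => [|[|[|k]]] // _ c at_.
  - by apply: (at_ 2%N) => //; rewrite /= !mulf_neq0.
  - by apply: (at_ 1%N) => //; rewrite /= !mulf_neq0.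
  by apply: (at_ 1%N) => //; rewrite /= !mulf_neq0.
have e3i : e3 = e1 * e2 by rewrite -e13 mulrA e11 mul1r.
case: k k3 @c nz => [|[|[|k]]] // _ c nz.
- apply: (@block_in_BS10 b l (row_of_seq 7 [:: t * e1; t ^+ 2 * e2; t * e1; t ^+ 2 * e3; e2; e3; t]) _ l0 _ nz).
    apply: (@del_pezzo6_param _ 1 e1 (t * e2) e3) => //.
      apply/eqP => /rowP/(_ (inord 4)); rewrite row_of_seqE // mxE /= expr1n mul1r => /eqP.
      by rewrite (negbTE n1).
    apply/rowP; apply: ord_iota => m; rewrite !inE [RHS]mxE e3i.
    by do 6?[case/orP]; move/eqP->; rewrite !row_of_seqE //=; ring: e11 e22.
  rewrite !row_of_seqE //= /c /= -lS; split=> //.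
  + by ring.
  + by rewrite mulrCA -lD; ring.
  by rewrite mulrCA -lD; ring.
- apply: (@block_in_BS10 b l (row_of_seq 7 [:: t ^+ 2 * e1; t * e2; e1; e3; t * e2; t ^+ 2 * e3; t]) _ l0 _ nz).
    apply: (@del_pezzo6_param _ 1 (t * e1) e2 e3) => //.
      apply/eqP => /rowP/(_ (inord 2)); rewrite row_of_seqE // mxE /= expr1n mul1r => /eqP.
      by rewrite (negbTE n2).
    apply/rowP; apply: ord_iota => m; rewrite !inE [RHS]mxE e3i.
    by do 6?[case/orP]; move/eqP->; rewrite !row_of_seqE //=; ring: e11 e22.
  rewrite !row_of_seqE //= /c /= -lS; split=> //.
  + by rewrite mulrCA -lD; ring.
  + by ring.
  by rewrite mulrCA -lD; ring.
apply: (@block_in_BS10 b l (row_of_seq 7 [:: e1; e2; t ^+ 2 * e1; t * e3; t ^+ 2 * e2; t * e3; t]) _ l0 _ nz).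
  apply: (@del_pezzo6_param _ t e1 e2 e3) => //.
    apply/eqP => /rowP/(_ (inord 0)); rewrite row_of_seqE // mxE /= expr2 e11 mul1r => /eqP.
    by rewrite (negbTE n2).
  apply/rowP; apply: ord_iota => m; rewrite !inE [RHS]mxE e3i.
  by do 6?[case/orP]; move/eqP->; rewrite !row_of_seqE //=; ring: e11 e22.
rewrite !row_of_seqE //= /c /= -lS; split=> //.
- by rewrite mulrCA -lD; ring.
- by rewrite mulrCA -lD; ring.
by ring.
Qed.

(** The image of the product of the line and a fixed point of the sextic surface. *)
Lemma cross_line (a c : F) i : (i < 4)%N -> a *: node F false i + c *: node F true i != 0 ->
  W (a *: node F false i + c *: node F true i).
Proof.
move=> i4 nz; have [e13 e11 e22 e33] := node_signP i4.
have e3i : eps i 3 = eps i 1 * eps i 2 by rewrite -e13 mulrA e11 mul1r.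
pose x := row_of_seq 7 [:: eps i 1; eps i 2; eps i 1; eps i 3; eps i 2; eps i 3; 1].
have n3 : eps i 3 != 0 by apply: contraTneq (oner_neq0 F) => h; rewrite -e33 h mul0r eqxx.
have n1 : eps i 1 != 0 by apply: contraTneq (oner_neq0 F) => h; rewrite -e11 h mul0r eqxx.
have dx : del_pezzo6 x.
  apply: (@del_pezzo6_param _ 1 (eps i 1) (eps i 2) (eps i 3)) => //.
    apply/eqP => /rowP/(_ (inord 4)); rewrite row_of_seqE // mxE /= expr1n mul1r => /eqP.
    by rewrite (negbTE n1).
  apply/rowP; apply: ord_iota => m; rewrite !inE [RHS]mxE e3i.
  by do 6?[case/orP]; move/eqP->; rewrite !row_of_seqE //= ?e3i; ring: e11 e22.
apply: (@sextic_in_BS10 _ (sqrtC a) (sqrtC c) x) => //.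
apply: row11P => k hk; rewrite [LHS]mxE [X in X + _]mxE [X in _ + X]mxE.
- rewrite !(nodeE _ _ hk).1 mulr0 addr0.
  by case: k hk => [|[|[|[|k]]]] // _; rewrite !row_of_seqE //= sqrtCK; ring.
- rewrite !(nodeE _ _ hk).2 mulr0 add0r.
  by case: k hk => [|[|[|[|k]]]] // _; rewrite !row_of_seqE //= sqrtCK; ring.
rewrite !blockE8 // !mulr0 addr0.
by case: k hk => [|[|[|k]]] // _; rewrite !row_of_seqE //=; ring.
Qed.

(** Two of the four sign vectors agree in one place and are opposite in the others. *)
Lemma node_line b (i j : nat) (a c : F) : (i < 4)%N -> (j < 4)%N ->
  a *: node F b i + c *: node F b j != 0 -> W (a *: node F b i + c *: node F b j).
Proof.
move=> i4 j4 nz; case: (eqVneq i j) => [ij|ij].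
  move: nz; rewrite -ij -scalerDl => nz.
  case: b nz => nz; first by rewrite -[X in W X]add0r -(scale0r (node F false i)); apply: cross_line; rewrite // scale0r add0r.
  by rewrite -[X in W X]addr0 -(scale0r (node F true i)); apply: cross_line; rewrite // scale0r addr0.
have [k [k3 [ek S D]]] : exists k, (k < 3)%N /\ [/\ eps j k.+1 = eps i k.+1,
    (forall m, (m < 3)%N -> m != k -> eps j m.+1 = - eps i m.+1) & true].
  move: i4 j4 ij {nz}; case: i => [|[|[|[|i]]]] //; case: j => [|[|[|[|j]]]] //= _ _ _;
    first [ by exists 0%N; split=> //; split=> //; case=> [|[|[|m]]] //= _ _; rewrite /node_sign /= ?opprK
          | by exists 1%N; split=> //; split=> //; case=> [|[|[|m]]] //= _ _; rewrite /node_sign /= ?opprK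
          | by exists 2%N; split=> //; split=> //; case=> [|[|[|m]]] //= _ _; rewrite /node_sign /= ?opprK ].
have e : a *: node F b i + c *: node F b j = block b [:: a + c;
    2%:R * (eps i 1 * (if k == 0%N then a + c else a - c));
    2%:R * (eps i 2 * (if k == 1%N then a + c else a - c));
    2%:R * (eps i 3 * (if k == 2%N then a + c else a - c))].
  have hm m : (m < 3)%N -> a * (2%:R * eps i m.+1) + c * (2%:R * eps j m.+1) =
     2%:R * (eps i m.+1 * (if k == m then a + c else a - c)).
    move=> m3; case: (eqVneq k m) => [<-|km]; first by rewrite ek; ring.
    by rewrite S // 1?eq_sym //; ring.
  apply: row11P => l hl; rewrite [LHS]mxE [X in X + _]mxE [X in _ + X]mxE.
  - rewrite !(nodeE _ _ hl).1 (blockE _ _ hl).1; case: (b); rewrite ?mulr0 ?addr0 //.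
    case: l hl => [|[|[|[|l]]]] // _ /=; [by ring | exact: (hm 0%N) | exact: (hm 1%N) | exact: (hm 2%N)].
  - rewrite !(nodeE _ _ hl).2 (blockE _ _ hl).2; case: (b); rewrite ?mulr0 ?addr0 //.
    case: l hl => [|[|[|[|l]]]] // _ /=; [by ring | exact: (hm 0%N) | exact: (hm 1%N) | exact: (hm 2%N)].
  by rewrite !blockE8 // !mulr0 addr0.
rewrite e; apply: cayley_line => //; last exact: node_signP.
apply: contraNT nz; rewrite negb_or !negbK => /andP[/eqP S0 /eqP D0].
have a0 : a = 0.
  apply: (mulfI two); rewrite mulr0 -[RHS](addr0 0) -{1}S0 -D0; ring.
have c0 : c = 0 by move: S0; rewrite a0 add0r.
by rewrite a0 c0 !scale0r addr0.
Qed.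

Lemma nodes_independent b i (c : F) : (i < 4)%N -> c != 0 ->
  row_free (c *: \matrix_(k < 5) (if (k < 4)%N then node F b k else node F (~~ b) i)).
Proof.
move=> i4 c0; rewrite /row_free mxrank_scale_nz // -/(row_free _).
set U := \matrix_(k < 5) _; rewrite -kermx_eq0; apply/rowV0P => v /sub_kermxP/rowP vU.
have E (l : nat) : \sum_(k < 5) v 0 k * U k (inord l) = 0.
  by have := vU (inord l); rewrite mxE [RHS]mxE.
have Uk (k : nat) l : (k < 4)%N -> U (inord k) l = node F b k 0 l.
  by move=> k4; rewrite mxE inordK ?k4 // ltnS ltnW.
have U4 l : U (inord 4) l = node F (~~ b) i 0 l by rewrite mxE inordK.
have big (f : 'I_5 -> F) : \sum_k f k = f (inord 0) + f (inord 1) + f (inord 2) + f (inord 3) + f (inord 4).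
  rewrite !big_ord_recr big_ord0 /= add0r.
  by do !congr (_ + _); congr f; apply: val_inj; rewrite /= inordK.
have E4 (l : nat) : (l < 4)%N -> v 0 (inord 0) * (node_vec 0)`_l + v 0 (inord 1) * (node_vec 1)`_l +
   v 0 (inord 2) * (node_vec 2)`_l + v 0 (inord 3) * (node_vec 3)`_l = 0.
  move=> l4; have := E (if b then l.+4 else l); rewrite big U4 !Uk //.
  by case: (b); rewrite ?(nodeE _ _ l4).1 ?(nodeE _ _ l4).2 /= mulr0 addr0.
have e0 := E4 0%N isT; have e1 := E4 1%N isT; have e2 := E4 2%N isT; have e3 := E4 3%N isT.
rewrite /node_vec /node_sign /= !mulr1 in e0 e1 e2 e3.
have e4 : v 0 (inord 4) = 0.
  have := E (if b then 0 else 4)%N; rewrite big U4 !Uk //.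
  by case: (b); rewrite ?(nodeE _ _ (isT : 0 < 4)%N).1 ?(nodeE _ _ (isT : 0 < 4)%N).2 /= !mulr0 !add0r mulr1.
have four : (4%:R : F) != 0 by rewrite pnatr_eq0.
have fin (x : F) : 4%:R * x = 0 -> x = 0 by move=> /eqP; rewrite mulf_eq0 (negbTE four) => /eqP.
move: e0 e1 e2 e3; set v0 := v 0 (inord 0); set v1 := v 0 (inord 1); set v2 := v 0 (inord 2); set v3 := v 0 (inord 3).
move=> e0 e1 e2 e3.
have comb (a b c : F) := eqD e0 (eqD (eqM a e1) (eqD (eqM b e2) (eqM c e3))).
have z0 : v0 = 0 by apply: fin; apply: (lincomb (comb 2%:R^-1 2%:R^-1 2%:R^-1)); field.
have z1 : v1 = 0 by apply: fin; apply: (lincomb (comb 2%:R^-1 (- 2%:R^-1) (- 2%:R^-1))); field.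
have z2 : v2 = 0 by apply: fin; apply: (lincomb (comb (- 2%:R^-1) 2%:R^-1 (- 2%:R^-1))); field.
have z3 : v3 = 0 by move: e0; rewrite z0 z1 z2 !add0r.
apply/rowP; apply: ord_iota => k; rewrite !inE [RHS]mxE.
by do 4?[case/orP]; move/eqP->.
Qed.

Lemma node_coord0 b i : node F b i 0 (inord (if b then 4 else 0)%N) = 1.
Proof. by case: b; rewrite ?(nodeE _ _ (isT : 0 < 4)%N).1 ?(nodeE _ _ (isT : 0 < 4)%N).2. Qed.

Lemma node_neq0 b i : node F b i != 0.
Proof.
apply/eqP => /rowP/(_ (inord (if b then 4 else 0)%N)).
by rewrite node_coord0 mxE => /eqP; rewrite oner_eq0.
Qed.

Lemma node_in_BS10 b i : (i < 4)%N -> W (node F b i).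
Proof.
move=> i4; have := @node_line b i i 1 0 i4 i4; rewrite scale1r scale0r addr0; apply.
exact: node_neq0.
Qed.

(** Four lines of W pass through a node; together with the node itself they span a
    space of dimension five. *)
Lemma node_singular z b i : (i < 4)%N -> same_point z (node F b i) -> singular_point W z.
Proof.
move=> i4 /same_pointP[c c0 ez].
apply: (singular_of_lines (U := c *: \matrix_(k < 5) (if (k < 4)%N then node F b k else node F (~~ b) i))).
- by rewrite ez; apply: BS10_scale => //; exact: node_in_BS10.
- exact: nodes_independent.
move=> k t t1; rewrite linearZ /= rowK ez scalerA mulrC -scalerA -scalerDr; apply: BS10_scale => //.
case: ifP => k4.
  have := @node_line b i k 1 t i4 k4; rewrite scale1r; apply.
  apply/eqP => /rowP/(_ (inord (if b then 4 else 0)%N)).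
  rewrite mxE [X in _ + X]mxE !node_coord0 mxE mulr1 => /eqP.
  by rewrite addrC addr_eq0 (negbTE t1).
have nz : node F b i + t *: node F (~~ b) i != 0.
  apply/eqP => /rowP/(_ (inord (if b then 4 else 0)%N)).
  rewrite mxE [X in _ + X]mxE node_coord0 [RHS]mxE.
  have -> : node F (~~ b) i 0 (inord (if b then 4 else 0)%N) = 0.
    by case: (b); rewrite ?(nodeE _ _ (isT : 0 < 4)%N).1 ?(nodeE _ _ (isT : 0 < 4)%N).2.
  by rewrite mulr0 addr0 => /eqP; rewrite oner_eq0.
case: b nz {k4 ez} => /= nz.
  by rewrite addrC -[node F true i]scale1r; apply: cross_line; rewrite // scale1r addrC.
by rewrite -[node F false i]scale1r; apply: cross_line; rewrite // scale1r.
Qed.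

Lemma node_inj b b' i j : (i < 4)%N -> (j < 4)%N -> same_point (node F b i) (node F b' j) -> b = b' /\ i = j.
Proof.
move=> i4 j4 /same_pointP[c c0 /rowP e].
have bb : b = b'.
  apply: contraTeq isT => /negP nb; have := e (inord (if b then 4 else 0)%N).
  rewrite node_coord0 [RHS]mxE; have -> : b' = ~~ b by case: b b' nb {e} => -[].
  have -> : node F (~~ b) j 0 (inord (if b then 4 else 0)%N) = 0.
    by case: (b); rewrite ?(nodeE _ _ (isT : 0 < 4)%N).1 ?(nodeE _ _ (isT : 0 < 4)%N).2.
  by rewrite mulr0 => /eqP; rewrite oner_eq0.
split=> //; subst b'.
have c1 : c = 1 by have := e (inord (if b then 4 else 0)%N); rewrite [RHS]mxE !node_coord0 mulr1.
have ev k : (k < 4)%N -> (node_vec i)`_k = (node_vec j)`_k.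
  move=> k4; have := e (inord (if b then k.+4 else k)); rewrite [RHS]mxE c1 mul1r.
  by case: (b); rewrite ?(nodeE _ _ k4).1 ?(nodeE _ _ k4).2.
have := (ev 1%N isT, ev 2%N isT, ev 3%N isT); rewrite /node_vec /= => -[[h1 h2] h3].
have {}h1 := mulfI two h1; have {}h2 := mulfI two h2; have {}h3 := mulfI two h3.
have n1 : (1 : F) <> -1 by move/eqP; rewrite -addr_eq0 -[1 + 1]/(2%:R) (negbTE two).
have n2 : (-1 : F) <> 1 by move/esym.
by move: i4 j4 h1 h2 h3 {ev e}; rewrite /node_sign; case: i => [|[|[|[|i]]]] //; case: j => [|[|[|[|j]]]] //= _ _ h1 h2 h3;
  exfalso; tauto.
Qed.

(** The quadrics A_0 B_k - A_k B_0 do not vanish on the sum of two such nodes. *)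
Lemma nodes_not_joined b i j : (i < 4)%N -> (j < 4)%N -> i != j ->
  ~ W (node F b i + node F (~~ b) j).
Proof.
move=> i4 j4 ij Wz; have eqv k : (k < 4)%N -> (node_vec i)`_k = (node_vec j)`_k.
  move=> k4; have := minor_mem (isT : 0 < 4)%N k4 Wz.
  have E l : (node F b i + node F (~~ b) j) 0 l = node F b i 0 l + node F (~~ b) j 0 l by rewrite mxE.
  rewrite mevalB !mevalM !mevalXU !E.
  rewrite !(nodeE _ _ k4).1 !(nodeE _ _ k4).2 !(nodeE _ _ (isT : 0 < 4)%N).1 !(nodeE _ _ (isT : 0 < 4)%N).2.
  by case: (b) => /=; rewrite !(add0r, addr0, mul1r, mulr1) => /eqP; rewrite subr_eq0 => /eqP.
have : same_point (node F b i) (node F b j).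
  apply/same_pointP; exists 1; rewrite ?oner_neq0 // scale1r; apply: row11P => k hk.
  - by rewrite !(nodeE _ _ hk).1 eqv.
  - by rewrite !(nodeE _ _ hk).2 eqv.
  by rewrite !blockE8.
by case/(node_inj i4 j4) => _ e; rewrite e eqxx in ij.
Qed.

End Nodes.

(** * Local invariants and linear symmetries *)

Section LocalInvariants.
Variables (F : fieldType) (n : nat).
Implicit Types (W : set 'rV[F]_n.+1) (p q : 'rV[F]_n.+1) (I J : set {mpoly F[n]}).

Lemma pihomog_lin_subst (A : 'M[F]_n) d (f : {mpoly F[n]}) :
  pihomog mdeg d (f \mPo lin_subst A) = pihomog mdeg d f \mPo lin_subst A.
Proof.
rewrite [f \mPo _]comp_mpolyEX [pihomog mdeg d f]pihomogE raddf_sum [RHS]raddf_sum /=.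
rewrite [RHS]big_mkcond; apply: eq_bigr => m _; rewrite linearZ /= comp_mpolyZ.
have hm : 'X_[m] \mPo lin_subst A \is (mdeg m).-homog by apply: dhomog_lin_subst; rewrite dhomogX /=.
case: eqP => [<-|/eqP md]; first by rewrite pihomog_dE.
by rewrite (pihomog_ne0 md hm) scaler0.
Qed.

(** A linear identification of the two affine charts that carries W to W; it preserves
    the multiplicity and the tangent cone without the need to compute them. *)
Definition local_isomorphism W p q := exists H H' : 'M[F]_n,
  [/\ H *m H' = 1%:M, H' *m H = 1%:M,
      forall t, W (chart p t) -> W (chart q (t *m H)) &
      forall t, W (chart q t) -> W (chart p (t *m H'))].

Lemma local_isomorphism_sym W p q : local_isomorphism W p q -> local_isomorphism W q p.
Proof. by case=> H [H' [h1 h2 h3 h4]]; exists H', H. Qed.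

Lemma local_isomorphism_trans W p q r :
  local_isomorphism W p q -> local_isomorphism W q r -> local_isomorphism W p r.
Proof.
case=> H [H' [h1 h2 h3 h4]] [K [K' [k1 k2 k3 k4]]]; exists (H *m K), (K' *m H').
split=> [||t /h3/k3|t /k4/h4]; rewrite ?mulmxA //.
  by rewrite -(mulmxA H) k1 mulmx1.
by rewrite -(mulmxA K') h2 mulmx1.
Qed.

Lemma chart_ideal_subst W p q (H : 'M[F]_n) f :
  (forall t, W (chart p t) -> W (chart q (t *m H))) ->
  chart_ideal W q f -> chart_ideal W p (f \mPo lin_subst H).
Proof. by move=> h If t /= /h Wt; rewrite meval_lin_subst; apply: If. Qed.

Lemma ideal_gen_subst (G G' : set {mpoly F[n]}) (H : 'M[F]_n) f :
  (forall g, G g -> G' (g \mPo lin_subst H)) -> ideal_gen G f -> ideal_gen G' (f \mPo lin_subst H).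
Proof.
move=> h [s [Gs ->]]; rewrite raddf_sum /= big_seq; apply: (ideal_sum (ideal_gen_is_ideal G')) => -[a g] sg /=.
rewrite comp_mpolyM; apply: (idealM (ideal_gen_is_ideal G')); apply: sub_ideal_gen; apply: h.
exact: (Gs _ sg).
Qed.

Lemma tangent_cone_subst W p q (H : 'M[F]_n) f :
  (forall t, W (chart p t) -> W (chart q (t *m H))) ->
  tangent_cone_ideal W q f -> tangent_cone_ideal W p (f \mPo lin_subst H).
Proof.
move=> h; apply: ideal_gen_subst => g [e [d [Ie low ->]]].
exists (e \mPo lin_subst H), d; split; first exact: chart_ideal_subst Ie.
  by move=> k kd; rewrite pihomog_lin_subst low // comp_mpoly0.
by rewrite pihomog_lin_subst.
Qed.

Lemma add_max_pow_subst I J (H : 'M[F]_n) r f :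
  (forall g, I g -> J (g \mPo lin_subst H)) ->
  add_max_pow I r f -> add_max_pow J r (f \mPo lin_subst H).
Proof.
move=> h [a [b [Ia br ->]]]; exists (a \mPo lin_subst H), (b \mPo lin_subst H); split; last exact: comp_mpolyD.
  exact: h.
rewrite -/(supp (fun u => r <= mdeg u)%N _) comp_mpolyEX big_seq; apply: supp_sum => m mb; apply: suppZ => u.
have /dhomogP hm : 'X_[m] \mPo lin_subst H \is (mdeg m).-homog by apply: dhomog_lin_subst; rewrite dhomogX /=.
by move=> /hm ->; exact: br.
Qed.

Lemma has_codim_subst I J (H H' : 'M[F]_n) k : H *m H' = 1%:M -> H' *m H = 1%:M ->
  (forall g, I g -> J (g \mPo lin_subst H)) -> (forall g, J g -> I (g \mPo lin_subst H')) ->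
  has_codim I k -> has_codim J k.
Proof.
move=> HH' H'H IJ JI [s [indep span]].
exists [tuple of [seq f \mPo lin_subst H | f : {mpoly F[n]} <- s]].
have sE c : \sum_(i < k) c i *: tnth [tuple of [seq f \mPo lin_subst H | f : {mpoly F[n]} <- s]] i =
  (\sum_(i < k) c i *: tnth s i) \mPo lin_subst H.
  by rewrite raddf_sum /=; apply: eq_bigr => i _; rewrite tnth_map comp_mpolyZ.
split=> [c|f].
  by rewrite sE => /JI; rewrite lin_substK //; exact: indep.
have [c Ic] := span (f \mPo lin_subst H'); exists c.
by move: Ic => /IJ; rewrite sE comp_mpolyB lin_substK.
Qed.

Lemma is_multiplicity_local W p q e : local_isomorphism W p q ->
  is_multiplicity W p e -> is_multiplicity W q e.
Proof.
case=> H [H' [h1 h2 h3 h4]] [Hf [h [cd N lead]]]; exists Hf, h; split=> // r.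
apply: (has_codim_subst h2 h1) (cd r) => g.
  by apply: add_max_pow_subst => g'; apply: chart_ideal_subst.
by apply: add_max_pow_subst => g'; apply: chart_ideal_subst.
Qed.

Lemma multiplicity_local W p q : local_isomorphism W p q -> multiplicity W p = multiplicity W q.
Proof.
move=> pq; rewrite /multiplicity; congr xget; apply/seteqP; split=> e.
  exact: is_multiplicity_local.
by apply: is_multiplicity_local; exact: local_isomorphism_sym.
Qed.

Lemma tangent_cone_local W p q : local_isomorphism W p q ->
  linearly_isomorphic (tangent_cone_ideal W p) (tangent_cone_ideal W q).
Proof.
case=> H [H' [h1 h2 h3 h4]]; exists (H'^T) => [|f].
  by rewrite unitmx_tr; case/mulmx1_unit: h2.
have -> : [tuple \sum_(k < n) H'^T j k *: 'X_k | j < n] = lin_subst H'.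
  apply: eq_from_tnth => j; rewrite !tnth_mktuple; apply: eq_bigr => k _.
  by rewrite mxE mul_mpolyC.
split; first exact: tangent_cone_subst.
move=> Tf; rewrite -[f](lin_substK _ h1); exact: tangent_cone_subst Tf.
Qed.

(** [pick] returns the first index that satisfies the condition. *)
Lemma chart_indexE p (i : 'I_n.+1) : p 0 i != 0 -> (forall j : 'I_n.+1, (j < i)%N -> p 0 j = 0) ->
  chart_index p = i.
Proof.
move=> pi low; rewrite /chart_index /pick [enum _](_ : _ = [seq j <- enum 'I_n.+1 | p 0 j != 0]); last by rewrite enumT.
rewrite -(cat_take_drop i (enum _)) (drop_nth i) ?size_enum_ord // filter_cat /= nth_ord_enum pi.
rewrite (_ : [seq j <- take _ _ | _] = [::]) //; apply/eqP; rewrite -size_eq0 size_filter -leqn0 leqNgt -has_count.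
apply/hasPn => j /(map_f val); rewrite map_take val_enum_ord take_iota mem_iota add0n => /= ji.
by rewrite low ?eqxx // (leq_trans ji) ?geq_minl.
Qed.

Definition chart_matrix p q (G : 'M[F]_n.+1) : 'M[F]_n :=
  \matrix_(k, l) G (lift (chart_index p) k) (lift (chart_index q) l).

Lemma chartE p t : p 0 (chart_index p) = 1 ->
  chart p t = p + \row_j (if unlift (chart_index p) j is Some k then t 0 k else 0).
Proof.
move=> p1; apply/rowP => j; rewrite !mxE; case: unliftP => [k ->|->]; first by rewrite p1 divr1.
by rewrite p1 addr0.
Qed.

Lemma chart_mul p q (G : 'M[F]_n.+1) t : p 0 (chart_index p) = 1 -> q 0 (chart_index q) = 1 -> p *m G = q ->
  (forall k, G (lift (chart_index p) k) (chart_index q) = 0) ->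
  chart p t *m G = chart q (t *m chart_matrix p q G).
Proof.
move=> p1 q1 pG G0; rewrite !chartE // mulmxDl pG; congr (_ + _); apply/rowP => j; rewrite !mxE.
rewrite (bigD1_ord (chart_index p)) //= mxE unlift_none mul0r add0r.
case: unliftP => [l ->|->].
  by rewrite mxE; apply: eq_bigr => k _; rewrite !mxE liftK.
by rewrite big1 // => k _; rewrite G0 mulr0.
Qed.

Lemma chart_matrixK p q (G : 'M[F]_n.+1) : G *m G = 1%:M ->
  (forall k, G (lift (chart_index p) k) (chart_index q) = 0) ->
  chart_matrix p q G *m chart_matrix q p G = 1%:M.
Proof.
move=> GG G0; apply/matrixP => k k'; rewrite !mxE.
have /matrixP/(_ (lift (chart_index p) k))/(_ (lift (chart_index p) k')) := GG.
rewrite !mxE (bigD1_ord (chart_index q)) //= G0 mul0r add0r (inj_eq (lift_inj)) => <-.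
by apply: eq_bigr => l _; rewrite !mxE.
Qed.

(** A linear involution of W that maps p to q acts linearly on the charts if it also
    exchanges their hyperplanes at infinity, which is the condition on the columns of G. *)
Lemma local_isomorphism_involution W p q (G : 'M[F]_n.+1) :
  p 0 (chart_index p) = 1 -> q 0 (chart_index q) = 1 -> p *m G = q -> G *m G = 1%:M ->
  (forall k, G (lift (chart_index p) k) (chart_index q) = 0) ->
  (forall k, G (lift (chart_index q) k) (chart_index p) = 0) ->
  (forall z, W z -> W (z *m G)) -> local_isomorphism W p q.
Proof.
move=> p1 q1 pG GG Gp Gq WG; exists (chart_matrix p q G), (chart_matrix q p G).
have qG : q *m G = p by rewrite -pG -mulmxA GG mulmx1.
split; [exact: chart_matrixK | exact: chart_matrixK | |] => t /WG.
  by rewrite (chart_mul _ p1 q1 pG).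
by rewrite (chart_mul _ q1 p1 qG).
Qed.

(** The chart depends on the point only, not on the vector that represents it. *)
Lemma chart_scale c p t : c != 0 -> chart (c *: p) t = chart p t.
Proof.
move=> c0; have e : chart_index (c *: p) = chart_index p.
  by congr odflt; apply: eq_pick => j; rewrite mxE mulf_eq0 (negbTE c0).
apply/rowP => j; rewrite !mxE e; case: unlift => [k|//]; congr (_ + _).
by rewrite -mulf_div divff // mul1r.
Qed.

Lemma local_isomorphism_same_point W p q : same_point p q -> local_isomorphism W p q.
Proof.
move=> /same_pointP[c c0 ->]; exists 1%:M, 1%:M; split=> [||t|t]; rewrite ?mulmx1 ?chart_scale //.
Qed.

End LocalInvariants.

(** * The symmetries of the threefold of genus 10 *)

Section Involutions.
Variable F : fieldType.

Lemma proj_image_invariant (T : Type) n (D : set T) (phi : T -> 'rV[F]_n) (g : T -> T) (M : 'M[F]_n) :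
  M *m M = 1%:M -> (forall x, D x -> D (g x)) -> (forall x, phi (g x) = phi x *m M) ->
  forall z, proj_image D phi z -> proj_image D phi (z *m M).
Proof.
move=> MM Dg phig z [x [Dx nz /same_pointP[c c0 ->]]]; exists (g x); split; first exact: Dg.
  by apply: contraNneq nz; rewrite phig => e; rewrite -[phi x]mulmx1 -MM mulmxA e mul0mx.
by rewrite phig; apply/same_pointP; exists c; rewrite // scalemxAl.
Qed.

Lemma proj_closure_invariant n (S : set 'rV[F]_n) (M : 'M[F]_n) :
  M *m M = 1%:M -> (forall z, S z -> S (z *m M)) ->
  forall z, proj_closure S z -> proj_closure S (z *m M).
Proof.
move=> MM SM z [nz Iz]; split.
  by apply: contraNneq nz => e; rewrite -[z]mulmx1 -MM mulmxA e mul0mx.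
move=> f If; rewrite -meval_lin_subst; apply: Iz => v /SM Sv.
by rewrite meval_lin_subst; exact: If.
Qed.

Lemma associated_same_point n (W : set 'rV[F]_n.+1) p q p' q' : same_point p p' -> same_point q q' ->
  singular_point W p' -> singular_point W q' -> associated W p q -> associated W p' q'.
Proof.
move=> pp qq sp sq [_ _ pq line]; split=> //.
  apply: contra pq => pq'; apply: same_point_trans pp (same_point_trans pq' _); exact: same_point_sym.
have /same_pointP[c _ ->] := same_point_sym pp; have /same_pointP[d _ ->] := same_point_sym qq.
by move=> a b; rewrite !scalerA; exact: line.
Qed.

End Involutions.

Section Similar.
Variable F : numClosedFieldType.
Local Notation W := (BS10 F).
Local Notation eps := (node_sign F).

Definition sign_row n (s : seq F) : 'M[F]_n.+1 := diag_mx (row_of_seq n.+1 s).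

Lemma mul_sign_row m n (s : seq F) (z : 'M[F]_(m, n.+1)) i k : (k < n.+1)%N ->
  (z *m sign_row n s) i (inord k) = z i (inord k) * s`_k.
Proof. by move=> kn; rewrite mul_mx_diag mxE row_of_seqE. Qed.

Lemma sign_rowK n (s : seq F) : (forall k, (k < n.+1)%N -> s`_k * s`_k = 1) -> sign_row n s *m sign_row n s = 1%:M.
Proof.
move=> ss; apply/matrixP => i; apply: ord_ind => k kn; rewrite mul_sign_row // !mxE.
by case: eqP => [->|_]; rewrite ?mulr1n ?mulr0n ?mul0r // inordK // ss.
Qed.

(** The change of signs of (u0, u1, u2) by (e3, e2, e1), for the signs e of the i-th node,
    multiplies the monomials x by the second list and the coordinates of W by the first;
    it exchanges the i-th node with the node of signs (1, 1, 1). *)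
Definition point_signs i := [:: 1; eps i 1; eps i 2; eps i 3; 1; eps i 1; eps i 2; eps i 3; eps i 1; eps i 2; eps i 3].
Definition sextic_signs i := [:: eps i 1; eps i 2; eps i 1; eps i 3; eps i 2; eps i 3; 1].
Definition plane_signs i := [:: eps i 3; eps i 2; eps i 1].

Lemma signs_square i : (i < 4)%N -> [/\ forall k, (k < 11)%N -> (point_signs i)`_k * (point_signs i)`_k = 1,
  forall k, (k < 7)%N -> (sextic_signs i)`_k * (sextic_signs i)`_k = 1 &
  forall k, (k < 3)%N -> (plane_signs i)`_k * (plane_signs i)`_k = 1].
Proof.
move=> i4; have [_ e1 e2 e3] := node_signP F i4; split.
- by do 11?[case=> [_|]] => //=; rewrite ?mulr1.
- by do 7?[case=> [_|]] => //=; rewrite ?mulr1.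
by do 3?[case=> [_|]] => //=; rewrite ?mulr1.
Qed.

Lemma del_pezzo6_signs i x : (i < 4)%N -> del_pezzo6 x -> del_pezzo6 (x *m sign_row 6 (sextic_signs i)).
Proof.
move=> i4; have [_ s7 _] := signs_square i4; have [e13 e11 e22 e33] := node_signP F i4.
have e3i : eps i 3 = eps i 1 * eps i 2 by rewrite -e13 mulrA e11 mul1r.
have MM := sign_rowK s7; apply: (proj_closure_invariant MM).
apply: (proj_image_invariant (g := fun u => u *m sign_row 2 (plane_signs i)) MM) => // u.
apply/rowP; apply: ord_ind => k k7; rewrite mul_sign_row //= !mul_sign_row // !row_of_seqE //.
by move: k7; do 7?[case: k => [_|k]] => //=; rewrite ?e3i; ring: e11 e22.
Qed.

Lemma BS10_signs i z : (i < 4)%N -> W z -> W (z *m sign_row 10 (point_signs i)).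
Proof.
move=> i4; have [s11 _ _] := signs_square i4; have MM := sign_rowK s11.
apply: (proj_image_invariant (g := fun yx => (yx.1, yx.2 *m sign_row 6 (sextic_signs i))) MM).
  by move=> [y x] [/= y0 dx]; split=> //; exact: del_pezzo6_signs.
move=> [y x]; apply/rowP; apply: ord_ind => k k11; rewrite mul_sign_row // /BS10_map /= !row_of_seqE // !mul_sign_row //.
by move: k11; do 11?[case: k => [_|k]] => //=; ring.
Qed.

(** The exchange of y0 and y1. *)
Definition swap_index (k : nat) : nat := nth 0%N [:: 4; 5; 6; 7; 0; 1; 2; 3; 8; 9; 10]%N k.

Definition block_swap : 'M[F]_11 := \matrix_(i, j) (i == inord (swap_index j))%:R.

Lemma mul_block_swap m (z : 'M[F]_(m, 11)) i k : (k < 11)%N ->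
  (z *m block_swap) i (inord k) = z i (inord (swap_index k)).
Proof.
move=> k11; rewrite mxE (bigD1 (inord (swap_index k))) //= big1 ?addr0 => [|j jk].
  by rewrite mxE inordK // eqxx mulr1.
by rewrite mxE inordK // (negbTE jk) mulr0.
Qed.

Lemma swap_indexK k : (k < 11)%N -> swap_index (swap_index k) = k /\ (swap_index k < 11)%N.
Proof. by do 11?[case: k => [_|k]] => //. Qed.

Lemma block_swapK : block_swap *m block_swap = 1%:M.
Proof.
apply/matrixP => i; apply: ord_ind => k k11; have [e s11] := swap_indexK k11.
by rewrite mul_block_swap // !mxE inordK // e.
Qed.

Lemma BS10_swap z : W z -> W (z *m block_swap).
Proof.
pose exch (y : 'rV[F]_2) := row_of_seq 2 [:: y 0 (inord 1); y 0 (inord 0)].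
apply: (proj_image_invariant (g := fun yx => (exch yx.1, yx.2)) block_swapK).
  move=> [y x] [/= y0 dx]; split=> //; apply: contraNneq y0 => /rowP e.
  apply/eqP/rowP; apply: ord_ind => k k2; rewrite [RHS]mxE.
  have := e (inord 0); have := e (inord 1); rewrite !row_of_seqE // ![X in _ = X -> _]mxE /= [X in _ -> _ = X -> _]mxE => e0 e1.
  by move: k2; do 2?[case: k => [_|k]].
move=> [y x]; apply/rowP; apply: ord_ind => k k11; have [_ s11] := swap_indexK k11.
rewrite mul_block_swap // /BS10_map /= !row_of_seqE //.
by move: k11 {s11}; do 11?[case: k => [_|k]] => //=; ring.
Qed.

Lemma chart_index_node b i : (i < 4)%N -> chart_index (node F b i) = inord (if b then 4 else 0)%N.
Proof.
move=> i4; apply: chart_indexE; first by rewrite node_coord0 oner_eq0.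
apply: ord_ind => k k11; rewrite !inordK //; last by case: (b).
case: b => // k4; exact: (nodeE F true i k4).1.
Qed.

Lemma node_local b i : (i < 4)%N -> local_isomorphism W (node F b i) (node F b 0).
Proof.
move=> i4; have [s11 _ _] := signs_square i4; have [_ e11 e22 e33] := node_signP F i4.
have off (j : 'I_11) k : sign_row 10 (point_signs i) (lift j k) j = 0.
  by rewrite !mxE eq_sym (negbTE (neq_lift _ _)) mulr0n.
apply: (@local_isomorphism_involution _ _ _ _ _ (sign_row 10 (point_signs i))).
- by rewrite chart_index_node // node_coord0.
- by rewrite chart_index_node // node_coord0.
- apply: row11P => k hk; rewrite mul_sign_row; try by lia.
  + rewrite !(nodeE F _ _ hk).1; case: (b); rewrite ?mul0r //.
    by move: hk; do 4?[case: k => [_|k]] => //=; rewrite ?mulr1 // -mulrA ?e11 ?e22 ?e33 mulr1.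
  + rewrite !(nodeE F _ _ hk).2; case: (b); rewrite ?mul0r //.
    by move: hk; do 4?[case: k => [_|k]] => //=; rewrite ?mulr1 // -mulrA ?e11 ?e22 ?e33 mulr1.
  by rewrite !blockE8 // mul0r.
- exact: sign_rowK.
- by move=> k; rewrite !chart_index_node.
- by move=> k; rewrite !chart_index_node.
by move=> z; exact: BS10_signs.
Qed.

Lemma swap_local : local_isomorphism W (node F true 0) (node F false 0).
Proof.
apply: (@local_isomorphism_involution _ _ _ _ _ block_swap).
- by rewrite chart_index_node // node_coord0.
- by rewrite chart_index_node // node_coord0.
- apply/rowP; apply: ord_ind => k k11; have [_ s11] := swap_indexK k11.
  rewrite mul_block_swap // /node /block !row_of_seqE //.
  by move: k11 {s11}; do 11?[case: k => [_|k]].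
- exact: block_swapK.
- move=> k; rewrite !chart_index_node // !mxE inordK //=.
  by rewrite eq_sym (negbTE (neq_lift _ _)).
- move=> k; rewrite !chart_index_node // !mxE inordK //=.
  by rewrite eq_sym (negbTE (neq_lift _ _)).
exact: BS10_swap.
Qed.

Lemma nodes_local b i : (i < 4)%N -> local_isomorphism W (node F b i) (node F false 0).
Proof.
move=> i4; case: b; last exact: node_local.
apply: local_isomorphism_trans (node_local true i4) swap_local.
Qed.

(** Nodes of one block are joined by a line of its Cayley cubic, nodes with the same
    index by the image of a line; in the remaining case a minor excludes the line. *)
Lemma associated_nodes b b' (i j : nat) : (i < 4)%N -> (j < 4)%N ->
  associated W (node F b i) (node F b' j) <-> (b == b') != (i == j).
Proof.
move=> i4 j4; split=> [[_ _ np line]|h].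
  case: (eqVneq b b') np line => [<-|bb] np line; case: (eqVneq i j) => [ij|ij] //.
    by rewrite ij same_point_refl in np.
  exfalso; apply: (nodes_not_joined (b := b) i4 j4 ij).
  have -> : ~~ b = b' by case: b b' bb {np line} => -[].
  have := line 1 1; rewrite !scale1r; apply.
  apply/eqP => /rowP/(_ (inord (if b then 4 else 0)%N)); rewrite mxE node_coord0 [RHS]mxE.
  have -> : b' = ~~ b by case: b b' bb {np line} => -[].
  have -> : node F (~~ b) j 0 (inord (if b then 4 else 0)%N) = 0.
    by case: (b); rewrite ?(nodeE F _ _ (isT : 0 < 4)%N).1 ?(nodeE F _ _ (isT : 0 < 4)%N).2.
  by rewrite addr0 => /eqP; rewrite oner_eq0.
split.
- exact: (node_singular i4 (same_point_refl _)).
- exact: (node_singular j4 (same_point_refl _)).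
- by apply/negP => /(node_inj i4 j4)[eb ei]; move: h; rewrite eb ei !eqxx.
move=> x y; case: (eqVneq b b') h => [<-|bb] /=; first by move=> _; exact: node_line.
rewrite eq_sym eqbF_neg negbK => /eqP <- nz.
case: b b' bb nz => -[] // _ nz; last exact: cross_line.
by rewrite addrC; apply: cross_line; rewrite // addrC.
Qed.

(** For a node (b, i): the three other nodes of its block, and the i-th node of the
    other block, listed in place of the node itself. *)
Lemma four_associated p : singular_point W p -> associated_with_exactly W p 4.
Proof.
move=> sp; have [b [i hp]] := singular_is_node sp.
pose c (k : 'I_4) := if k == i then ~~ b else b.
exists [tuple node F (c k) k | k < 4]; split=> [k l|q].
  by rewrite !tnth_mktuple => /(node_inj (ltn_ord k) (ltn_ord l))[_ /val_inj].
split=> [pq|[k]].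
  have [_ sq _ _] := pq; have [b' [j qj]] := singular_is_node sq.
  exists j; rewrite tnth_mktuple.
  have := associated_same_point hp qj (node_singular (ltn_ord i) (same_point_refl _))
    (node_singular (ltn_ord j) (same_point_refl _)) pq.
  rewrite associated_nodes // => h; suff -> : c j = b' by [].
  by move: h; rewrite /c -(inj_eq val_inj) [val j == _]eq_sym /=; case: (_ == _ :> nat); case: (b); case: (b').
rewrite tnth_mktuple => qk.
apply: (associated_same_point (same_point_sym hp) (same_point_sym qk) sp (node_singular (ltn_ord k) qk)).
rewrite associated_nodes // /c eq_sym -(inj_eq val_inj) /= eq_sym.
by case: (eqVneq (i : nat) k); case: (b).
Qed.

(** The symmetries permute the eight nodes transitively. *)
Lemma BS10_similar : similar_singular_points W.
Proof.
split; last by exists 4%N; exact: four_associated.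
move=> p q sp sq.
have loc z : singular_point W z -> local_isomorphism W z (node F false 0).
  move=> /singular_is_node[b [i zi]].
  exact: local_isomorphism_trans (local_isomorphism_same_point _ zi) (nodes_local b (ltn_ord i)).
have pq := local_isomorphism_trans (loc p sp) (local_isomorphism_sym (loc q sq)).
by split; [exact: multiplicity_local | exact: tangent_cone_local].
Qed.

End Similar.

Theorem theorem1p4 (R : realType) :
  [/\ (forall (q r : quad_coef R[i]) (A : 'M[R[i]]_(9, 10)),
         BS8_smooth q r -> BS8_coordinates q A ->
         generated_by_quadrics_and_cubics
           (vanishing_ideal (BS8_in_P8 q r A))),
      generated_by_quadrics_and_cubics (vanishing_ideal (BS10 R[i])),
      similar_singular_points (BS10 R[i]) &
      exists P P' : 'I_4 -> 'rV[R[i]]_11,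
        [/\ (forall z, singular_point (BS10 R[i]) z <->
               exists i, same_point z (P i) \/ same_point z (P' i)),
            [/\ (forall i j, same_point (P i) (P j) -> i = j),
                (forall i j, same_point (P' i) (P' j) -> i = j) &
                (forall i j, ~~ same_point (P i) (P' j))],
            (forall i j, i != j -> associated (BS10 R[i]) (P i) (P j) /\
                                   associated (BS10 R[i]) (P' i) (P' j)),
            (forall i, associated (BS10 R[i]) (P i) (P' i)) &
            (forall i j, i != j -> ~ associated (BS10 R[i]) (P i) (P' j))]].
Proof.
have assoc b b' (k l : 'I_4) : associated (BS10 R[i]) (node R[i] b k) (node R[i] b' l) <-> (b == b') != (k == l).
  by rewrite -(inj_eq val_inj) /=; exact: associated_nodes.
split; [by move=> q r A sm cA; exact: BS8_generated cA sm | exact: BS10_generated | exact: BS10_similar |].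
exists (fun k => node R[i] false k), (fun k => node R[i] true k); split.
- move=> z; split=> [/singular_is_node[b [k zk]]|[k [] zk]].
  + by exists k; case: b zk => zk; [right | left].
  + exact: node_singular (ltn_ord k) zk.
  exact: node_singular (ltn_ord k) zk.
- split=> k l; last by apply/negP => /(node_inj (ltn_ord k) (ltn_ord l))[].
  + by case/(node_inj (ltn_ord k) (ltn_ord l)) => _ /val_inj.
  by case/(node_inj (ltn_ord k) (ltn_ord l)) => _ /val_inj.
- by move=> k l /negbTE kl; split; apply/assoc; rewrite kl.
- by move=> k; apply/assoc; rewrite !eqxx.
by move=> k l /negbTE kl /assoc; rewrite kl.
Qed.
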